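(* Let $\mathbb{H}^2=\{(x,y)\in\mathbb{R}^2: y>0\}$ be the upper half plane model of the hyperbolic plane with the Poincaré metric $(dx^2+dy^2)/y^2$, and let $\mathbb{H}^2\times\mathbb{R}$ be its Riemannian product with the real line $(\mathbb{R},dz^2)$, with metric $g=\frac{dx^2+dy^2}{y^2}+dz^2$. Put $\theta^1=\frac{dx}{y}$, $\theta^2=\frac{dy}{y}$, $\theta^3=dz$, and let $dV_{\mathbb{H}^2}=\theta^1\wedge\theta^2$ be the area form of $\mathbb{H}^2$. Then $\mathbb{H}^2\times\mathbb{R}$ admits, up to isomorphism, two types of homogeneous structure tensors: $$T^{\lambda}=\lambda\,\theta^3\otimes(\theta^1\wedge\theta^2)=\lambda\,(\theta^3\otimes dV_{\mathbb{H}^2})\qquad(\lambda\ge 0),$$ $$T=\theta^1\otimes(\theta^1\wedge\theta^2)=\theta^1\otimes dV_{\mathbb{H}^2}.$$ That is, $T$ and each $T^\lambda$ with $\lambda\ge0$ are homogeneous structure tensors on $(\mathbb{H}^2\times\mathbb{R},g)$, and every homogeneous structure tensor on $(\mathbb{H}^2\times\mathbb{R},g)$ is isomorphic to exactly one member of the list consisting of $T$ and the $T^\lambda$, $\lambda\ge 0$. Moreover, the coset space representation corresponding to $T^\lambda$ is $\mathbb{H}^2\times\mathbb{R}=(\mathrm{SL}(2,\mathbb{R})\times\mathbb{R})/\mathrm{SO}(2)$ for each $\lambda\ge 0$, and the one corresponding to $T$ is $\mathbb{H}^2\times\mathbb{R}=(\mathbb{H}^2\times\mathbb{R})/\{\mathrm{Id}\}$,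 where in the latter $\mathbb{H}^2\times\mathbb{R}$ is regarded as a solvable Lie group with left-invariant metric.
   Context: **Homogeneous structure tensor.** Let $(M,g)$ be a Riemannian manifold with Levi-Civita connection $\nabla$ and curvature tensor field $R$. A homogeneous (Riemannian) structure tensor on $(M,g)$ is a tensor field $T$ of type $(1,2)$ on $M$, written $(X,Y)\mapsto T_XY$, such that the affine connection $\tilde\nabla=\nabla-T$ (i.e. $\tilde\nabla_XY=\nabla_XY-T_XY$) satisfies $\tilde\nabla g=0$, $\tilde\nabla R=0$ and $\tilde\nabla T=0$. The covariant tensor field $(X,Y,Z)\mapsto g(T_XY,Z)$ is denoted by the same letter $T$; so $T=\omega\otimes\beta$ with a 1-form $\omega$ and a 2-form $\beta$ means $g(T_XY,Z)=\omega(X)\beta(Y,Z)$. The wedge product convention is $\theta^1\wedge\theta^2=\theta^1\otimes\theta^2-\theta^2\otimes\theta^1$. **Isomorphism.** Homogeneous structure tensors $T$ on $(M,g)$ and $T'$ on $(M',g')$ are isomorphic if there is an isometry $\phi:(M,g)\to(M',g')$ such that $\phi_*(T_XY)=T'_{\phi_*X}\phi_*Y$ for all vector fields $X,Y$ on $M$. **Corresponding coset space representation.** Let $G$ be a connected Lie group acting transitively by isometries on $M$, let $H$ be the isotropy group at a point $o\in M$, so $M=G/H$, and let $\mathfrak g,\mathfrak h$ be the Lie algebras of $G$ and $H$. A reductive decomposition is a direct sum decomposition $\mathfrak g=\mathfrak m\oplus\mathfrak h$ with $\mathfrak m$ an $\mathrm{Ad}(H)$-invariant linear subspace. For $X\in\mathfrak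 g$ let $X^*$ be the vector field on $M$ given by $X^*_p=\frac{d}{dt}\exp(tX)\cdot p\,|_{t=0}$; the map $\tau:\mathfrak m\to T_oM$, $\tau(X)=X^*_o$, is an isomorphism. The reductive decomposition determines a homogeneous structure tensor $T$, namely the $G$-invariant tensor field whose value at $o$ is given, for $u=\tau(X)$, $v=\tau(Y)$, $w=\tau(Z)$ with $X,Y,Z\in\mathfrak m$, by $$2g(T_uv,w)_o=g([X,Y]^*,Z^* )_o-g([Y,Z]^*,X^* )_o+g([Z,X]^*,Y^* )_o .$$ Saying that the coset space representation corresponding to $T$ is $M=G/H$ means that $T$ is determined in this way by some reductive decomposition of $\mathfrak g$ with respect to $\mathfrak h$. In the case of a Lie group $G$ with left-invariant metric acting on itself by left translations, $H=\{\mathrm{Id}\}$ and $\mathfrak m=\mathfrak g$, and $T$ is the left-invariant tensor with $2g(T_XY,Z)=g([X,Y],Z)-g([Y,Z],X)+g([Z,X],Y)$ for $X,Y,Z\in\mathfrak g$. **The two groups.** $\mathrm{SL}(2,\mathbb{R})\times\mathbb{R}$ acts isometrically on $\mathbb{H}^2\times\mathbb{R}$, with $w=x+yi$, by $$\left(\begin{pmatrix}a&b\\c&d\end{pmatrix},s\right)\cdot(w,z)=\left(\frac{aw+b}{cw+d},\,z+s\right),$$ and the isotropy group at $o=(i,0)$ is $\mathrm{SO}(2)$. The solvable Lie group structure on $\mathbb{H}^2\times\mathbb{R}$ is obtained by identifying $(x,y,z)$ with the matrix $\begin{pmatrix}y&x&0\\0&1&0\\0&0&e^z\end{pmatrix}$,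 $x,y,z\in\mathbb{R}$, $y>0$; the metric $g$ is left-invariant for it. *)

(* Defs.v *)
From HB Require Import structures.
From mathcomp Require Import all_boot all_order all_algebra.
From mathcomp Require Import all_classical all_reals all_analysis.
From mathcomp Require Import complex.

Set Implicit Arguments.
Unset Strict Implicit.
Unset Printing Implicit Defensive.

Import Order.TTheory GRing.Theory Num.Theory.
Import numFieldNormedType.Exports.

Local Open Scope classical_set_scope.
Local Open Scope ring_scope.

Section Smooth.
Context {R : realType} {V W : normedModType R}.

(* For A open: f is of class C^n on A.  In finite dimension, continuity of all
   n-fold iterated directional derivatives is the usual notion. *)
Fixpoint class_C (n : nat) (A : set V) (f : V -> W) : Prop :=
  match n with
  | 0%N => forall p, A p -> {for p, continuous f}
  | n'.+1 => forall v : V,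
      (forall p, A p -> derivable f p v) /\ class_C n' A (fun p => 'D_v f p)
  end.

Definition smooth (A : set V) (f : V -> W) : Prop := forall n, class_C n A f.

(* Smoothness on a subset that need not be open (here: a submanifold). *)
Definition smooth_ext (A : set V) (f : V -> W) : Prop :=
  exists (U : set V) (F : V -> W),
    [/\ open U, A `<=` U, smooth U F & forall p, A p -> F p = f p].

End Smooth.

(* M is an open subset of R^n.  It carries the global chart given by the inclusion, so every tangent space is
   'rV[R]_n.  Fields on M are total functions of the point; only their values at
   the points of M matter. *)

Section Geometry.
Context {R : realType} {n : nat}.
Local Notation V := 'rV[R]_n.

Definition vfield := V -> V.
Definition form1 := V -> V -> R.
Definition form2 := V -> V -> V -> R.            (* also used for metrics *)
Definition tensor03 := V -> V -> V -> V -> R.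
Definition tensor12 := V -> V -> V -> V.         (* T p u v is (T_u v)_p *)

Implicit Types (M : set V) (g : form2) (T : tensor12) (X Y Z W : vfield).

(* a ^ b = a (x) b - b (x) a, without a factor 1/2. *)
Definition wedge1 (a b : form1) : form2 :=
  fun p u v => a p u * b p v - b p u * a p v.

Definition tens12 (w : form1) (b : form2) : tensor03 :=
  fun p u v x => w p u * b p v x.

(* The (1,2)-tensor T with g(T_u v, x) = S(u, v, x): the last index is raised
   with the inverse of the Gram matrix of g. *)
Definition raise g (S : tensor03) : tensor12 := fun p u v =>
  (\row_k S p u v (delta_mx 0 k)) *m
  invmx (\matrix_(i, j) g p (delta_mx 0 i) (delta_mx 0 j)).

Definition tensor_field M T : Prop :=
  (forall p, M p -> forall (a : R) (u u' v : V),
     T p (a *: u + u') v = a *: T p u v + T p u' v) /\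
  (forall p, M p -> forall (a : R) (u v v' : V),
     T p u (a *: v + v') = a *: T p u v + T p u v') /\
  (forall X Y, smooth M X -> smooth M Y -> smooth M (fun p => T p (X p) (Y p))).

Definition lie_bracket X Y : vfield :=
  fun p => 'D_(X p) Y p - 'D_(Y p) X p.

Definition affine_connection M (nabla : vfield -> vfield -> vfield) : Prop :=
  (forall X Y, smooth M X -> smooth M Y -> smooth M (nabla X Y)) /\
  (forall X X' Y, smooth M X -> smooth M X' -> smooth M Y -> forall p, M p ->
     nabla (fun q => X q + X' q) Y p = nabla X Y p + nabla X' Y p) /\
  (forall (f : V -> R) X Y, smooth M f -> smooth M X -> smooth M Y ->
     forall p, M p ->
     nabla (fun q => f q *: X q) Y p = f p *: nabla X Y p) /\
  (forall X Y Y', smooth M X -> smooth M Y -> smooth M Y' -> forall p, M p ->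
     nabla X (fun q => Y q + Y' q) p = nabla X Y p + nabla X Y' p) /\
  (forall (f : V -> R) X Y, smooth M f -> smooth M X -> smooth M Y ->
     forall p, M p ->
     nabla X (fun q => f q *: Y q) p = 'D_(X p) f p *: Y p + f p *: nabla X Y p).

Definition parallel_metric M g (nabla : vfield -> vfield -> vfield) : Prop :=
  forall X Y Z, smooth M X -> smooth M Y -> smooth M Z -> forall p, M p ->
    'D_(X p) (fun q => g q (Y q) (Z q)) p
    = g p (nabla X Y p) (Z p) + g p (Y p) (nabla X Z p).

Definition levi_civita M g (nabla : vfield -> vfield -> vfield) : Prop :=
  [/\ affine_connection M nabla,
      parallel_metric M g nabla
    & forall X Y, smooth M X -> smooth M Y -> forall p, M p ->
        nabla X Y p - nabla Y X p = lie_bracket X Y p].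

Definition curvature (nabla : vfield -> vfield -> vfield) X Y Z : vfield :=
  fun p => nabla X (nabla Y Z) p - nabla Y (nabla X Z) p
           - nabla (lie_bracket X Y) Z p.

(* nt Rm = 0 for a tensor field Rm of type (1,3), given by its action on
   vector fields. *)
Definition parallel13 M (nt : vfield -> vfield -> vfield)
    (Rm : vfield -> vfield -> vfield -> vfield) : Prop :=
  forall X Y Z W, smooth M X -> smooth M Y -> smooth M Z -> smooth M W ->
  forall p, M p ->
    nt X (Rm Y Z W) p - Rm (nt X Y) Z W p - Rm Y (nt X Z) W p
    - Rm Y Z (nt X W) p = 0.

Definition parallel12 M (nt : vfield -> vfield -> vfield) T : Prop :=
  forall X Y Z, smooth M X -> smooth M Y -> smooth M Z -> forall p, M p ->
    nt X (fun q => T q (Y q) (Z q)) p - T p (nt X Y p) (Z p)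
    - T p (Y p) (nt X Z p) = 0.

Definition homogeneous_structure M g T : Prop :=
  tensor_field M T /\
  exists2 nabla, levi_civita M g nabla &
    let nt X Y := fun p => nabla X Y p - T p (X p) (Y p) in
    [/\ parallel_metric M g nt,
        parallel13 M nt (curvature nabla)
      & parallel12 M nt T].

Definition isometry M g (M' : set V) (g' : form2) (phi : V -> V) : Prop :=
  [/\ smooth M phi,
      exists psi : V -> V,
        [/\ smooth M' psi,
            forall p, M p -> M' (phi p) /\ psi (phi p) = p
          & forall q, M' q -> M (psi q) /\ phi (psi q) = q]
    & forall p, M p -> forall u v : V,
        g' (phi p) ('d phi p u) ('d phi p v) = g p u v].

Definition intertwines M T (T' : tensor12) (phi : V -> V) : Prop :=
  forall p, M p -> forall u v : V,
    'd phi p (T p u v) = T' (phi p) ('d phi p u) ('d phi p v).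

Definition isomorphic M g T (M' : set V) (g' : form2) (T' : tensor12) : Prop :=
  exists2 phi, isometry M g M' g' phi & intertwines M T T' phi.

End Geometry.

Section LieGroups.
Context {R : realType} {k : nat}.
Local Notation gl := 'M[R]_k.+1.

Definition expmx (X : gl) : gl :=
  limn (series (fun i : nat => (i`!%:R)^-1 *: X ^+ i)).

Definition matrix_lie_group (G : set gl) : Prop :=
  [/\ exists2 C : set gl, closed C & G = C `&` [set P | P \in unitmx],
      G 1,
      forall P Q, G P -> G Q -> G (P * Q)
    & forall P, G P -> G P^-1].

Definition lie_algebra (G : set gl) : set gl :=
  [set X | forall t : R, G (expmx (t *: X))].

Definition brk (X Y : gl) : gl := X * Y - Y * X.

Definition reductive_decomposition (G H : set gl) (m : {vspace gl}) : Prop :=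
  [/\ forall X, X \in m -> lie_algebra G X,
      forall X, X \in m -> lie_algebra H X -> X = 0,
      forall X, lie_algebra G X ->
        exists Y Z, [/\ Y \in m, lie_algebra H Z & X = Y + Z]
    & forall h X, H h -> X \in m -> h * X * h^-1 \in m].

Context {n : nat}.
Local Notation V := 'rV[R]_n.

Definition fundamental (act : gl -> V -> V) (X : gl) : V -> V :=
  fun p => derive1 (fun t : R => act (expmx (t *: X)) p) 0.

Definition transitive_isometric_action (M : set V) (g : form2) (G : set gl)
    (act : gl -> V -> V) : Prop :=
  [/\ smooth_ext [set Pp : gl * V | G Pp.1 /\ M Pp.2]
        (fun Pp : gl * V => act Pp.1 Pp.2),
      forall p, M p -> act 1 p = p,
      forall P Q p, G P -> G Q -> M p -> act (P * Q) p = act P (act Q p),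
      forall P, G P -> isometry M g M g (act P)
    & forall p q, M p -> M q -> exists2 P, G P & act P p = q].

Definition determined_by (M : set V) (g : form2) (G : set gl)
    (act : gl -> V -> V) (o : V) (m : {vspace gl}) (T : tensor12) : Prop :=
  [/\ tensor_field M T,
      forall P, G P -> intertwines M T T (act P)
    & forall X Y Z, X \in m -> Y \in m -> Z \in m ->
        let st := fun A => fundamental act A o in
        2 * g o (T o (st X) (st Y)) (st Z)
        = g o (st (brk X Y)) (st Z) - g o (st (brk Y Z)) (st X)
          + g o (st (brk Z X)) (st Y)].

Definition coset_representation (M : set V) (g : form2) (T : tensor12)
    (G : set gl) (act : gl -> V -> V) (o : V) (H : set gl) : Prop :=
  [/\ matrix_lie_group G /\ connected G,
      transitive_isometric_action M g G act,
      M o /\ H = [set P | G P /\ act P o = o]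
    & exists2 m : {vspace gl}, reductive_decomposition G H m &
        determined_by M g G act o m T].

End LieGroups.

Section H2xR.
Context {R : realType}.
Local Notation V := 'rV[R]_3.

Definition cx (v : V) : R := v 0 0.
Definition cy (v : V) : R := v 0 1.
Definition cz (v : V) : R := v 0 ord_max.
Definition pt (x y z : R) : V := \row_i [:: x; y; z]`_i.

Definition H2xR : set V := [set p | 0 < cy p].

Definition gH2xR : form2 := fun p u v =>
  (cx u * cx v + cy u * cy v) / cy p ^+ 2 + cz u * cz v.

Definition theta1 : form1 := fun p u => cx u / cy p.
Definition theta2 : form1 := fun p u => cy u / cy p.
Definition theta3 : form1 := fun p u => cz u.
Definition dVH2 : form2 := wedge1 theta1 theta2.

Definition T_product (l : R) : tensor12 :=
  raise gH2xR (fun p u v w => l * tens12 theta3 dVH2 p u v w).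

Definition T_solvable : tensor12 := raise gH2xR (tens12 theta1 dVH2).

(* The index set of the list: Some l for T^l with l >= 0, None for T. *)
Definition listed (c : option R) : Prop :=
  if c is Some l then 0 <= l else True.

Definition T_listed (c : option R) : tensor12 :=
  if c is Some l then T_product l else T_solvable.

Definition origin : V := pt 0 1 0.

(* The additive group R is realised as the positive numbers through exp:
   (A, s) is the block matrix diag(A, e^s). *)
Definition SL2xR_elt (A : 'M[R]_2) (s : R) : 'M[R]_3 :=
  block_mx A 0 0 (expR s)%:M : 'M[R]_(2 + 1).

Definition SL2xR : set 'M[R]_3 :=
  [set P | exists A s, \det A = 1 /\ P = SL2xR_elt A s].

Definition SO2 : set 'M[R]_3 :=
  [set P | exists A, [/\ A *m A^T = 1%:M, \det A = 1 & P = SL2xR_elt A 0]].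

Definition moebius (a b c d : R) (w : R[i]) : R[i] :=
  ((a%:C * w + b%:C) / (c%:C * w + d%:C))%C.

Definition act_SL2xR (P : 'M[R]_3) (p : V) : V :=
  let w := moebius (P 0 0) (P 0 1) (P 1 0) (P 1 1) (cx p +i* cy p)%C in
  pt (complex.Re w) (complex.Im w) (cz p + ln (P ord_max ord_max)).

Definition solv_elt (p : V) : 'M[R]_3 :=
  \matrix_(i < 3, j < 3)
    nth 0 (nth [::] [:: [:: cy p; cx p; 0];
                        [:: 0; 1; 0];
                        [:: 0; 0; expR (cz p)]] i) j.

Definition Solv : set 'M[R]_3 := solv_elt @` H2xR.

(* Left translation, read through the identification solv_elt (whose inverse
   on Solv appears here explicitly). *)
Definition act_Solv (P : 'M[R]_3) (p : V) : V :=
  let Q := P *m solv_elt p in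
  pt (Q 0 1) (Q 0 0) (ln (Q ord_max ord_max)).

End H2xR.

(* Main.v *)
(* In the chart, the Levi-Civita connection of [H^2 x R] is [D_X Y + Gamma(X, Y)] and
   its curvature is parallel.  Hence [nabla~ R = 0] says that every [T_X] acts
   trivially on the curvature; being also skew, [T_X = w(X) J] with [J] the rotation
   of the hyperbolic factor, and [nabla~ T = 0] becomes
   [nabla_u w = - w(u) w o J] for the 1-form [w = a dx + b dy + c dz].
   The symmetry of the second derivatives of [a] and [b] forces either [a = b = 0]
   with [c] constant, or [c = 0] and [|w| = 1].  In the first case [T = T^c], and the
   reflection of the line changes the sign of [c].  In the second case the geodesics
   tangent to the kernel of [w] meet at one boundary point of [H^2]; this point is a
   constant of the system and determines [w], it is infinity exactly for [theta1],
   and the inversion moving it to infinity carries [T] to [theta1 (x) dV].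
   Two listed tensors are told apart at one point: [T_(T_u v) w] vanishes identically
   for [T^l] but not for [theta1 (x) dV], and [l] is the norm of [T^l].
   For the coset representation of [T^l] the complement of [so(2)] consists of the
   symmetric traceless matrices and the line spanned by [(l/2 J, 1)]. *)
Require Import Defs.
From HB Require Import structures.
From mathcomp Require Import all_boot all_order all_algebra.
From mathcomp Require Import all_classical all_reals all_analysis.
From mathcomp Require Import complex ring lra.

Set Implicit Arguments.
Unset Strict Implicit.
Unset Printing Implicit Defensive.

Import Order.TTheory GRing.Theory Num.Theory.
Import numFieldNormedType.Exports.

Local Open Scope classical_set_scope.
Local Open Scope ring_scope.

(** * Smooth maps on open sets *)

Section DirectionalDerivative.
Context {R : realType} {U : normedModType R}.
Implicit Types (p v : U) (f g : U -> R) (A : set U).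

(** [smooth] speaks of iterated directional derivatives only, so linearity of ['D_v f p] in [v] and
    symmetry of second derivatives have to be extracted from the mean value theorem. A homogeneous
    structure comes with some Levi-Civita connection, known only through its values on global smooth
    fields; it is identified with the explicit one by evaluation on the constant frame [e1], [e2],
    [e3]. The system for [w] is never integrated: it is overdetermined, and mixed derivatives
    together with first integrals on the convex set [H2xR] determine its solutions. The danger there
    is a vanishing denominator, as the boundary point may be infinity; hence the homogeneous
    treatment of that point. The matrix exponential is not computed in full either: derivatives at
    0, linear relations between entries of powers and scalar linear equations yield the Lie algebras
    and the fundamental fields. Both groups act by maps [mobius_map], so one computation of
    differential, isometry and composition serves both. *)

Lemma is_derive_fun_cst {W : normedModType R} (c : W) p v :
  is_derive p v (fun=> c) 0.
Proof. exact: is_derive_cst. Qed.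

Lemma is_derive_funD {W : normedModType R} (f g : U -> W) p v df dg :
  is_derive p v f df -> is_derive p v g dg ->
  is_derive p v (fun q => f q + g q) (df + dg).
Proof. exact: is_deriveD. Qed.

Lemma is_derive_funN {W : normedModType R} (f : U -> W) p v df :
  is_derive p v f df -> is_derive p v (fun q => - f q) (- df).
Proof. exact: is_deriveN. Qed.

Lemma is_derive_funB {W : normedModType R} (f g : U -> W) p v df dg :
  is_derive p v f df -> is_derive p v g dg ->
  is_derive p v (fun q => f q - g q) (df - dg).
Proof. exact: is_deriveB. Qed.

Lemma is_derive_funM f g p v df dg :
  is_derive p v f df -> is_derive p v g dg ->
  is_derive p v (fun q => f q * g q) (f p * dg + g p * df).
Proof. exact: is_deriveM. Qed.

Lemma is_derive_funX f p v df n : is_derive p v f df ->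
  is_derive p v (fun q => f q ^+ n) (n%:R * f p ^+ n.-1 * df).
Proof.
move=> h; have := is_deriveX n h.
by rewrite (_ : f ^+ n = fun q => f q ^+ n)//; apply/funext => q; rewrite exprfctE.
Qed.

Lemma is_derive_funV f p v df : f p != 0 -> is_derive p v f df ->
  is_derive p v (fun q => (f q)^-1) (- (f p ^- 2) * df).
Proof.
move=> fp0 [h1 h2]; split; first exact: (derivableV fp0 h1).
by rewrite deriveV// h2.
Qed.

(** Reduction to one variable: through it the chain rule and the mean value theorem on [R] apply
    along lines. *)
Lemma is_derive_lineP {W : normedModType R} (f : U -> W) p v df :
  is_derive p v f df <-> is_derive (0 : R) 1 (fun h : R => f (h *: v + p)) df.
Proof.
have E : 'D_v f p = 'D_1 (fun h : R => f (h *: v + p)) (0 : R).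
  rewrite /derive; set g1 := fun h => h^-1 *: _; set g2 := fun h => h^-1 *: _.
  suff -> : g1 = g2 by [].
  by apply/funext => h; rewrite /g1 /g2 /= addr0 scale0r add0r [_%:A]mulr1.
split => -[h1 h2]; split.
- exact: (derivable1P f p v).1.
- by rewrite -E.
- exact: (derivable1P f p v).2.
- by rewrite E.
Qed.

Lemma is_derive_fun_comp (F : R -> R) f p v dF df :
  is_derive (f p) 1 F dF -> is_derive p v f df ->
  is_derive p v (fun q => F (f q)) (dF * df).
Proof.
move=> hF /is_derive_lineP hf; apply/is_derive_lineP.
have hF' : is_derive ((fun h : R => f (h *: v + p)) 0) 1 F dF.
  by rewrite /= scale0r add0r.
exact: (@is_derive1_comp _ F (fun h => f (h *: v + p)) 0 dF df).
Qed.

Lemma is_derive_linear {W : normedModType R} (L : {linear U -> W}) p v :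
  is_derive p v L (L v).
Proof.
have E : (fun h : R => h^-1 *: ((L \o shift p) (h *: v) - L p)) @ 0^' --> L v.
  apply: cvg_near_cst; near=> h.
  rewrite /= (linearD L) addrK linearZZ scalerA mulVf ?scale1r//.
  by near: h; exact: nbhs_dnbhs_neq.
split; first by apply/cvg_ex; exists (L v).
exact: cvg_lim E.
Unshelve. all: by end_near. Qed.

Lemma is_derive_mxP {m n} (F : U -> 'M[R]_(m, n)) p v dF :
  is_derive p v F dF <-> forall i j, is_derive p v (fun q => F q i j) (dF i j).
Proof.
split=> [[h1 h2] i j|h].
  split; first exact: (proj1 (derivable_mxP F p v) h1 i j).
  by rewrite -h2 derive_mx// mxE.
have d : derivable F p v by apply/derivable_mxP => i j; case: (h i j).
split=> //; rewrite derive_mx//; apply/matrixP => i j; rewrite mxE.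
by case: (h i j).
Qed.

Lemma is_derive_near_eq {W : normedModType R} A (f g : U -> W) p v df :
  open A -> A p -> (forall q, A q -> f q = g q) ->
  is_derive p v f df -> is_derive p v g df.
Proof.
move=> oA Ap fg; apply: near_eq_is_derive.
by apply: filterS (open_nbhs_nbhs (conj oA Ap)) => q; exact: fg.
Qed.

Lemma derive_scale {W : normedModType R} (f : U -> W) p v (a : R) :
  derivable f p v -> is_derive p (a *: v) f (a *: 'D_v f p).
Proof.
move=> df; have [->|a0] := eqVneq a 0.
  by rewrite !scale0r; exact: is_derive0.
have E : (fun h : R => h^-1 *: ((f \o shift p) (h *: (a *: v)) - f p)) @ 0^' -->
    a *: 'D_v f p.
  (* Substituting [h * a] for the increment preserves punctured neighbourhoods of 0 because
     [a != 0]; hence the separate case above. *)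
  rewrite [X in X @ _](_ : _ = (fun h => a *: h) \o
    ((fun h => h^-1 *: ((f \o shift p) (h *: v) - f p)) \o (fun h => h * a))).
    apply: (@cvg_comp _ _ _ _ _ _ (nbhs ('D_v f p))).
      apply: (@cvg_comp _ _ _ _ _ _ (0 : R)^').
        apply: cvg_trans (_ : 0^' --> (0 : R)^') => //.
        move=> S [e /= e0 eS]; exists (e / `|a|) => /=.
          by rewrite divr_gt0// normr_gt0.
        move=> h; rewrite /ball_/= sub0r normrN => he h0.
        apply: eS => /=; last by rewrite mulf_neq0.
        by rewrite /ball_/= sub0r normrN normrM -ltr_pdivlMr ?normr_gt0.
      exact: df.
    exact: scaler_continuous.
  by apply/funext => h /=; rewrite !scalerA invfM mulrCA divff// mulr1.
split; first by apply/cvg_ex; exists (a *: 'D_v f p).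
exact: cvg_lim E.
Qed.

End DirectionalDerivative.

Section SmoothClosure.
Context {R : realType} {U : normedModType R} (A : set U).
Hypothesis openA : open A.
Implicit Types (f g : U -> R).

Lemma class_C_eq {W : normedModType R} n (f g : U -> W) :
  (forall p, A p -> f p = g p) -> class_C n A f -> class_C n A g.
Proof.
elim: n f g => [|n IH] f g fg /=.
  move=> cf p Ap; have := cf p Ap; rewrite /prop_for /continuous_at (fg _ Ap).
  apply: cvg_trans; apply: near_eq_cvg.
  by apply: filterS (open_nbhs_nbhs (conj openA Ap)) => q /fg.
move=> h v; case: (h v) => h1 h2.
have d p (Ap : A p) : is_derive p v g ('D_v f p).
  exact: (is_derive_near_eq openA Ap fg (derivableP (h1 p Ap))).
split; first by move=> p /d[].
by apply: IH h2 => p /d[].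
Qed.

(** The induction step of the closure properties below: it trades ['D_v f], a limit controlled only
    on [A], for an explicit formula [df]. *)
Lemma class_CS {W : normedModType R} n (f df : U -> W) v :
  (forall p, A p -> is_derive p v f (df p)) -> class_C n A df ->
  (forall p, A p -> derivable f p v) /\ class_C n A ('D_v f).
Proof.
move=> h c; split; first by move=> p /h[].
by apply: class_C_eq c => p /h[].
Qed.

Lemma smooth_eq {W : normedModType R} (f g : U -> W) :
  (forall p, A p -> f p = g p) -> smooth A f -> smooth A g.
Proof. by move=> fg sf n; exact: class_C_eq (sf n). Qed.

Lemma smooth_is_derive {W : normedModType R} (f : U -> W) p v :
  smooth A f -> A p -> is_derive p v f ('D_v f p).
Proof. by move=> sf Ap; apply/derivableP; exact: (sf 1%N v).1. Qed.

Lemma smooth_derive {W : normedModType R} (f : U -> W) v :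
  smooth A f -> smooth A ('D_v f).
Proof. by move=> sf n; case: (sf n.+1 v). Qed.

Lemma smooth_continuous {W : normedModType R} (f : U -> W) p :
  smooth A f -> A p -> {for p, continuous f}.
Proof. by move=> sf; exact: (sf 0%N). Qed.

Lemma smooth_cst {W : normedModType R} (c : W) : smooth A (fun=> c).
Proof.
move=> n; elim: n c => [|n IH] c /=; first by move=> p _; exact: cst_continuous.
move=> v; apply: class_CS (IH 0) => p _; exact: is_derive_fun_cst.
Qed.

Lemma smooth_linear {W : normedModType R} (L : {linear U -> W}) :
  continuous L -> smooth A L.
Proof.
move=> cL [|n] /=; first by move=> p _; exact: cL.
move=> v; apply: class_CS (smooth_cst (L v) n) => p _; exact: is_derive_linear.
Qed.

Lemma class_CD {W : normedModType R} n (f g : U -> W) : class_C n A f ->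
  class_C n A g -> class_C n A (fun q => f q + g q).
Proof.
elim: n f g => [|n IH] f g hf hg /=.
  by move=> p Ap; apply: continuousD; [exact: hf|exact: hg].
move=> v; case: (hf v) (hg v) => f1 f2 [g1 g2].
by apply: class_CS (IH _ _ f2 g2) => p Ap;
  apply: is_derive_funD; apply/derivableP; [exact: f1|exact: g1].
Qed.

Lemma smoothD {W : normedModType R} (f g : U -> W) : smooth A f -> smooth A g ->
  smooth A (fun q => f q + g q).
Proof. by move=> sf sg n; exact: class_CD. Qed.

Lemma smoothN {W : normedModType R} (f : U -> W) : smooth A f ->
  smooth A (fun q => - f q).
Proof.
move=> sf n; elim: n f sf => [|n IH] f sf /=.
  by move=> p Ap; apply: continuousN; exact: smooth_continuous Ap.
move=> v; apply: class_CS (IH _ (smooth_derive v sf)) => p Ap.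
exact/is_derive_funN/smooth_is_derive.
Qed.

Lemma smoothB {W : normedModType R} (f g : U -> W) : smooth A f -> smooth A g ->
  smooth A (fun q => f q - g q).
Proof. by move=> sf sg; apply: smoothD => //; exact: smoothN. Qed.

Lemma smoothM f g : smooth A f -> smooth A g -> smooth A (fun q => f q * g q).
Proof.
move=> sf sg n; elim: n f g sf sg => [|n IH] f g sf sg /=.
  by move=> p Ap; apply: continuousM; exact: smooth_continuous Ap.
move=> v; apply: class_CS (class_CD (IH _ _ sf (smooth_derive v sg))
  (IH _ _ sg (smooth_derive v sf))) => p Ap.
by apply: is_derive_funM; exact: smooth_is_derive.
Qed.

Lemma smoothX f k : smooth A f -> smooth A (fun q => f q ^+ k).
Proof.
move=> sf; elim: k => [|k IH]; first exact: smooth_cst.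
by apply: smooth_eq (smoothM sf IH) => p _; rewrite exprS.
Qed.

(* Iterating [D (1/f) = - Df / f^2] yields products of smooth functions with
   powers of [1/f], which is why the induction carries a smooth factor. *)
Lemma class_C_divr n f g k : smooth A f -> smooth A g ->
  (forall p, A p -> f p != 0) -> class_C n A (fun q => g q * (f q)^-1 ^+ k).
Proof.
elim: n g k => [|n IH] g k sf sg f0 /=.
  move=> p Ap; apply: continuousM; first exact: smooth_continuous.
  apply: (@continuous_comp _ _ _ (fun q => (f q)^-1) (fun z => z ^+ k)).
    by apply: continuousV; [exact: f0|exact: smooth_continuous].
  exact: exprn_continuous.
move=> v; have s : smooth A (fun q => f q * 'D_v g q - k%:R * (g q * 'D_v f q)).
  apply: smoothB; first exact: smoothM (smooth_derive v sg).
  apply: smoothM; first exact: smooth_cst.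
  exact: smoothM (smooth_derive v sf).
apply: class_CS (IH _ k.+1 sf s f0) => p Ap.
apply: is_derive_eq (is_derive_funM (smooth_is_derive v sg Ap)
  (is_derive_funX k (is_derive_funV (f0 _ Ap) (smooth_is_derive v sf Ap)))) _.
have fp0 := f0 p Ap; case: k {s} => [|k].
  by rewrite !mul0r mulr0 add0r subr0 expr1 expr0; field.
by rewrite (exprS _ k.+1) (exprS _ k) /= expr2; field.
Qed.

Lemma smoothV f : smooth A f -> (forall p, A p -> f p != 0) ->
  smooth A (fun q => (f q)^-1).
Proof.
move=> sf f0 n; have := class_C_divr n 1%N sf (smooth_cst (1 : R)) f0.
apply: class_C_eq => p _.
by rewrite mul1r expr1.
Qed.

Lemma smooth_ln f : smooth A f -> (forall p, A p -> 0 < f p) ->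
  smooth A (fun q => ln (f q)).
Proof.
move=> sf f0; have f0' p : A p -> f p != 0 by move=> /f0 /lt0r_neq0.
case=> [|n] /=.
  move=> p Ap; apply: (@continuous_comp _ _ _ f (@ln R)).
    exact: smooth_continuous.
  by apply: continuous_ln; exact: f0.
move=> v; apply: class_CS (smoothM (smoothV sf f0') (smooth_derive v sf) n) => p Ap.
apply: is_derive_fun_comp (smooth_is_derive v sf Ap).
by apply: is_derive1_ln; exact: f0.
Qed.

Lemma smooth_mxP {m n} (F : U -> 'M[R]_(m.+1, n.+1)) :
  smooth A F <-> forall i j, smooth A (fun q => F q i j).
Proof.
split=> [sF i j|].
  move=> k; elim: k F sF => [|k IH] F sF /=.
    move=> p Ap; apply: (@continuous_comp _ _ _ F (fun M : 'M[R]_(m.+1, n.+1) => M i j)).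
      exact: smooth_continuous.
    exact: coord_continuous.
  move=> v; apply: class_CS (IH _ (smooth_derive v sF)) => p Ap.
  exact: (proj1 (is_derive_mxP _ _ _ _) (smooth_is_derive v sF Ap)).
move=> h k; elim: k F h => [|k IH] F h /=.
  move=> p Ap; apply/cvgrPdist_lt => e e0.
  near=> q; rewrite [ltLHS]/Num.Def.normr/= mx_normrE.
  apply: bigmax_lt => //= ij _; rewrite !mxE.
  (* The matrix norm is the largest entry, so closeness is a finite intersection of entrywise
     conditions. *)
  move: ij; near: q; apply: filter_forall => ij.
  by have /cvgrPdist_lt := smooth_continuous (h ij.1 ij.2) Ap; apply.
move=> v; apply: (class_CS (df := fun p => \matrix_(i, j) 'D_v (fun q => F q i j) p)).
  by move=> p Ap; apply/is_derive_mxP => i j; rewrite mxE; exact: smooth_is_derive.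
apply: IH => i j; apply: smooth_eq (smooth_derive v (h i j)) => p _.
by rewrite mxE.
Unshelve. all: by end_near. Qed.

End SmoothClosure.

(** * Mean values: linearity in the direction and symmetry of second derivatives *)

Section MeanValue.
Context {R : realType} {U : normedModType R}.
Implicit Types (p u v : U) (f g : U -> R) (A : set U).

Lemma is_derive_shift {W : normedModType R} (f : U -> W) p v w df :
  is_derive (p + w) v f df -> is_derive p v (fun q => f (q + w)) df.
Proof.
move=> /is_derive_lineP h; apply/is_derive_lineP.
by under eq_fun do rewrite -addrA.
Qed.

Lemma mean_value_line f p v (r : R) : 0 < r ->
  (forall s, 0 <= s <= r -> derivable f (p + s *: v) v) ->
  exists2 c, 0 <= c <= r & f (p + r *: v) - f p = r * 'D_v f (p + c *: v).
Proof.
move=> r0 df; pose F (s : R) := f (s *: v + p).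
have dF s : 0 <= s <= r -> is_derive s 1 F ('D_v f (p + s *: v)).
  move=> /df /derivableP /is_derive_lineP h; apply/is_derive_lineP.
  rewrite [X in is_derive _ _ X _](_ : _ = fun h => f (h *: v + (p + s *: v)))//.
  apply/funext => t; rewrite /F; congr f.
  by rewrite [_%:A]mulr1 scalerDl -addrA [s *: v + p]addrC.
have [||c] := @MVT R F (fun s => 'D_v f (p + s *: v)) 0 r r0.
- by move=> s; rewrite in_itv/= => /andP[s0 sr]; apply: dF; rewrite !ltW.
- apply: derivable_within_continuous => s; rewrite in_itv/= => hs.
  by case: (dF s hs).
- rewrite in_itv/= => /andP[c0 cr] E; exists c; first by rewrite !ltW.
  by move: E; rewrite /F scale0r add0r addrC subr0 mulrC => <-; rewrite addrC [r *: v + p]addrC.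
Qed.

(** Mean value arguments give identities between values at unrelated intermediate points; continuity
    lets all of them collapse onto [p]. *)
Lemma continuous_approx_eq (F G H : U -> R) p :
  {for p, continuous F} -> {for p, continuous G} -> {for p, continuous H} ->
  (forall e : R, 0 < e -> exists q1 q2 q3,
    [/\ `|q1 - p| < e, `|q2 - p| < e, `|q3 - p| < e & F q1 = G q2 + H q3]) ->
  F p = G p + H p.
Proof.
move=> cF cG cH h; apply/eqP; rewrite -subr_eq0 -normr_le0.
apply/ler_addgt0Pl => e e0; rewrite addr0.
have e3 : 0 < e / 3 by rewrite divr_gt0.
have near_at (K : U -> R) : {for p, continuous K} ->
    exists2 d, 0 < d & forall q, `|q - p| < d -> `|K p - K q| < e / 3.
  move=> /cvgrPdist_lt /(_ _ e3) /nbhs_normP[d /= d0 dK]; exists d => // q qd.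
  by apply: dK => /=; rewrite distrC.
have [d1 d10 h1] := near_at _ cF; have [d2 d20 h2] := near_at _ cG.
have [d3 d30 h3] := near_at _ cH.
have [|q1 [q2 [q3 [b1 b2 b3 E]]]] := h (Num.min d1 (Num.min d2 d3)).
  by rewrite !lt_min d10 d20 d30.
move: b1 b2 b3; rewrite !lt_min => /and3P[/h1 b1 _ _] /and3P[_ /h2 b2 _] /and3P[_ _ /h3 b3].
have -> : F p - (G p + H p) = (F p - F q1) - (G p - G q2) - (H p - H q3).
  by rewrite E; ring.
rewrite (le_trans (ler_normB _ _))// (_ : e = e / 3 + e / 3 + e / 3); last by field.
rewrite lerD ?(ltW b3)// (le_trans (ler_normB _ _))//.
by rewrite lerD ?(ltW b1) ?(ltW b2).
Qed.

Lemma small_parallelogram A p u v (e : R) : open A -> A p -> 0 < e ->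
  exists2 r : R, 0 < r & forall a b : R, 0 <= a <= r -> 0 <= b <= r ->
    A (p + (a *: u + b *: v)) /\ `|p + (a *: u + b *: v) - p| < e.
Proof.
move=> oA Ap e0.
have /nbhs_normP[d /= d0 dA] := open_nbhs_nbhs (conj oA Ap).
pose m := Num.min d e; have m0 : 0 < m by rewrite lt_min d0 e0.
(* The summand 1 keeps the denominator positive when [u = v = 0]. *)
have n0 : 0 < `|u| + `|v| + 1 by rewrite ltr_wpDl// addr_ge0.
exists (m / (`|u| + `|v| + 1)) => [|a b /andP[a0 ar] /andP[b0 br]].
  by rewrite divr_gt0.
have small : `|p + (a *: u + b *: v) - p| < m.
  rewrite addrC addKr (le_lt_trans (ler_normD _ _))// !normrZ !ger0_norm//.
  apply: (@le_lt_trans _ _ (m / (`|u| + `|v| + 1) * (`|u| + `|v|))).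
    by rewrite mulrDr lerD// ler_wpM2r.
  by rewrite -mulrA gtr_pMr// mulrC ltr_pdivrMr// mul1r ltrDl.
move: (small); rewrite lt_min => /andP[sd se]; split=> //.
by apply: dA; rewrite /ball_/= distrC.
Qed.

(** The increment along the diagonal of a small parallelogram is the sum of the increments along two
    sides; each is [r] times a directional derivative at an intermediate point. *)
Lemma smooth_deriveD_dir A f p u v : open A -> smooth A f -> A p ->
  'D_(u + v) f p = 'D_v f p + 'D_u f p.
Proof.
move=> oA sf Ap; have cD w := smooth_continuous (smooth_derive w sf) Ap.
apply: (continuous_approx_eq (cD _) (cD _) (cD _)) => e e0.
have [r r0 h] := small_parallelogram u v oA Ap e0.
have rr : 0 <= r <= r by rewrite lexx ltW.
have zr : 0 <= (0 : R) <= r by rewrite lexx ltW.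
have d q w : A q -> derivable f q w by move=> Aq; case: (smooth_is_derive w sf Aq).
have [s hs|c1 hc1 E1] := @mean_value_line f p (u + v) r r0.
  by apply: d; rewrite scalerDr; exact: (h _ _ hs hs).1.
have [s hs|c2 hc2 E2] := @mean_value_line f (p + r *: u) v r r0.
  by apply: d; rewrite -addrA; exact: (h _ _ rr hs).1.
have [s hs|c3 hc3 E3] := @mean_value_line f p u r r0.
  by apply: d; have := (h _ _ hs zr).1; rewrite scale0r addr0.
exists (p + c1 *: (u + v)), (p + r *: u + c2 *: v), (p + c3 *: u); split.
- by rewrite scalerDr; exact: (h _ _ hc1 hc1).2.
- by rewrite -(addrA p); exact: (h _ _ rr hc2).2.
- by have := (h _ _ hc3 zr).2; rewrite scale0r addr0.
- suff E : r * 'D_(u + v) f (p + c1 *: (u + v)) =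
      r * ('D_v f (p + r *: u + c2 *: v) + 'D_u f (p + c3 *: u)).
    exact: (mulfI (lt0r_neq0 r0) E).
  by rewrite mulrDr -E1 -E2 -E3 scalerDr !addrA subrK.
Qed.

(** Two applications of the mean value theorem: to [f (q + r *: v) - f q] along [u], then to
    ['D_u f] along [v]. *)
Lemma second_difference A f p u v (r : R) : 0 < r -> smooth A f ->
  (forall a b : R, 0 <= a <= r -> 0 <= b <= r -> A (p + (a *: u + b *: v))) ->
  open A ->
  exists a b, [/\ 0 <= a <= r, 0 <= b <= r &
    f (p + r *: u + r *: v) - f (p + r *: u) - (f (p + r *: v) - f p) =
    r * (r * 'D_v ('D_u f) (p + (a *: u + b *: v)))].
Proof.
move=> r0 sf h oA.
have rr : 0 <= r <= r by rewrite lexx ltW.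
have zr : 0 <= (0 : R) <= r by rewrite lexx ltW.
have dg s : 0 <= s <= r -> is_derive (p + s *: u) u
    (fun q => f (q + r *: v) - f q)
    ('D_u f (p + s *: u + r *: v) - 'D_u f (p + s *: u)).
  move=> hs; apply: is_derive_funB.
    apply: is_derive_shift; apply: smooth_is_derive sf _ => //.
    by rewrite -addrA; exact: h.
  apply: smooth_is_derive sf _ => //.
  by have := h _ _ hs zr; rewrite scale0r addr0.
have [s /dg[]//|a ha E] := @mean_value_line (fun q => f (q + r *: v) - f q) p u r r0.
have [s hs|b hb E'] := @mean_value_line ('D_u f) (p + a *: u) v r r0.
  have Aq : A (p + a *: u + s *: v) by rewrite -addrA; exact: h.
  by case: (smooth_is_derive v (smooth_derive u sf) Aq).
exists a, b; split=> //; rewrite E addrA -E'.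
by case: (dg a ha) => _ ->.
Qed.

(** The second difference over a parallelogram is symmetric in [u] and [v], so each mixed
    derivative, at some point near [p], equals the other one at another such point. *)
Lemma smooth_deriveC A f p u v : open A -> smooth A f -> A p ->
  'D_u ('D_v f) p = 'D_v ('D_u f) p.
Proof.
move=> oA sf Ap.
have cD w1 w2 := smooth_continuous (smooth_derive w1 (smooth_derive w2 sf)) Ap.
rewrite -[RHS]addr0.
apply: (continuous_approx_eq (H := fun=> 0) (cD _ _) (cD _ _)) => [|e e0].
  exact: cst_continuous.
have [r r0 h] := small_parallelogram u v oA Ap e0.
have [a [b [ha hb E]]] := second_difference r0 sf (fun a b ha hb => (h a b ha hb).1) oA.
have h' a' b' : 0 <= a' <= r -> 0 <= b' <= r -> A (p + (a' *: v + b' *: u)).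
  by move=> ha' hb'; rewrite [_ *: v + _]addrC; exact: (h _ _ hb' ha').1.
have [a' [b' [ha' hb' E']]] := second_difference r0 sf h' oA.
exists (p + (a' *: v + b' *: u)), (p + (a *: u + b *: v)), p; split.
- by rewrite [_ *: v + _]addrC; exact: (h _ _ hb' ha').2.
- exact: (h _ _ ha hb).2.
- by rewrite subrr normr0.
- rewrite addr0.
  suff EE : r * (r * 'D_u ('D_v f) (p + (a' *: v + b' *: u))) =
      r * (r * 'D_v ('D_u f) (p + (a *: u + b *: v))).
    exact: (mulfI (lt0r_neq0 r0) (mulfI (lt0r_neq0 r0) EE)).
  apply: etrans (esym E') (etrans _ E).
  have -> : p + r *: v + r *: u = p + r *: u + r *: v by rewrite addrAC.
  by ring.
Qed.

Lemma derive_eq0_constant A f p q :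
  (forall s, 0 <= s <= 1 -> A (p + s *: (q - p))) ->
  (forall x v, A x -> is_derive x v f 0) -> f q = f p.
Proof.
move=> seg df; have [s /seg|c /seg Ac] := @mean_value_line f p (q - p) 1 ltr01.
  by case/(df _ (q - p)).
rewrite scale1r subrKC mul1r => E; apply/subr0_eq; rewrite E.
by case: (df _ (q - p) Ac).
Qed.

End MeanValue.

Lemma smooth_derive_linear {R : realType} {U : normedModType R} {n : nat}
    (A : set U) (F : U -> 'rV[R]_n.+1) p u v (a : R) :
  open A -> smooth A F -> A p ->
  'D_(a *: u + v) F p = a *: 'D_u F p + 'D_v F p.
Proof.
move=> oA sF Ap; have sFi i : smooth A (fun q => F q 0 i).
  by move: i; exact: (proj1 (smooth_mxP oA F) sF 0).
have E w : 'D_w F p = \row_i 'D_w (fun q => F q 0 i) p.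
  apply/rowP => i; rewrite mxE; apply/esym/derive_val.
  exact: (proj1 (is_derive_mxP _ _ _ _) (smooth_is_derive w sF Ap)).
rewrite !E; apply/rowP => i; rewrite !mxE (smooth_deriveD_dir _ _ oA (sFi i) Ap).
rewrite addrC; congr (_ + _); apply: derive_val.
by apply: derive_scale; case: (smooth_is_derive u (sFi i) Ap).
Qed.

(** * The Levi-Civita connection and the curvature of [H^2 x R] *)

Section Coordinates.
Context {R : realType}.
Local Notation V := 'rV[R]_3.
Implicit Types (u v w p : V) (a b c : R).

Lemma cx_pt a b c : cx (pt a b c) = a. Proof. by rewrite /cx mxE. Qed.
Lemma cy_pt a b c : cy (pt a b c) = b. Proof. by rewrite /cy mxE. Qed.
Lemma cz_pt a b c : cz (pt a b c) = c. Proof. by rewrite /cz mxE. Qed.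

Lemma cxD u v : cx (u + v) = cx u + cx v. Proof. by rewrite /cx mxE. Qed.
Lemma cyD u v : cy (u + v) = cy u + cy v. Proof. by rewrite /cy mxE. Qed.
Lemma czD u v : cz (u + v) = cz u + cz v. Proof. by rewrite /cz mxE. Qed.
Lemma cxN u : cx (- u) = - cx u. Proof. by rewrite /cx mxE. Qed.
Lemma cyN u : cy (- u) = - cy u. Proof. by rewrite /cy mxE. Qed.
Lemma czN u : cz (- u) = - cz u. Proof. by rewrite /cz mxE. Qed.
Lemma cxZ a u : cx (a *: u) = a * cx u. Proof. by rewrite /cx mxE. Qed.
Lemma cyZ a u : cy (a *: u) = a * cy u. Proof. by rewrite /cy mxE. Qed.
Lemma czZ a u : cz (a *: u) = a * cz u. Proof. by rewrite /cz mxE. Qed.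
Lemma cx0 : cx (0 : V) = 0. Proof. by rewrite /cx mxE. Qed.
Lemma cy0 : cy (0 : V) = 0. Proof. by rewrite /cy mxE. Qed.
Lemma cz0 : cz (0 : V) = 0. Proof. by rewrite /cz mxE. Qed.

Definition coordE := (cx_pt, cy_pt, cz_pt, cxD, cyD, czD, cxN, cyN, czN,
  cxZ, cyZ, czZ, cx0, cy0, cz0).

Lemma ord3P (P : 'I_3 -> Prop) : P 0 -> P 1 -> P ord_max -> forall i, P i.
Proof.
move=> h0 h1 h2 i; case: i => -[|[|[|//]]] hi.
- by rewrite (_ : Ordinal hi = 0)//; exact/val_inj.
- by rewrite (_ : Ordinal hi = 1)//; exact/val_inj.
- by rewrite (_ : Ordinal hi = ord_max)//; exact/val_inj.
Qed.

Lemma coordP u v : cx u = cx v -> cy u = cy v -> cz u = cz v -> u = v.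
Proof. by move=> h0 h1 h2; apply/rowP; apply: ord3P. Qed.

Lemma is_derive_coordP {U : normedModType R} (F : U -> V) (x v : U) dF :
  is_derive x v F dF <->
  [/\ is_derive x v (fun q => cx (F q)) (cx dF),
      is_derive x v (fun q => cy (F q)) (cy dF)
    & is_derive x v (fun q => cz (F q)) (cz dF)].
Proof.
split=> [/is_derive_mxP h|[h0 h1 h2]]; first by split; exact: h.
by apply/is_derive_mxP => i j; rewrite !ord1; move: j; apply: ord3P.
Qed.

Lemma is_derive_cx {U : normedModType R} (F : U -> V) (x v : U) dF :
  is_derive x v F dF -> is_derive x v (fun q => cx (F q)) (cx dF).
Proof. by case/is_derive_coordP. Qed.

Lemma is_derive_cy {U : normedModType R} (F : U -> V) (x v : U) dF :
  is_derive x v F dF -> is_derive x v (fun q => cy (F q)) (cy dF).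
Proof. by case/is_derive_coordP. Qed.

Lemma is_derive_cz {U : normedModType R} (F : U -> V) (x v : U) dF :
  is_derive x v F dF -> is_derive x v (fun q => cz (F q)) (cz dF).
Proof. by case/is_derive_coordP. Qed.

Lemma is_derive_fun_id p v : is_derive p v (fun q => q) v.
Proof. exact: is_derive_id. Qed.

Lemma smooth_coordP {U : normedModType R} (A : set U) (F : U -> V) : open A ->
  smooth A F <-> [/\ smooth A (fun q => cx (F q)), smooth A (fun q => cy (F q))
                   & smooth A (fun q => cz (F q))].
Proof.
move=> oA; split=> [/(smooth_mxP oA) h|[h0 h1 h2]]; first by split; exact: h.
by apply/(smooth_mxP oA) => i j; rewrite !ord1; move: j; apply: ord3P.
Qed.

Lemma smooth_cx {U : normedModType R} (A : set U) (F : U -> V) : open A ->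
  smooth A F -> smooth A (fun q => cx (F q)).
Proof. by move=> oA /(smooth_coordP _ oA)[]. Qed.

Lemma smooth_cy {U : normedModType R} (A : set U) (F : U -> V) : open A ->
  smooth A F -> smooth A (fun q => cy (F q)).
Proof. by move=> oA /(smooth_coordP _ oA)[]. Qed.

Lemma smooth_cz {U : normedModType R} (A : set U) (F : U -> V) : open A ->
  smooth A F -> smooth A (fun q => cz (F q)).
Proof. by move=> oA /(smooth_coordP _ oA)[]. Qed.

Lemma smooth_pt {U : normedModType R} (A : set U) (f g h : U -> R) : open A ->
  smooth A f -> smooth A g -> smooth A h ->
  smooth A (fun q => pt (f q) (g q) (h q)).
Proof.
move=> oA sf sg sh; apply/(smooth_coordP _ oA).
by split; under eq_fun do rewrite coordE.
Qed.

Lemma smooth_id {U : normedModType R} (A : set U) :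
  open A -> smooth A (fun q => q).
Proof. by move=> oA; apply: (@smooth_linear _ _ _ oA _ (@idfun U)) => x; exact: cvg_id. Qed.

Lemma open_H2xR : open (@H2xR R).
Proof.
rewrite (_ : H2xR = (fun p : V => p 0 1) @^-1` [set t | 0 < t])//.
by apply: open_comp; [move=> x _; exact: coord_continuous|exact: open_gt].
Qed.

End Coordinates.

#[global] Hint Extern 0 (open _) => exact: open_H2xR : core.

(** Subtraction and division have no clause of their own, being a sum with an opposite and a product
    with an inverse. Side conditions on denominators and on arguments of [ln] are left to the caller
    unless trivial. *)
Ltac smooth_solve :=
  lazymatch goal with
  | |- smooth _ (fun q => @?f q + @?g q) =>
      apply: (@smoothD _ _ _ _ _ f g); [done|smooth_solve|smooth_solve]
  | |- smooth _ (fun q => - @?f q) => apply: (@smoothN _ _ _ _ _ f); [done|smooth_solve]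
  | |- smooth _ (fun q => @?f q * @?g q) =>
      apply: (@smoothM _ _ _ _ f g); [done|smooth_solve|smooth_solve]
  | |- smooth _ (fun q => @?f q ^+ _) => apply: (@smoothX _ _ _ _ f); [done|smooth_solve]
  | |- smooth _ (fun q => (@?f q)^-1) =>
      apply: (@smoothV _ _ _ _ f); [done|smooth_solve|try done]
  | |- smooth _ (fun q => ln (@?f q)) =>
      apply: (@smooth_ln _ _ _ _ f); [done|smooth_solve|try done]
  | |- smooth _ (fun q => pt _ _ _) =>
      apply: smooth_pt; [done|smooth_solve|smooth_solve|smooth_solve]
  | |- smooth _ (fun q => cx (@?f q)) => apply: (@smooth_cx _ _ _ f); [done|smooth_solve]
  | |- smooth _ (fun q => cy (@?f q)) => apply: (@smooth_cy _ _ _ f); [done|smooth_solve]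
  | |- smooth _ (fun q => cz (@?f q)) => apply: (@smooth_cz _ _ _ f); [done|smooth_solve]
  | |- smooth _ (fun q => q) => apply: smooth_id; done
  | |- smooth _ (fun _ => ?c) => apply: smooth_cst; done
  | |- smooth _ cx => apply: (@smooth_cx _ _ _ (fun q => q)); [done|smooth_solve]
  | |- smooth _ cy => apply: (@smooth_cy _ _ _ (fun q => q)); [done|smooth_solve]
  | |- smooth _ cz => apply: (@smooth_cz _ _ _ (fun q => q)); [done|smooth_solve]
  | |- smooth _ ('D__ _) => apply: smooth_derive; smooth_solve
  | |- _ => try eassumption
  end.

Ltac derive_solve :=
  lazymatch goal with
  | |- is_derive _ _ (fun q => @?f q + @?g q) _ =>
      eapply (@is_derive_funD _ _ _ f g); [derive_solve|derive_solve]
  | |- is_derive _ _ (fun q => - @?f q) _ => eapply (@is_derive_funN _ _ _ f); derive_solve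
  | |- is_derive _ _ (fun q => @?f q * @?g q) _ =>
      eapply (@is_derive_funM _ _ f g); [derive_solve|derive_solve]
  | |- is_derive _ _ (fun q => @?f q ^+ _) _ => eapply (@is_derive_funX _ _ f); derive_solve
  | |- is_derive _ _ (fun q => (@?f q)^-1) _ =>
      eapply (@is_derive_funV _ _ f); [try done|derive_solve]
  | |- is_derive _ _ (fun q => cx (@?f q)) _ => eapply (@is_derive_cx _ _ f); derive_solve
  | |- is_derive _ _ (fun q => cy (@?f q)) _ => eapply (@is_derive_cy _ _ f); derive_solve
  | |- is_derive _ _ (fun q => cz (@?f q)) _ => eapply (@is_derive_cz _ _ f); derive_solve
  | |- is_derive _ _ (fun q => q) _ => apply: is_derive_fun_id
  | |- is_derive _ _ (fun _ => ?c) _ => apply: is_derive_fun_cst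
  | |- is_derive _ _ cx _ => eapply (@is_derive_cx _ _ (fun q => q)); derive_solve
  | |- is_derive _ _ cy _ => eapply (@is_derive_cy _ _ (fun q => q)); derive_solve
  | |- is_derive _ _ cz _ => eapply (@is_derive_cz _ _ (fun q => q)); derive_solve
  | |- _ => try eassumption
  end.

Ltac derive_by := eapply is_derive_eq; [derive_solve|].

(* Opaque atoms keep unification from unfolding the limits behind ['D_v f p]. *)
Ltac generalize_derive := repeat match goal with
  |- context [derive ?f ?p ?v] => generalize (derive f p v); intro end.

Section LeviCivita.
Context {R : realType}.
Local Notation V := 'rV[R]_3.
Local Notation M := (@H2xR R).
Local Notation g := (@gH2xR R).
Implicit Types (u v w p : V) (X Y Z W : V -> V) (T : @tensor12 R 3).

(** The quarter turn has constant coefficients because the hyperbolic metric is conformal to the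
    Euclidean one. *)
Definition rotJ v : V := pt (- cy v) (cx v) 0.

(** In complex notation the hyperbolic part is [i u v / y]. *)
Definition christoffel p u v : V :=
  pt (- (cx u * cy v + cy u * cx v) / cy p)
     ((cx u * cx v - cy u * cy v) / cy p) 0.

(** Constant curvature -1 on the hyperbolic factor: [- (g (v, w) u - g (u, w) v)] for the hyperbolic
    parts of the vectors. *)
Definition curvature_tensor p u v w : V :=
  pt (- ((cx v * cx w + cy v * cy w) * cx u - (cx u * cx w + cy u * cy w) * cx v)
       / cy p ^+ 2)
     (- ((cx v * cx w + cy v * cy w) * cy u - (cx u * cx w + cy u * cy w) * cy v)
       / cy p ^+ 2) 0.

Definition nablaH2R X Y : V -> V :=
  fun p => 'D_(X p) Y p + christoffel p (X p) (Y p).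

Definition e1 : V := pt 1 0 0.
Definition e2 : V := pt 0 1 0.
Definition e3 : V := pt 0 0 1.

Lemma basisE v : v = cx v *: e1 + (cy v *: e2 + cz v *: e3).
Proof. by generalize_derive; apply: coordP; rewrite !coordE; ring. Qed.

Lemma cy_neq0 p : M p -> cy p != 0.
Proof. by move=> /lt0r_neq0. Qed.

(** In a field such as ['D_(X p) Y p] the point occurs also in the direction; the expansion leaves
    derivatives in fixed directions with smooth coefficients. *)
Lemma deriveV_basis Y p v : smooth M Y -> M p ->
  'D_v Y p = cx v *: 'D_e1 Y p + (cy v *: 'D_e2 Y p + cz v *: 'D_e3 Y p).
Proof.
move=> sY Mp; rewrite {1}(basisE v) !(smooth_derive_linear _ _ _ open_H2xR sY Mp).
congr (_ + (_ + _)); apply: derive_val; apply: derive_scale.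
by case: (smooth_is_derive e3 sY Mp).
Qed.

Lemma smooth_derive_field X Y : smooth M X -> smooth M Y ->
  smooth M (fun p => 'D_(X p) Y p).
Proof.
move=> sX sY; have oM := @open_H2xR R.
apply: (smooth_eq oM (f := fun p => pt
  (cx (X p) * cx ('D_e1 Y p) + (cy (X p) * cx ('D_e2 Y p) + cz (X p) * cx ('D_e3 Y p)))
  (cx (X p) * cy ('D_e1 Y p) + (cy (X p) * cy ('D_e2 Y p) + cz (X p) * cy ('D_e3 Y p)))
  (cx (X p) * cz ('D_e1 Y p) + (cy (X p) * cz ('D_e2 Y p) + cz (X p) * cz ('D_e3 Y p))))).
  move=> p Mp; rewrite (deriveV_basis (X p) sY Mp).
  by generalize_derive; apply: coordP; rewrite !coordE.
have s1 := smooth_derive e1 sY; have s2 := smooth_derive e2 sY.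
have s3 := smooth_derive e3 sY.
by smooth_solve.
Qed.

Lemma smooth_christoffel Y Z : smooth M Y -> smooth M Z ->
  smooth M (fun p => christoffel p (Y p) (Z p)).
Proof. by move=> sY sZ; rewrite /christoffel; smooth_solve; move=> p /cy_neq0. Qed.

Lemma smooth_nablaH2R X Y : smooth M X -> smooth M Y -> smooth M (nablaH2R X Y).
Proof.
move=> sX sY; apply: smoothD => //; first exact: smooth_derive_field.
exact: smooth_christoffel.
Qed.

Lemma levi_civita_nablaH2R : levi_civita M g nablaH2R.
Proof.
split; [do !split|..].
- exact: smooth_nablaH2R.
- move=> X X' Y sX sX' sY p Mp; rewrite /nablaH2R -[X p]scale1r.
  rewrite (smooth_derive_linear _ _ _ open_H2xR sY Mp) !scale1r.
  by generalize_derive; apply: coordP; rewrite !coordE; ring.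
- move=> f X Y sf sX sY p Mp; rewrite /nablaH2R -[f p *: X p]addr0.
  rewrite (smooth_derive_linear _ _ _ open_H2xR sY Mp) derive0.
  by generalize_derive; apply: coordP; rewrite !coordE; ring.
- move=> X Y Y' sX sY sY' p Mp; rewrite /nablaH2R.
  rewrite (derive_val (is_derive := is_derive_funD (smooth_is_derive (X p) sY Mp)
    (smooth_is_derive (X p) sY' Mp))).
  by generalize_derive; apply: coordP; rewrite !coordE; ring.
- move=> f X Y sf sX sY p Mp; rewrite /nablaH2R.
  have df := smooth_is_derive (X p) sf Mp; have dY := smooth_is_derive (X p) sY Mp.
  have -> : 'D_(X p) (fun q => f q *: Y q) p =
      'D_(X p) f p *: Y p + f p *: 'D_(X p) Y p.
    apply: derive_val; apply/is_derive_coordP; rewrite !coordE.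
    by split; under eq_fun do rewrite coordE; derive_by; ring.
  by generalize_derive; apply: coordP; rewrite !coordE; ring.
- move=> X Y Z sX sY sZ p Mp; apply: derive_val.
  have dY := smooth_is_derive (X p) sY Mp; have dZ := smooth_is_derive (X p) sZ Mp.
  have y0 := cy_neq0 Mp; rewrite /gH2xR; derive_by.
    by rewrite expf_neq0.
  by rewrite /nablaH2R; generalize_derive; rewrite !coordE; field.
- move=> X Y sX sY p Mp; rewrite /nablaH2R /lie_bracket.
  by generalize_derive; apply: coordP; rewrite !coordE; ring.
Qed.

Lemma gH2xR_nondegenerate p u : M p -> (forall v, g p u v = 0) -> u = 0.
Proof.
move=> Mp h; have y0 := cy_neq0 Mp.
have h1 := h e1; have h2 := h e2; have h3 := h e3.
rewrite /gH2xR !coordE !mulr0 !mulr1 ?addr0 ?add0r mul0r in h1 h2 h3.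
have yy : (cy p ^+ 2)^-1 != 0 by rewrite invr_eq0 expf_neq0.
apply: coordP; rewrite coordE; last by rewrite -h3 add0r.
  by apply: (mulIf yy); rewrite h1 mul0r.
by apply: (mulIf yy); rewrite h2 mul0r.
Qed.

Section AnyLeviCivita.
Variable nabla : (V -> V) -> (V -> V) -> V -> V.
Hypothesis LC : levi_civita M g nabla.

Let scst v : smooth M (fun=> v). Proof. exact: smooth_cst. Qed.

(* Koszul: the difference of two metric torsion-free connections is symmetric in
   the first two and skew in the last two arguments, hence zero. *)
Lemma levi_civita_cst u v p : M p ->
  nabla (fun=> u) (fun=> v) p = christoffel p u v.
Proof.
move=> Mp; case: LC => _ metric tf.
pose S a b : V := nabla (fun=> a) (fun=> b) p - christoffel p a b.
have S_sym a b : S a b = S b a.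
  have := tf _ _ (scst a) (scst b) p Mp; rewrite /lie_bracket !derive_cst subrr.
  move=> /subr0_eq E; rewrite /S E; congr (_ - _).
  by generalize_derive; apply: coordP; rewrite !coordE; ring.
have S_skew a b c : g p (S a b) c = - g p b (S a c).
  have E := metric _ _ _ (scst a) (scst b) (scst c) p Mp.
  have [_ metric0 _] := levi_civita_nablaH2R.
  move: E; rewrite (metric0 _ _ _ (scst a) (scst b) (scst c) p Mp).
  rewrite /nablaH2R !derive_cst !add0r /S /gH2xR !coordE => E.
  apply/eqP; rewrite -addr_eq0; apply/eqP; move/eqP: E; rewrite eq_sym -subr_eq0.
  by move=> /eqP E; rewrite -[RHS]E; ring.
apply/subr0_eq; apply: (gH2xR_nondegenerate Mp) => w; rewrite -/(S u v).
have gC a b : g p a b = g p b a by rewrite /gH2xR; ring.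
have : g p (S u v) w = - g p (S u v) w.
  rewrite {1}S_skew gC (S_sym u w) S_skew opprK gC (S_sym w v) S_skew gC.
  by rewrite (S_sym v u).
by lra.
Qed.

(** Both fields are expanded in the constant frame; function-linearity and the Leibniz rule reduce
    the claim to constant fields, and the derivatives of the coefficients of [Y] add up to
    ['D_(X p) Y p]. *)
Lemma levi_civita_unique X Y p : smooth M X -> smooth M Y -> M p ->
  nabla X Y p = nablaH2R X Y p.
Proof.
move=> sX sY Mp.
case: (LC) => -[_ [addl [scalel [addr scaler]]]] _ _.
have sc (f : V -> R) v : smooth M f -> smooth M (fun q => f q *: v).
  move=> sf; apply/smooth_coordP => //.
  rewrite (_ : (fun q => cx _) = fun q => f q * cx v); last first.
    by apply/funext => q; rewrite cxZ.
  rewrite (_ : (fun q => cy _) = fun q => f q * cy v); last first.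
    by apply/funext => q; rewrite cyZ.
  rewrite (_ : (fun q => cz _) = fun q => f q * cz v); last first.
    by apply/funext => q; rewrite czZ.
  by split; smooth_solve.
have scX : smooth M (fun q => cx (X q)) by smooth_solve.
have scY : smooth M (fun q => cy (X q)) by smooth_solve.
have scZ : smooth M (fun q => cz (X q)) by smooth_solve.
have scX' : smooth M (fun q => cx (Y q)) by smooth_solve.
have scY' : smooth M (fun q => cy (Y q)) by smooth_solve.
have scZ' : smooth M (fun q => cz (Y q)) by smooth_solve.
have s2 (F G : V -> V) : smooth M F -> smooth M G -> smooth M (fun q => F q + G q).
  exact: smoothD.
have cstr v : nabla X (fun=> v) p = christoffel p (X p) v.
  have -> : X = fun q => cx (X q) *: e1 + (cy (X q) *: e2 + cz (X q) *: e3).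
    by apply/funext => q; exact: basisE.
  rewrite addl ?scalel ?levi_civita_cst//; [|exact: sc|by apply: s2; exact: sc].
  rewrite addl ?scalel ?levi_civita_cst//; [|exact: sc|exact: sc].
  by generalize_derive; apply: coordP; rewrite !coordE; ring.
have EY : Y = fun q => cx (Y q) *: e1 + (cy (Y q) *: e2 + cz (Y q) *: e3).
  by apply/funext => q; exact: basisE.
rewrite {1}EY addr ?scaler ?cstr//; [|exact: sc|by apply: s2; exact: sc].
rewrite addr ?scaler ?cstr//; [|exact: sc|exact: sc].
have dY := smooth_is_derive (X p) sY Mp.
rewrite (derive_val (is_derive := is_derive_cx dY)).
rewrite (derive_val (is_derive := is_derive_cy dY)).
rewrite (derive_val (is_derive := is_derive_cz dY)) /nablaH2R.
by generalize_derive; apply: coordP; rewrite !coordE; ring.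
Qed.

End AnyLeviCivita.

End LeviCivita.

Lemma smooth_deriveC_rV {R : realType} {U : normedModType R} {n : nat}
    (A : set U) (F : U -> 'rV[R]_n.+1) p u v :
  open A -> smooth A F -> A p -> 'D_u ('D_v F) p = 'D_v ('D_u F) p.
Proof.
move=> oA sF Ap.
have sFi i : smooth A (fun q => F q 0 i) by exact: (proj1 (smooth_mxP oA F) sF 0).
have coordD w q i : A q -> 'D_w F q 0 i = 'D_w (fun q => F q 0 i) q.
  move=> Aq; apply/esym/derive_val.
  exact: (proj1 (is_derive_mxP _ _ _ _) (smooth_is_derive w sF Aq)).
have coordDD w1 w2 i : ('D_w1 ('D_w2 F) p) 0 i = 'D_w1 ('D_w2 (fun q => F q 0 i)) p.
  have d := smooth_is_derive w1 (smooth_derive w2 sF) Ap.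
  have di := proj1 (is_derive_mxP _ _ _ _) d 0 i.
  apply/esym/derive_val; apply: (is_derive_near_eq oA Ap _ di) => q Aq.
  exact: coordD.
apply/rowP => i; apply: etrans (coordDD u v i) _.
apply: etrans (esym (coordDD v u i)); exact: (smooth_deriveC u v oA (sFi i) Ap).
Qed.

Lemma addr_sum3 {W : zmodType} (a1 a2 b1 b2 c1 c2 : W) :
  a1 + a2 + (b1 + b2 + (c1 + c2)) = a1 + (b1 + c1) + (a2 + (b2 + c2)).
Proof. by rewrite (addrACA b1) (addrACA a1). Qed.

(** * Curvature and the action of a tensor on it *)

Section Curvature.
Context {R : realType}.
Local Notation V := 'rV[R]_3.
Local Notation M := (@H2xR R).
Local Notation g := (@gH2xR R).
Implicit Types (u v w p : V) (X Y Z W : V -> V) (T : @tensor12 R 3).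

Lemma is_derive_funZ (f : V -> R) (F : V -> V) p v df dF :
  is_derive p v f df -> is_derive p v F dF ->
  is_derive p v (fun q => f q *: F q) (df *: F p + f p *: dF).
Proof.
move=> hf /is_derive_mxP hF; apply/is_derive_mxP => i j.
have E : (fun q => (f q *: F q) i j) = (fun q => f q * F q i j).
  by apply/funext => q; rewrite mxE.
rewrite E; apply: is_derive_eq (is_derive_funM hf (hF i j)) _.
by rewrite !mxE; ring.
Qed.

(** Product rule: one term differentiates the direction [Y q], the other freezes it at [Y p] and is
    a genuine second derivative. *)
Lemma is_derive_field Y Z p v : smooth M Y -> smooth M Z -> M p ->
  is_derive p v (fun q => 'D_(Y q) Z q)
    ('D_('D_v Y p) Z p + 'D_v ('D_(Y p) Z) p).
Proof.
move=> sY sZ Mp; have oM := @open_H2xR R.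
have dY := smooth_is_derive v sY Mp.
have dZ w := smooth_is_derive v (smooth_derive w sZ) Mp.
have -> : 'D_v ('D_(Y p) Z) p = cx (Y p) *: 'D_v ('D_e1 Z) p +
    (cy (Y p) *: 'D_v ('D_e2 Z) p + cz (Y p) *: 'D_v ('D_e3 Z) p).
  apply: derive_val; apply: (is_derive_near_eq (f := fun q =>
    cx (Y p) *: 'D_e1 Z q + (cy (Y p) *: 'D_e2 Z q + cz (Y p) *: 'D_e3 Z q)) oM Mp).
  by move=> q Mq; apply/esym; exact: (deriveV_basis (Y p) sZ Mq).
apply: (is_derive_near_eq (f := fun q => cx (Y q) *: 'D_e1 Z q +
    (cy (Y q) *: 'D_e2 Z q + cz (Y q) *: 'D_e3 Z q)) oM Mp).
  by move=> q Mq; apply/esym; exact: (deriveV_basis (Y q) sZ Mq).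
eapply is_derive_eq.
  apply: is_derive_funD; first exact: is_derive_funZ (is_derive_cx dY) (dZ e1).
  apply: is_derive_funD; first exact: is_derive_funZ (is_derive_cy dY) (dZ e2).
  exact: is_derive_funZ (is_derive_cz dY) (dZ e3).
by rewrite (deriveV_basis ('D_v Y p) sZ Mp); exact: addr_sum3.
Qed.

Lemma is_derive_pt {U : normedModType R} (f1 f2 f3 : U -> R) (x w : U) d1 d2 d3 :
  is_derive x w f1 d1 -> is_derive x w f2 d2 -> is_derive x w f3 d3 ->
  is_derive x w (fun q => pt (f1 q) (f2 q) (f3 q)) (pt d1 d2 d3).
Proof.
move=> h1 h2 h3; apply/is_derive_coordP; rewrite !coordE.
by split; under eq_fun do rewrite coordE.
Qed.

(** The subtracted term is the derivative of the factor [1 / y]. *)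
Lemma is_derive_christoffel Y Z p v dY dZ : M p ->
  is_derive p v Y dY -> is_derive p v Z dZ ->
  is_derive p v (fun q => christoffel q (Y q) (Z q))
    (christoffel p dY (Z p) + christoffel p (Y p) dZ
     - (cy v / cy p) *: christoffel p (Y p) (Z p)).
Proof.
move=> /cy_neq0 y0 hY hZ; rewrite /christoffel; eapply is_derive_eq.
  by apply: is_derive_pt; derive_solve.
by apply: coordP; rewrite !coordE; field.
Qed.

Lemma is_derive_curvature_tensor Y Z W p v dY dZ dW : M p ->
  is_derive p v Y dY -> is_derive p v Z dZ -> is_derive p v W dW ->
  is_derive p v (fun q => curvature_tensor q (Y q) (Z q) (W q))
    (curvature_tensor p dY (Z p) (W p) + curvature_tensor p (Y p) dZ (W p)
     + curvature_tensor p (Y p) (Z p) dW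
     - (2 * cy v / cy p) *: curvature_tensor p (Y p) (Z p) (W p)).
Proof.
move=> /cy_neq0 y0 hY hZ hW; rewrite /curvature_tensor; eapply is_derive_eq.
  by apply: is_derive_pt; derive_solve; rewrite ?expf_neq0.
by apply: coordP; rewrite !coordE; field.
Qed.

Lemma smooth_lie_bracket X Y : smooth M X -> smooth M Y -> smooth M (lie_bracket X Y).
Proof. by move=> sX sY; apply: smoothB => //; exact: smooth_derive_field. Qed.

Section AnyLeviCivita.
Variable nabla : (V -> V) -> (V -> V) -> V -> V.
Hypothesis LC : levi_civita M g nabla.

Lemma smooth_nabla X Y : smooth M X -> smooth M Y -> smooth M (nabla X Y).
Proof. by move=> sX sY; case: LC => -[h _] _ _; exact: h. Qed.

Lemma is_derive_nabla Y Z p v : smooth M Y -> smooth M Z -> M p ->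
  is_derive p v (nabla Y Z)
    ('D_('D_v Y p) Z p + 'D_v ('D_(Y p) Z) p +
     (christoffel p ('D_v Y p) (Z p) + christoffel p (Y p) ('D_v Z p)
      - (cy v / cy p) *: christoffel p (Y p) (Z p))).
Proof.
move=> sY sZ Mp; apply: (is_derive_near_eq (@open_H2xR R) Mp).
  by move=> q Mq; apply/esym; exact: (levi_civita_unique LC sY sZ Mq).
apply: is_derive_funD; first exact: is_derive_field.
by apply: is_derive_christoffel; [|exact: (smooth_is_derive v sY Mp)|
  exact: (smooth_is_derive v sZ Mp)].
Qed.

Lemma curvatureE X Y Z p : smooth M X -> smooth M Y -> smooth M Z -> M p ->
  curvature nabla X Y Z p = curvature_tensor p (X p) (Y p) (Z p).
Proof.
move=> sX sY sZ Mp; rewrite /curvature.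
have sYZ := smooth_nabla sY sZ; have sXZ := smooth_nabla sX sZ.
have sXY := smooth_lie_bracket sX sY.
rewrite !(levi_civita_unique LC _ _ Mp)// /nablaH2R.
rewrite (derive_val (is_derive := is_derive_nabla (X p) sY sZ Mp)).
rewrite (derive_val (is_derive := is_derive_nabla (Y p) sX sZ Mp)).
(* After this exchange the second derivatives of [Z] cancel. *)
rewrite (smooth_deriveC_rV (Y p) (X p) (@open_H2xR R) sZ Mp).
rewrite !(levi_civita_unique LC _ _ Mp)// /nablaH2R /lie_bracket.
rewrite -[_ - 'D_(Y p) X p]addrC -[- 'D_(Y p) X p]scaleN1r.
rewrite (smooth_derive_linear _ _ _ (@open_H2xR R) sZ Mp).
have y0 := cy_neq0 Mp; rewrite /christoffel /curvature_tensor.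
by generalize_derive; apply: coordP; rewrite !coordE; field.
Qed.

Lemma smooth_curvature X Y Z : smooth M X -> smooth M Y -> smooth M Z ->
  smooth M (curvature nabla X Y Z).
Proof.
move=> sX sY sZ; have oM := @open_H2xR R; rewrite /curvature.
apply: smoothB => //; first (apply: smoothB => //).
- by apply: smooth_nabla => //; exact: smooth_nabla.
- by apply: smooth_nabla => //; exact: smooth_nabla.
- by apply: smooth_nabla => //; exact: smooth_lie_bracket.
Qed.

Section Tensor.
Variable T : @tensor12 R 3.
Hypothesis tT : tensor_field M T.
Let nt X Y : V -> V := fun p => nabla X Y p - T p (X p) (Y p).

Lemma smooth_tensor X Y : smooth M X -> smooth M Y ->
  smooth M (fun p => T p (X p) (Y p)).
Proof. by case: tT => _ [_ h]; exact: h. Qed.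

Lemma smooth_nabla_tilde X Y : smooth M X -> smooth M Y -> smooth M (nt X Y).
Proof.
move=> sX sY; apply: smoothB => //; first exact: smooth_nabla.
exact: smooth_tensor.
Qed.

(* The curvature of a symmetric space is parallel, so only the algebraic action
   of [T] on it survives. *)
Lemma parallel13_action X Y Z W p :
  smooth M X -> smooth M Y -> smooth M Z -> smooth M W -> M p ->
  nt X (curvature nabla Y Z W) p - curvature nabla (nt X Y) Z W p
  - curvature nabla Y (nt X Z) W p - curvature nabla Y Z (nt X W) p =
  curvature_tensor p (T p (X p) (Y p)) (Z p) (W p)
  + curvature_tensor p (Y p) (T p (X p) (Z p)) (W p)
  + curvature_tensor p (Y p) (Z p) (T p (X p) (W p))
  - T p (X p) (curvature_tensor p (Y p) (Z p) (W p)).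
Proof.
move=> sX sY sZ sW Mp; have sR := smooth_curvature sY sZ sW.
have sXY := smooth_nabla_tilde sX sY; have sXZ := smooth_nabla_tilde sX sZ.
have sXW := smooth_nabla_tilde sX sW.
rewrite !(curvatureE _ _ _ Mp)// /nt (curvatureE _ _ _ Mp)//.
rewrite !(levi_civita_unique LC _ _ Mp)// /nablaH2R (curvatureE _ _ _ Mp)//.
have -> : 'D_(X p) (curvature nabla Y Z W) p =
    'D_(X p) (fun q => curvature_tensor q (Y q) (Z q) (W q)) p.
  apply/derive_val; apply: (is_derive_near_eq (@open_H2xR R) Mp).
    by move=> q Mq; apply/esym; exact: (curvatureE _ _ _ Mq).
  apply: derivableP; case: (is_derive_curvature_tensor Mp
    (smooth_is_derive (X p) sY Mp) (smooth_is_derive (X p) sZ Mp)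
    (smooth_is_derive (X p) sW Mp)) => h _; exact: h.
rewrite (derive_val (is_derive := is_derive_curvature_tensor Mp
    (smooth_is_derive (X p) sY Mp) (smooth_is_derive (X p) sZ Mp)
    (smooth_is_derive (X p) sW Mp))).
generalize (T p (X p) (curvature_tensor p (Y p) (Z p) (W p))) => t0.
generalize (T p (X p) (Y p)) (T p (X p) (Z p)) (T p (X p) (W p)) => t1 t2 t3.
have y0 := cy_neq0 Mp; rewrite /christoffel /curvature_tensor.
by generalize_derive; apply: coordP; rewrite !coordE; field.
Qed.

End Tensor.

End AnyLeviCivita.

End Curvature.

(** * Structure equations *)

Section StructureEquations.
Context {R : realType}.
Local Notation V := 'rV[R]_3.
Local Notation M := (@H2xR R).
Local Notation g := (@gH2xR R).
Implicit Types (u v w p : V) (X Y Z W : V -> V) (T : @tensor12 R 3).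
Implicit Types (a b c : V -> R).

Definition form_of a b c p u : R := a p * cx u + b p * cy u + c p * cz u.

(* [T = w (x) dV] with [w = a dx + b dy + c dz] satisfying [nabla_u w = - w(u) w o J],
   i.e. [w] is parallel for [nabla - T]. *)
Definition structure_equations T a b c : Prop :=
  [/\ smooth M a, smooth M b, smooth M c,
      forall p, M p -> forall u v, T p u v = form_of a b c p u *: rotJ v
    & forall p, M p -> forall u,
      [/\ is_derive p u a
            ((b p * cx u - a p * cy u) / cy p - form_of a b c p u * b p),
          is_derive p u b
            (- (a p * cx u + b p * cy u) / cy p + form_of a b c p u * a p)
        & is_derive p u c 0]].

Lemma tensor_linear_l T p (k : R) u u' v : tensor_field M T -> M p ->
  T p (k *: u + u') v = k *: T p u v + T p u' v.
Proof. by move=> [h _] Mp; exact: h. Qed.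

Lemma tensor_linear_r T p (k : R) u v v' : tensor_field M T -> M p ->
  T p u (k *: v + v') = k *: T p u v + T p u v'.
Proof. by move=> [_ [h _]] Mp; exact: h. Qed.

Lemma tensor_0r T p u : tensor_field M T -> M p -> T p u 0 = 0.
Proof.
move=> tT Mp; have := tensor_linear_r 1 u 0 0 tT Mp.
rewrite scaler0 add0r scale1r => /eqP; rewrite -subr_eq0 opprD addNKr oppr_eq0.
by move=> /eqP.
Qed.

Lemma tensor_0l T p v : tensor_field M T -> M p -> T p 0 v = 0.
Proof.
move=> tT Mp; have := tensor_linear_l 1 0 0 v tT Mp.
rewrite scaler0 add0r scale1r => /eqP; rewrite -subr_eq0 opprD addNKr oppr_eq0.
by move=> /eqP.
Qed.

Lemma tensor_basis_l T p u v : tensor_field M T -> M p ->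
  T p u v = cx u *: T p e1 v + (cy u *: T p e2 v + cz u *: T p e3 v).
Proof.
move=> tT Mp; rewrite {1}(basisE u) !(tensor_linear_l _ _ _ _ tT Mp).
rewrite -[cz u *: e3]addr0 (tensor_linear_l _ _ _ _ tT Mp).
by rewrite tensor_0l// addr0.
Qed.

Lemma tensor_basis_r T p u v : tensor_field M T -> M p ->
  T p u v = cx v *: T p u e1 + (cy v *: T p u e2 + cz v *: T p u e3).
Proof.
move=> tT Mp; rewrite {1}(basisE v) !(tensor_linear_r _ _ _ _ tT Mp).
rewrite -[cz v *: e3]addr0 (tensor_linear_r _ _ _ _ tT Mp).
by rewrite tensor_0r// addr0.
Qed.

(** Skewness turns a vertical [S e3] into 0 and then keeps [S e1], [S e2] horizontal. Skew maps of a
    plane are multiples of the quarter turn, and the factor is [cy (S e1)] because [J e1 = e2]. *)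
Lemma skew_commuting_form (S : V -> V) p : M p ->
  (forall v w, g p (S v) w + g p v (S w) = 0) ->
  cx (S e3) = 0 -> cy (S e3) = 0 ->
  [/\ S e1 = cy (S e1) *: rotJ e1, S e2 = cy (S e1) *: rotJ e2
    & S e3 = cy (S e1) *: rotJ e3].
Proof.
move=> /cy_neq0 y0 sk x3 y3; rewrite /gH2xR in sk.
have i0 : (cy p ^+ 2)^-1 != 0 by rewrite invr_eq0 expf_neq0.
have z3 : cz (S e3) = 0.
  by have := sk e3 e3; rewrite x3 y3 !coordE; lra.
have z1 : cz (S e1) = 0.
  by have := sk e1 e3; rewrite x3 y3 z3 !coordE; lra.
have z2 : cz (S e2) = 0.
  by have := sk e2 e3; rewrite x3 y3 z3 !coordE; lra.
have x1 : cx (S e1) = 0.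
  apply: (mulIf i0); rewrite mul0r.
  by have := sk e1 e1; rewrite z1 !coordE; lra.
have y2 : cy (S e2) = 0.
  apply: (mulIf i0); rewrite mul0r.
  by have := sk e2 e2; rewrite z2 !coordE; lra.
have x2 : cx (S e2) = - cy (S e1).
  apply: (mulIf i0); rewrite mulNr.
  by have := sk e1 e2; rewrite z1 z2 !coordE; lra.
by split; apply: coordP; rewrite ?(x1, x2, x3, y2, y3, z1, z2, z3) !coordE; ring.
Qed.

Lemma homogeneous_structure_equations T : homogeneous_structure M g T ->
  exists a b c, structure_equations T a b c.
Proof.
move=> [tT [nabla LC [pm p13 p12]]].
have scst v : smooth M (fun=> v) by exact: smooth_cst.
have skew p u v w : M p -> g p (T p u v) w + g p v (T p u w) = 0.
  move=> Mp; have := pm _ _ _ (scst u) (scst v) (scst w) p Mp.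
  case: LC => _ m _; rewrite (m _ _ _ (scst u) (scst v) (scst w) p Mp).
  rewrite /gH2xR !coordE.
  generalize (nabla (fun=> u) (fun=> v) p) (nabla (fun=> u) (fun=> w) p) => s t.
  by move=> /eqP; rewrite -subr_eq0 => /eqP E; rewrite -[RHS]E; ring.
(* The action of [T_u] on the curvature at [(e1, e2, e3)]: every curvature term with last argument
   [e3] vanishes, which leaves [J (T_u e3) / y ^ 2 = 0]. *)
have T3 p u : M p -> cx (T p u e3) = 0 /\ cy (T p u e3) = 0.
  move=> Mp; have := p13 _ _ _ _ (scst u) (scst e1) (scst e2) (scst e3) p Mp.
  rewrite (parallel13_action LC tT (scst u) (scst e1) (scst e2) (scst e3) Mp).
  have -> : curvature_tensor p e1 e2 e3 = 0.
    by rewrite /curvature_tensor; apply: coordP; rewrite !coordE; ring.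
  rewrite (tensor_0r _ tT Mp) subr0.
  generalize (T p u e1) (T p u e2) (T p u e3) => t1 t2 t3 E.
  have y0 := cy_neq0 Mp.
  have := congr1 (@cx R) E; have := congr1 (@cy R) E.
  rewrite /curvature_tensor !coordE => E2 E1; split.
    by rewrite -[RHS](mulr0 (cy p ^+ 2)) -E2; field.
  by rewrite -[RHS](mulr0 (- cy p ^+ 2)) -E1; field.
pose o p u := cy (T p u e1).
have TJ p u v : M p -> T p u v = o p u *: rotJ v.
  move=> Mp; have [x3 y3] := T3 p u Mp.
  have [h1 h2 h3] := skew_commuting_form Mp (fun v w => skew p u v w Mp) x3 y3.
  rewrite (tensor_basis_r u v tT Mp) h1 h2 h3 -/(o p u).
  generalize (o p u) => k; rewrite /rotJ.
  by apply: coordP; rewrite !coordE; ring.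
exists (fun p => o p e1), (fun p => o p e2), (fun p => o p e3).
have oE p u : M p -> o p u = form_of (o^~ e1) (o^~ e2) (o^~ e3) p u.
  move=> Mp; rewrite /form_of {1}/o (tensor_basis_l u e1 tT Mp) !coordE /o.
  by ring.
have so u : smooth M (fun p => o p u).
  by apply: smooth_cy => //; exact: (smooth_tensor tT (scst u) (scst e1)).
split=> //; first by move=> p Mp u v; rewrite TJ// oE.
(* The [y] component of [nabla~ T = 0] on the constant fields [u], [v], [e1]: since [J] commutes
   with [nabla~], what remains is [nabla~ w = 0] evaluated at [v]. *)
have key p u v : M p -> is_derive p u (fun q => o q v)
    (o p (christoffel p u v) - o p u * o p (rotJ v)).
  move=> Mp; have sF := smooth_tensor tT (scst v) (scst e1).
  have dF := smooth_is_derive u sF Mp.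
  apply: is_derive_eq (is_derive_cy dF) _.
  have := congr1 (@cy R) (p12 _ _ _ (scst u) (scst v) (scst e1) p Mp).
  rewrite !(levi_civita_unique LC _ _ Mp)// /nablaH2R !derive_cst !add0r.
  generalize ('D_u (fun q => T q v e1) p) => d.
  rewrite !(TJ p _ _ Mp).
  have lin k w w' : o p (k *: w + w') = k * o p w + o p w'.
    by rewrite /o (tensor_linear_l _ _ _ _ tT Mp) !coordE.
  have -> : christoffel p u v - o p u *: rotJ v = - o p u *: rotJ v + christoffel p u v.
    by rewrite scaleNr addrC.
  rewrite lin /christoffel /rotJ; generalize (o p u) (o p v) => ou ov.
  set t1 := o p _; set t2 := o p _.
  have y0 := cy_neq0 Mp.
  rewrite !coordE => /eqP E; apply/eqP; rewrite -subr_eq0.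
  by move/eqP: E => E; apply/eqP; rewrite -[RHS]E; field.
move=> p Mp u; have y0 := cy_neq0 Mp; split.
- apply: is_derive_eq (key p u e1 Mp) _.
  rewrite !(oE p _ Mp) /form_of /christoffel /rotJ !coordE /=.
  by field.
- apply: is_derive_eq (key p u e2 Mp) _.
  rewrite !(oE p _ Mp) /form_of /christoffel /rotJ !coordE /=.
  by field.
- apply: is_derive_eq (key p u e3 Mp) _.
  rewrite !(oE p _ Mp) /form_of /christoffel /rotJ !coordE /=.
  by field.
Qed.

(** The converse, applied to the two models: [J] is skew and acts trivially on the curvature, and
    the equations for [a], [b], [c] make [w] parallel. *)
Lemma structure_equations_homogeneous T a b c :
  structure_equations T a b c -> homogeneous_structure M g T.
Proof.
move=> [sa sb sc TE dabc]; have oM := @open_H2xR R.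
have TE' p : M p -> forall u v, T p u v =
    pt (- (form_of a b c p u * cy v)) (form_of a b c p u * cx v) 0.
  by move=> Mp u v; rewrite TE// /rotJ; apply: coordP; rewrite !coordE; ring.
have tT : tensor_field M T.
  split; [|split].
  - by move=> p Mp k u u' v; rewrite !TE// /form_of; apply: coordP; rewrite !coordE; ring.
  - by move=> p Mp k u v v'; rewrite !TE// /form_of /rotJ; apply: coordP; rewrite !coordE; ring.
  - move=> X Y sX sY; apply: (smooth_eq oM (f := fun p =>
      pt (- (form_of a b c p (X p) * cy (Y p))) (form_of a b c p (X p) * cx (Y p)) 0)).
      by move=> p Mp; rewrite TE'.
    by rewrite /form_of; smooth_solve.
split=> //; have LC := @levi_civita_nablaH2R R.
exists nablaH2R => //; split.
- move=> X Y Z sX sY sZ p Mp; case: LC => _ m _; rewrite (m _ _ _ sX sY sZ p Mp).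
  generalize (nablaH2R X Y p) (nablaH2R X Z p) => s t.
  by rewrite !TE// /rotJ /gH2xR !coordE; ring.
- move=> X Y Z W sX sY sZ sW p Mp; rewrite (parallel13_action LC tT sX sY sZ sW Mp).
  rewrite !TE// /curvature_tensor /rotJ; have y0 := cy_neq0 Mp.
  by generalize (form_of a b c p (X p)) => k; apply: coordP; rewrite !coordE; field.
- move=> X Y Z sX sY sZ p Mp; rewrite /nablaH2R.
  have dY := smooth_is_derive (X p) sY Mp; have dZ := smooth_is_derive (X p) sZ Mp.
  have [da db dc] := dabc p Mp (X p); have y0 := cy_neq0 Mp.
  have E : is_derive p (X p) (fun q => T q (Y q) (Z q))
    (((- (a p * cx (X p) + b p * cy (X p)) / cy p * cy (Y p)
       + (b p * cx (X p) - a p * cy (X p)) / cy p * cx (Y p)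
       + form_of a b c p (X p) * (a p * cy (Y p) - b p * cx (Y p))
       + form_of a b c p ('D_(X p) Y p)) *: rotJ (Z p)
      + form_of a b c p (Y p) *: rotJ ('D_(X p) Z p))).
    apply: (is_derive_near_eq (f := fun q =>
      pt (- (form_of a b c q (Y q) * cy (Z q))) (form_of a b c q (Y q) * cx (Z q)) 0) oM Mp).
      by move=> q Mq; rewrite TE'.
    move: da db dc dY dZ; generalize ('D_(X p) Y p) ('D_(X p) Z p) => dY0 dZ0.
    move=> da db dc dY dZ; rewrite /form_of in da db *; eapply is_derive_eq.
      by apply: is_derive_pt; derive_solve.
    by rewrite /rotJ; apply: coordP; rewrite !coordE; field.
  rewrite (derive_val (is_derive := E)).
  rewrite !TE// /form_of /christoffel /rotJ.
  by generalize_derive; apply: coordP; rewrite !coordE; field.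
Qed.

Lemma delta_e1 : delta_mx 0 0 = e1 :> V.
Proof. by apply: coordP; rewrite !coordE /cx /cy /cz mxE. Qed.

Lemma delta_e2 : delta_mx 0 1 = e2 :> V.
Proof. by apply: coordP; rewrite !coordE /cx /cy /cz mxE. Qed.

Lemma delta_e3 : delta_mx 0 ord_max = e3 :> V.
Proof. by apply: coordP; rewrite !coordE /cx /cy /cz mxE. Qed.

Lemma invmx_gram p : M p ->
  invmx (\matrix_(i < 3, j < 3) g p (delta_mx 0 i) (delta_mx 0 j)) =
  diag_mx (pt (cy p ^+ 2) (cy p ^+ 2) 1).
Proof.
move=> /cy_neq0 y0; set G := \matrix_(i, j) _.
have GE : G *m diag_mx (pt (cy p ^+ 2) (cy p ^+ 2) 1) = 1%:M.
  rewrite mul_mx_diag; apply/matrixP.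
  have c0 (a b c : R) : pt a b c 0 0 = a by rewrite mxE.
  have c1 (a b c : R) : pt a b c 0 1 = b by rewrite mxE.
  have c2 (a b c : R) : pt a b c 0 ord_max = c by rewrite mxE.
  by apply: ord3P; apply: ord3P; rewrite !mxE ?(delta_e1, delta_e2, delta_e3) ?(c0, c1, c2)
    /gH2xR !coordE /=; field.
have uG : G \in unitmx by case/mulmx1_unit: GE.
by rewrite -[RHS]mul1mx -(mulVmx uG) -mulmxA GE mulmx1.
Qed.

(** [dVH2 (v, x) = g (J v, x)], so raising the last index of the area form gives [J]. *)
Lemma raise_wedge (w : form1) p u v : M p ->
  raise g (tens12 w dVH2) p u v = w p u *: rotJ v.
Proof.
move=> Mp; rewrite /raise (invmx_gram Mp) mul_mx_diag.
have y0 := cy_neq0 Mp.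
rewrite /tens12 /dVH2 /wedge1 /theta1 /theta2.
apply/rowP; apply: ord3P; rewrite !mxE ?(delta_e1, delta_e2, delta_e3) /=;
  rewrite !coordE; by field.
Qed.

Lemma T_productE l p u v : M p -> T_product l p u v = (l * cz u) *: rotJ v.
Proof.
move=> Mp; rewrite /T_product -(raise_wedge (fun p u => l * cz u) u v Mp).
congr (raise _ _ p u v).
by apply/funext => q; apply/funext => x; apply/funext => y; apply/funext => z;
  rewrite /tens12 /theta3 mulrA.
Qed.

Lemma T_solvableE p u v : M p -> T_solvable p u v = (cx u / cy p) *: rotJ v.
Proof. by move=> Mp; rewrite /T_solvable raise_wedge. Qed.

Lemma homogeneous_T_product l : homogeneous_structure M g (T_product l).
Proof.
have oM := @open_H2xR R.
apply: (@structure_equations_homogeneous _ (fun=> 0) (fun=> 0) (fun=> l)).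
split; [exact: smooth_cst..| |].
- by move=> p Mp u v; rewrite T_productE// /form_of !mul0r !add0r.
- move=> p Mp u; split; apply: is_derive_eq (is_derive_fun_cst _ _ _) _ => //.
  + by rewrite /form_of; ring.
  + by rewrite /form_of; ring.
Qed.

Lemma homogeneous_T_solvable : homogeneous_structure M g T_solvable.
Proof.
have oM := @open_H2xR R.
apply: (@structure_equations_homogeneous _ (fun p => (cy p)^-1) (fun=> 0) (fun=> 0)).
split; [|exact: smooth_cst|exact: smooth_cst| |].
- by smooth_solve => p /cy_neq0.
- by move=> p Mp u v; rewrite T_solvableE// /form_of !mul0r !addr0 mulrC.
- move=> p Mp u; have y0 := cy_neq0 Mp; split.
  + by derive_by; rewrite /form_of; field.
  + apply: is_derive_eq (is_derive_fun_cst _ _ _) _ => //.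
    by rewrite /form_of; field.
  + exact: is_derive_fun_cst.
Qed.

End StructureEquations.

(** Proves an equation modulo one hypothesis: [k] is the cofactor of that hypothesis, and the
    remaining identity is left to [ring] or [field]. *)
Lemma eq_of_multiple {K : pzRingType} (k x y z w : K) :
  x = y -> z - w = k * (x - y) -> z = w.
Proof. by move=> ->; rewrite subrr mulr0 => /subr0_eq. Qed.

(** * Isometries of [H^2 x R] *)

Section Isometries.
Context {R : realType}.
Local Notation V := 'rV[R]_3.
Local Notation M := (@H2xR R).
Local Notation g := (@gH2xR R).
Implicit Types (u v w p : V) (T : @tensor12 R 3) (a b c d s e : R).

(** Isometries and intertwining are stated with the differential ['d], whereas derivatives are
    computed direction by direction; differentiability ties the two. *)
Lemma diff_is_derive (phi : V -> V) p u dphi :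
  differentiable phi p -> is_derive p u phi dphi -> 'd phi p u = dphi.
Proof. by move=> h [_ <-]; rewrite deriveE. Qed.

Lemma differentiable_pt (f1 f2 f3 : V -> R) p : differentiable f1 p ->
  differentiable f2 p -> differentiable f3 p ->
  differentiable (fun q => pt (f1 q) (f2 q) (f3 q)) p.
Proof.
move=> h1 h2 h3.
rewrite (_ : (fun q => _) = (fun q => f1 q *: e1) + ((fun q => f2 q *: e2) +
    (fun q => f3 q *: e3))); last first.
  by apply/funext => q; rewrite !fctE; apply: coordP; rewrite !coordE; ring.
by apply: differentiableD; [|apply: differentiableD]; exact: differentiableZl.
Qed.

(** [|c w + d| ^ 2] for [w = x + i y]. *)
Definition mobius_denom c d p : R := (c * cx p + d) ^+ 2 + (c * cy p) ^+ 2.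

(** Real and imaginary part of [(a w + b) / (c w + d)], with a translation of the line. The
    determinant is not normalised, so that [w -> a w + b] belongs to the family. *)
Definition mobius_map a b c d s p : V :=
  pt (((a * cx p + b) * (c * cx p + d) + a * c * cy p ^+ 2) / mobius_denom c d p)
     ((a * d - b * c) * cy p / mobius_denom c d p) (cz p + s).

(* Multiplication by the complex derivative [(ad - bc) / (c w + d)^2]. *)
Definition mobius_diff a b c d p u : V :=
  let k := (a * d - b * c) * ((c * cx p + d) ^+ 2 - (c * cy p) ^+ 2)
             / mobius_denom c d p ^+ 2 in
  let l := (a * d - b * c) * (- 2 * (c * cx p + d) * (c * cy p))
             / mobius_denom c d p ^+ 2 in
  pt (k * cx u - l * cy u) (k * cy u + l * cx u) (cz u).

Lemma mobius_denom_gt0 a b c d p : a * d - b * c != 0 -> M p ->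
  0 < mobius_denom c d p.
Proof.
move=> D0 Mp; have y0 : 0 < cy p by [].
rewrite lt0r addr_ge0 ?sqr_ge0// andbT /mobius_denom paddr_eq0 ?sqr_ge0//.
rewrite !sqrf_eq0 mulf_eq0 (gt_eqF y0) orbF.
apply: contra D0 => /andP[/eqP h /eqP c0]; move: h; rewrite c0 mul0r add0r => ->.
by rewrite !mulr0 subrr.
Qed.

Lemma is_derive_mobius a b c d s p u : a * d - b * c != 0 -> M p ->
  is_derive p u (mobius_map a b c d s) (mobius_diff a b c d p u).
Proof.
move=> D0 Mp; have n0 := lt0r_neq0 (mobius_denom_gt0 D0 Mp).
rewrite /mobius_map /mobius_diff; rewrite /mobius_denom in n0 *.
eapply is_derive_eq; first by apply: is_derive_pt; derive_solve.
by apply: coordP; rewrite !coordE //=; field.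
Qed.

Lemma differentiable_mobius a b c d s p : a * d - b * c != 0 -> M p ->
  differentiable (mobius_map a b c d s) p.
Proof.
move=> D0 Mp; have n0 := lt0r_neq0 (mobius_denom_gt0 D0 Mp).
have dx : differentiable (@cx R) p by exact: differentiable_coord.
have dy : differentiable (@cy R) p by exact: differentiable_coord.
have dz : differentiable (@cz R) p by exact: differentiable_coord.
have dc k : differentiable (fun _ : V => k) p by exact: differentiable_cst.
have dD (f h : V -> R) : differentiable f p -> differentiable h p ->
  differentiable (fun q => f q + h q) p by exact: differentiableD.
have dM (f h : V -> R) : differentiable f p -> differentiable h p ->
  differentiable (fun q => f q * h q) p by exact: differentiableM.
have dV (f : V -> R) : f p != 0 -> differentiable f p ->
  differentiable (fun q => (f q)^-1) p by move=> *; exact: differentiableV.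
have dn : differentiable (mobius_denom c d) p.
  rewrite /mobius_denom; under eq_fun do rewrite !expr2.
  by apply: (dD); apply: (dM); do ?[apply: (dD) | apply: (dM)].
apply: differentiable_pt; last exact: dD.
- apply: (dM); last exact: dV.
  under eq_fun do rewrite expr2.
  by apply: (dD); apply: (dM); do ?[apply: (dD) | apply: (dM)].
- apply: (dM); last exact: dV.
  exact: dM.
Qed.

Lemma diff_mobius a b c d s p u : a * d - b * c != 0 -> M p ->
  'd (mobius_map a b c d s) p u = mobius_diff a b c d p u.
Proof.
move=> D0 Mp; apply: diff_is_derive; first exact: differentiable_mobius.
exact: is_derive_mobius.
Qed.

Lemma H2xR_mobius a b c d s p : 0 < a * d - b * c -> M p ->
  M (mobius_map a b c d s p).
Proof.
move=> D0 Mp; rewrite /H2xR /= /mobius_map coordE.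
apply: divr_gt0; first exact: mulr_gt0.
exact: mobius_denom_gt0 (lt0r_neq0 D0) Mp.
Qed.

(** The adjugate inverts the map without division by the determinant, since proportional matrices
    induce the same map of the half plane. *)
Lemma mobius_mapK a b c d s p : 0 < a * d - b * c -> M p ->
  mobius_map d (- b) (- c) a (- s) (mobius_map a b c d s p) = p.
Proof.
move=> D0 Mp; have n0 := lt0r_neq0 (mobius_denom_gt0 (lt0r_neq0 D0) Mp).
have D1 := lt0r_neq0 D0.
have nE : mobius_denom (- c) a (mobius_map a b c d s p) =
    (a * d - b * c) ^+ 2 / mobius_denom c d p.
  rewrite /mobius_map {1}/mobius_denom !coordE.
  by rewrite /mobius_denom in n0 *; field.
rewrite {1}/mobius_map nE /mobius_map; apply: coordP; rewrite !coordE.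
- by rewrite /mobius_denom in n0 *; field; rewrite n0.
- by rewrite /mobius_denom in n0 *; field; rewrite n0.
- by ring.
Qed.

Lemma smooth_mobius a b c d s : a * d - b * c != 0 ->
  smooth M (mobius_map a b c d s).
Proof.
move=> D0; have oM := @open_H2xR R; rewrite /mobius_map /mobius_denom.
by smooth_solve => p Mp; exact: lt0r_neq0 (mobius_denom_gt0 D0 Mp).
Qed.

Lemma isometry_mobius a b c d s : 0 < a * d - b * c ->
  Defs.isometry M g M g (mobius_map a b c d s).
Proof.
move=> D0; have D1 := lt0r_neq0 D0.
have D0' : 0 < d * a - - b * - c by rewrite mulrNN (mulrC d).
split; first exact: smooth_mobius.
- exists (mobius_map d (- b) (- c) a (- s)); split.
  + exact: smooth_mobius (lt0r_neq0 D0').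
  + by move=> p Mp; split; [exact: H2xR_mobius|exact: mobius_mapK].
  + move=> q Mq; split; first exact: H2xR_mobius.
    by have := mobius_mapK (- s) D0' Mq; rewrite !opprK.
- move=> p Mp u v; rewrite !diff_mobius// /gH2xR.
  have n0 := lt0r_neq0 (mobius_denom_gt0 D1 Mp); have y0 := cy_neq0 Mp.
  rewrite /mobius_diff /mobius_map !coordE; rewrite /mobius_denom in n0 *.
  by field; rewrite ?n0 ?D1 ?y0.
Qed.

(** With [e = 1] this is the identity, which lets one lemma treat both signs. *)
Definition reflection e p : V := pt (cx p) (cy p) (e * cz p).

Lemma diff_reflection e p u : 'd (reflection e) p u = reflection e u.
Proof.
apply: diff_is_derive.
  apply: differentiable_pt; [exact: differentiable_coord|exact: differentiable_coord|].
  by apply: differentiableM; [exact: differentiable_cst|exact: differentiable_coord].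
rewrite /reflection; eapply is_derive_eq; first by apply: is_derive_pt; derive_solve.
by apply: coordP; rewrite !coordE; ring.
Qed.

Lemma isometry_reflection e : e * e = 1 -> Defs.isometry M g M g (reflection e).
Proof.
move=> ee; have oM := @open_H2xR R.
have sr : smooth M (reflection e) by rewrite /reflection; smooth_solve.
have Mr p : M p -> M (reflection e p) by rewrite /H2xR/= /reflection coordE.
have rK p : reflection e (reflection e p) = p.
  by rewrite /reflection; apply: coordP; rewrite !coordE// mulrA ee mul1r.
split=> //; first by exists (reflection e); split=> // p Mp; split=> //; exact: Mr.
move=> p Mp u v; rewrite !diff_reflection /gH2xR /reflection !coordE.
by rewrite mulrACA ee mul1r.
Qed.

Lemma isomorphic_reflection e T T' : e * e = 1 ->
  (forall p u v, M p -> reflection e (T p u v) =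
     T' (reflection e p) (reflection e u) (reflection e v)) ->
  isomorphic M g T M g T'.
Proof.
move=> ee h; exists (reflection e); first exact: isometry_reflection.
by move=> p Mp u v; rewrite !diff_reflection h.
Qed.

(** The differential is complex linear on the hyperbolic factor, where [J] is multiplication by [i].
    Hence only 1-forms remain to be compared under these maps. *)
Lemma mobius_diff_rotJ a b c d p (k : R) v :
  mobius_diff a b c d p (k *: rotJ v) = k *: rotJ (mobius_diff a b c d p v).
Proof. by rewrite /mobius_diff /rotJ; apply: coordP; rewrite !coordE; ring. Qed.

End Isometries.

(** * Classification *)

Section Classification.
Context {R : realType}.
Local Notation V := 'rV[R]_3.
Local Notation M := (@H2xR R).
Local Notation g := (@gH2xR R).
Implicit Types (u v w p : V) (T : @tensor12 R 3).

Lemma H2xR_segment p q (s : R) : M p -> M q -> 0 <= s <= 1 ->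
  M (p + s *: (q - p)).
Proof.
rewrite /H2xR /= !coordE => p0 q0 /andP[s0 s1].
have -> : cy p + s * (cy q - cy p) = (1 - s) * cy p + s * cy q by ring.
have [->|s'] := eqVneq s 0; first by rewrite subr0 mul1r mul0r addr0.
have h1 : 0 <= (1 - s) * cy p by rewrite mulr_ge0 ?subr_ge0// ltW.
have h2 : 0 < s * cy q by rewrite mulr_gt0// lt0r s'.
by lra.
Qed.

Lemma constant_on_H2xR (f : V -> R) :
  (forall p u, M p -> is_derive p u f 0) -> forall p q, M p -> M q -> f q = f p.
Proof.
move=> h p q Mp Mq; apply: (@derive_eq0_constant _ _ M f p q _ h).
by move=> s; exact: H2xR_segment.
Qed.

(** Integrability condition of a first-order system for [f] with right-hand side [F]: its
    derivatives in exchanged directions agree. *)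
Lemma mixed_derivatives (f : V -> R) (F : V -> V -> R) p u v d1 d2 :
  smooth M f -> (forall q w, M q -> is_derive q w f (F q w)) -> M p ->
  is_derive p u (fun q => F q v) d1 -> is_derive p v (fun q => F q u) d2 -> d1 = d2.
Proof.
move=> sf h Mp h1 h2; have oM := @open_H2xR R.
have DD u' v' d : is_derive p u' (fun q => F q v') d -> 'D_u' ('D_v' f) p = d.
  move=> hd; apply: derive_val; apply: (is_derive_near_eq oM Mp _ hd) => q Mq.
  by case: (h q v' Mq).
by rewrite -(DD _ _ _ h1) -(DD _ _ _ h2); exact: smooth_deriveC sf Mp.
Qed.

Section Solution.
Variables (T : @tensor12 R 3) (a b c : V -> R).
Hypothesis SE : structure_equations T a b c.

Let da p u : M p -> is_derive p u a
  ((b p * cx u - a p * cy u) / cy p - form_of a b c p u * b p).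
Proof. by case: SE => _ _ _ _ h Mp; case: (h p Mp u). Qed.

Let db p u : M p -> is_derive p u b
  (- (a p * cx u + b p * cy u) / cy p + form_of a b c p u * a p).
Proof. by case: SE => _ _ _ _ h Mp; case: (h p Mp u). Qed.

Let dc p u : M p -> is_derive p u c 0.
Proof. by case: SE => _ _ _ _ h Mp; case: (h p Mp u). Qed.

(** In this order, and up to a factor, these are the equalities of mixed derivatives of [a] along
    [(e1, e2)], [b] along [(e1, e2)], [a] along [(e1, e3)] and [b] along [(e2, e3)]. *)
Lemma integrability_conditions p : M p ->
  [/\ b p * (cy p ^+ 2 * (a p ^+ 2 + b p ^+ 2) - 1) = 0,
      a p * (cy p ^+ 2 * (a p ^+ 2 + b p ^+ 2) - 1) = 0,
      b p ^+ 2 * c p = 0 & a p ^+ 2 * c p = 0].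
Proof.
move=> Mp; have y0 := cy_neq0 Mp; case: SE => sa sb _ _ _.
have hc u := dc u Mp; have [hc1 hc2 hc3] := And3 (hc e1) (hc e2) (hc e3).
have [ha1 ha2 ha3] := And3 (da e1 Mp) (da e2 Mp) (da e3 Mp).
have [hb1 hb2 hb3] := And3 (db e1 Mp) (db e2 Mp) (db e3 Mp).
rewrite /form_of !coordE in ha1 ha2 ha3 hb1 hb2 hb3.
have a12 := mixed_derivatives (u := e1) (v := e2) sa da Mp.
have a13 := mixed_derivatives (u := e1) (v := e3) sa da Mp.
have b12 := mixed_derivatives (u := e1) (v := e2) sb db Mp.
have b23 := mixed_derivatives (u := e2) (v := e3) sb db Mp.
rewrite /form_of in a12 a13 b12 b23.
have e12 := a12 _ _ ltac:(derive_solve) ltac:(derive_solve).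
have e13 := a13 _ _ ltac:(derive_solve) ltac:(derive_solve).
have f12 := b12 _ _ ltac:(derive_solve) ltac:(derive_solve).
have f23 := b23 _ _ ltac:(derive_solve) ltac:(derive_solve).
rewrite !coordE in e12 e13 f12 f23.
have scaled (x y k z : R) : x = y -> z = k * (x - y) -> z = 0.
  by move=> -> ->; rewrite subrr mulr0.
split.
- by apply: (scaled _ _ (- cy p ^+ 2) _ e12); field.
- by apply: (scaled _ _ (cy p ^+ 2) _ f12); field.
- by apply: (scaled _ _ (- 1) _ e13); field.
- by apply: (scaled _ _ (- 1) _ f23); field.
Qed.

Lemma structure_dichotomy :
  (forall p, M p -> a p = 0 /\ b p = 0) \/
  (forall p, M p -> cy p ^+ 2 * (a p ^+ 2 + b p ^+ 2) = 1 /\ c p = 0).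
Proof.
(* [N] is the squared norm of the hyperbolic part of [w]. The integrability conditions offer the two
   cases point by point; constancy of [N] makes the choice global. *)
pose N p := cy p ^+ 2 * (a p ^+ 2 + b p ^+ 2).
have dN p u : M p -> is_derive p u N 0.
  move=> Mp; have y0 := cy_neq0 Mp; have ha := da u Mp; have hb := db u Mp.
  by rewrite /N /form_of in ha hb *; derive_by; field.
have Mo : M origin by rewrite /H2xR/= coordE.
have NE p : M p -> N p = N origin by move=> Mp; exact: constant_on_H2xR.
have [N1|N1] := eqVneq (N origin - 1) 0; [right|left] => p Mp.
  have Np : N p = 1 by rewrite NE//; exact: subr0_eq.
  split=> //; have [_ _ hb ha] := integrability_conditions Mp.
  have : N p * c p = 0.
    have -> : N p * c p = cy p ^+ 2 * (a p ^+ 2 * c p + b p ^+ 2 * c p) by rewrite /N; ring.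
    by rewrite ha hb addr0 mulr0.
  by rewrite Np mul1r.
have [hb ha _ _] := integrability_conditions Mp.
have Np : N p - 1 != 0 by rewrite NE.
split; apply: (mulIf Np); rewrite mul0r; [exact: ha|exact: hb].
Qed.

Lemma isomorphic_T_product : (forall p, M p -> a p = 0 /\ b p = 0) ->
  isomorphic M g T M g (T_product `|c origin|).
Proof.
move=> ab0; case: (SE) => _ _ _ TE _.
have Mo : M origin by rewrite /H2xR/= coordE.
have cE p : M p -> c p = c origin by move=> Mp; exact: constant_on_H2xR.
(* The sign of [c], taken as 1 for [c = 0] so that [e * e = 1] in every case. *)
pose e : R := if 0 <= c origin then 1 else - 1.
have ee : e * e = 1 by rewrite /e; case: ifP => _; ring.
have ce : c origin = `|c origin| * e.
  rewrite /e; case: ifPn => [h|]; first by rewrite ger0_norm// mulr1.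
  by rewrite -ltNge => h; rewrite ltr0_norm// mulrN1 opprK.
apply: (isomorphic_reflection ee) => p u v Mp.
have Mr : M (reflection e p) by rewrite /H2xR/= /reflection coordE.
have [a0 b0] := ab0 p Mp.
rewrite TE// T_productE// /form_of a0 b0 cE// {1}ce /reflection /rotJ.
by apply: coordP; rewrite !coordE; ring.
Qed.

Section NullForm.
Hypothesis unit_ab : forall p, M p ->
  cy p ^+ 2 * (a p ^+ 2 + b p ^+ 2) = 1 /\ c p = 0.

(* With [w = cos f theta1 + sin f theta2] these are [2 sin^2], [2 sin * t] and
   [2 (sin^2 + t^2)] of the half angle, [t = x sin - y cos]; the geodesics tangent
   to the kernel of [w] meet at the boundary point [t / sin].  All three functions
   have the same logarithmic differential, so this point is a constant of the system. *)
Let bd1 p : R := 1 - cy p * a p.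
Let bd2 p : R := cx p * (1 - cy p * a p) - cy p * (cy p * b p).
Let bd3 p : R := (1 - cy p * a p) + cx p ^+ 2 * (1 - cy p * a p)
  - 2 * cx p * cy p * (cy p * b p) + cy p ^+ 2 * (1 + cy p * a p).
Let eta p u : R := - b p * cx u + (1 + cy p * a p) * cy u / cy p.

Let d_bd1 p u : M p -> is_derive p u bd1 (bd1 p * eta p u).
Proof.
move=> Mp; have y0 := cy_neq0 Mp; have ha := da u Mp; have hb := db u Mp.
have [E c0] := unit_ab Mp.
rewrite /form_of c0 in ha hb; rewrite /bd1 /eta; derive_by.
(* The derivative has the claimed form modulo the unit norm relation [E]. *)
by apply: (eq_of_multiple (k := cy u / cy p) E); field.
Qed.

Let d_bd2 p u : M p -> is_derive p u bd2 (bd2 p * eta p u).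
Proof.
move=> Mp; have y0 := cy_neq0 Mp; have ha := da u Mp; have hb := db u Mp.
have [E c0] := unit_ab Mp.
rewrite /form_of c0 in ha hb; rewrite /bd2 /eta; derive_by.
by apply: (eq_of_multiple (k := cx p * cy u / cy p - cx u) E); field.
Qed.

Let d_bd3 p u : M p -> is_derive p u bd3 (bd3 p * eta p u).
Proof.
move=> Mp; have y0 := cy_neq0 Mp; have ha := da u Mp; have hb := db u Mp.
have [E c0] := unit_ab Mp.
rewrite /form_of c0 in ha hb; rewrite /bd3 /eta; derive_by.
by apply: (eq_of_multiple (k := cy u / cy p + cx p ^+ 2 * cy u / cy p
  - 2 * cx p * cx u - cy p * cy u) E); rewrite /=; field.
Qed.

Let bd1_ge0 p : M p -> 0 <= bd1 p.
Proof.
move=> Mp; have [E _] := unit_ab Mp.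
have h : (cy p * a p) ^+ 2 <= 1.
  by rewrite -E exprMn mulrDr lerDl mulr_ge0 ?sqr_ge0.
by rewrite /bd1 subr_ge0; nra.
Qed.

(** [bd1 * bd3 = bd1 ^ 2 + bd2 ^ 2] by the unit norm relation, and [bd3 = 2 y ^ 2] where [bd1]
    vanishes. So [bd3] is a denominator that serves every boundary point, infinity included. *)
Let bd3_gt0 p : M p -> 0 < bd3 p.
Proof.
move=> Mp; have [E _] := unit_ab Mp; have y0 : 0 < cy p by [].
have h1 := bd1_ge0 Mp.
have [h|h] := eqVneq (bd1 p) 0.
  have Q0 : cy p * b p = 0.
    apply/eqP; rewrite -sqrf_eq0; apply/eqP.
    have -> : (cy p * b p) ^+ 2 = bd1 p * (1 + cy p * a p).
      by apply: (eq_of_multiple (k := 1) E); rewrite /bd1; ring.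
    by rewrite h mul0r.
  rewrite /bd3 -/(bd1 p) h Q0 !mulr0 addr0 subr0 add0r.
  by move: h; rewrite /bd1; nra.
have h' : 0 < bd1 p by rewrite lt0r h.
have E2 : bd1 p * bd3 p = bd1 p ^+ 2 + bd2 p ^+ 2.
  by apply: (eq_of_multiple (k := - cy p ^+ 2) E); rewrite /bd1 /bd2 /bd3; ring.
have : 0 < bd1 p * bd3 p by rewrite E2 ltr_pwDl ?exprn_gt0 ?sqr_ge0.
by rewrite pmulr_rgt0.
Qed.

Let quotient_constant (f : V -> R) p : (forall q u, M q -> is_derive q u f (f q * eta q u)) ->
  M p -> f p / bd3 p = f origin / bd3 origin.
Proof.
move=> df Mp; have Mo : M (origin : V) by rewrite /H2xR/= coordE.
apply: (constant_on_H2xR (f := fun q => f q / bd3 q)) => // q u Mq.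
have h1 := df q u Mq; have h2 := d_bd3 u Mq; have n0 := lt0r_neq0 (bd3_gt0 Mq).
apply: is_derive_eq (is_derive_funM h1 (is_derive_funV n0 h2)) _.
by field.
Qed.

Lemma isomorphic_T_solvable : isomorphic M g T M g T_solvable.
Proof.
case: (SE) => _ _ _ TE _.
have Mo : M (origin : V) by rewrite /H2xR/= coordE.
have n0 p : M p -> bd3 p != 0 by move=> Mp; exact: lt0r_neq0 (bd3_gt0 Mp).
have q1 p := quotient_constant (p := p) d_bd1.
have q2 p := quotient_constant (p := p) d_bd2.
(* If [bd1] vanishes at the origin it vanishes everywhere: the boundary point is infinity, [w] is
   [theta1] itself, and the identity is the isomorphism. *)
have [b0|b0] := eqVneq (bd1 origin) 0.
  apply: (isomorphic_reflection (e := 1)) => [|p u v Mp]; first by rewrite mulr1.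
  have r1 w : reflection 1 w = w.
    by apply: coordP; rewrite /reflection !coordE ?mul1r.
  have [E c0] := unit_ab Mp; have y0 := cy_neq0 Mp.
  have h : bd1 p = 0.
    by apply: (mulIf (_ : (bd3 p)^-1 != 0)); rewrite ?invr_eq0 ?n0// q1// b0 !mul0r.
  have aE : a p = (cy p)^-1.
    by apply: (mulfI y0); rewrite divff//; apply/eqP; rewrite eq_sym -subr_eq0; apply/eqP.
  have bE : b p = 0.
    apply/eqP; rewrite -sqrf_eq0; apply/eqP; apply: (mulfI (_ : cy p ^+ 2 != 0)).
      by rewrite expf_neq0.
    move: E; rewrite aE mulr0 mulrDr exprVn divff ?expf_neq0// => E.
    by apply/eqP; rewrite -subr_eq0 -[X in _ - X](subrr 1) -{1}E; apply/eqP; ring.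
  by rewrite !r1 TE// T_solvableE// /form_of aE bE c0 !mul0r !addr0 mulrC.
(* The finite boundary point; the map [w -> -1 / (w - x0)] used below has determinant 1 and moves it
   to infinity. *)
pose x0 : R := bd2 origin / bd1 origin.
have D0 : 0 < 0 * (- x0) - (- 1) * 1 :> R by rewrite mul0r add0r mulN1r opprK.
exists (mobius_map 0 (- 1) 1 (- x0) 0); first exact: isometry_mobius.
move=> p Mp u v; have D1 := lt0r_neq0 D0; rewrite !diff_mobius//.
have y0 := cy_neq0 Mp; have [E c0] := unit_ab Mp.
rewrite TE// T_solvableE; last exact: H2xR_mobius.
rewrite mobius_diff_rotJ; congr (_ *: _).
have h1 : bd1 p != 0.
  apply/negP => /eqP h; have := q1 p Mp; rewrite h mul0r => /esym/eqP.
  by rewrite mulf_eq0 (negPf b0) invr_eq0 (negPf (n0 _ Mo)).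
have x0E : bd2 p = x0 * bd1 p.
  rewrite -[bd2 p](divfK (n0 p Mp)) -[bd1 p in RHS](divfK (n0 p Mp)) q1// q2// /x0.
  by field; rewrite b0 n0.
pose t := cx p - x0.
have Q : cy p * (cy p * b p) = t * bd1 p.
  by rewrite /t mulrBl -x0E /bd2 -/(bd1 p); ring.
(* The unit norm relation, written through [Q], determines [bd1], and hence [a] and [b], as explicit
   functions of [t] and [y]. *)
have U : bd1 p * (cy p ^+ 2 + t ^+ 2) = 2 * cy p ^+ 2.
  apply: (mulfI h1).
  have : cy p ^+ 2 * (bd1 p * (2 - bd1 p)) = (t * bd1 p) ^+ 2.
    by rewrite -Q; apply: (eq_of_multiple (k := - cy p ^+ 2) E); rewrite /bd1; ring.
  by move=> h; apply: (eq_of_multiple (k := - 1) h); ring.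
have m0 : t ^+ 2 + cy p ^+ 2 != 0.
  have : 0 < cy p ^+ 2 by rewrite exprn_even_gt0.
  by move=> h; rewrite gt_eqF// ltr_wpDl ?sqr_ge0.
have bd1E : bd1 p = 2 * cy p ^+ 2 / (t ^+ 2 + cy p ^+ 2).
  by apply: (mulIf m0); rewrite divfK// addrC.
have aE : a p = (t ^+ 2 - cy p ^+ 2) / (cy p * (t ^+ 2 + cy p ^+ 2)).
  have -> : a p = (1 - bd1 p) / cy p by rewrite /bd1; field.
  by rewrite bd1E; field; rewrite y0 m0.
have bE : b p = 2 * t / (t ^+ 2 + cy p ^+ 2).
  have -> : b p = t * bd1 p / cy p ^+ 2 by rewrite -Q; field.
  by rewrite bd1E; field; rewrite y0 m0.
have nE : mobius_denom 1 (- x0) p = t ^+ 2 + cy p ^+ 2.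
  by rewrite /mobius_denom /t !mul1r.
rewrite /form_of c0 aE bE /mobius_diff /mobius_map !coordE nE !mul1r -/t.
by field; rewrite y0 m0.
Qed.

End NullForm.
End Solution.

Theorem homogeneous_structure_listed T : homogeneous_structure M g T ->
  exists k : option R, listed k /\ isomorphic M g T M g (T_listed k).
Proof.
move=> /homogeneous_structure_equations[a [b [c SE]]].
case: (structure_dichotomy SE) => h.
- exists (Some `|c origin|); split; first exact: normr_ge0.
  exact: isomorphic_T_product SE h.
- by exists None; split=> //; exact: isomorphic_T_solvable SE h.
Qed.

End Classification.

(** * Invariants distinguishing the listed tensors *)

Section Uniqueness.
Context {R : realType}.
Local Notation V := 'rV[R]_3.
Local Notation M := (@H2xR R).
Local Notation g := (@gH2xR R).
Implicit Types (u v w p : V) (T : @tensor12 R 3).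

(** Injective because the metric is nondegenerate, hence bijective, being given by a square
    matrix. *)
Lemma isometry_diff_bijective (phi : V -> V) p : M p -> M (phi p) ->
  (forall u v, g (phi p) ('d phi p u) ('d phi p v) = g p u v) ->
  (forall u, 'd phi p u = 0 -> u = 0) /\ (forall w, exists u, 'd phi p u = w).
Proof.
move=> Mp Mq iso.
have inj u : 'd phi p u = 0 -> u = 0.
  move=> E; apply: (gH2xR_nondegenerate Mp) => v; rewrite -iso E /gH2xR !coordE.
  by ring.
split=> // w; pose A := lin1_mx ('d phi p).
have uA : A \in unitmx.
  by rewrite -row_free_unit; apply: inj_row_free => v; rewrite mul_rV_lin1; exact: inj.
exists (w *m invmx A); have := mul_rV_lin1 ('d phi p) (w *m invmx A).
by rewrite -/A mulmxKV.
Qed.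

(** Surjectivity of [L] provides vectors at the origin with prescribed images, on which the model
    tensor is explicit. *)
Lemma isomorphic_pointwise T T' : isomorphic M g T M g T' ->
  exists q (L : V -> V), [/\ M q, forall u v, g q (L u) (L v) = g origin u v,
    forall u v, L (T origin u v) = T' q (L u) (L v),
    forall u, L u = 0 <-> u = 0 & forall w, exists u, L u = w].
Proof.
have Mo : M (origin : V) by rewrite /H2xR/= coordE.
move=> [phi [_ [psi [_ h _]] iso] tw]; have [Mq _] := h _ Mo.
have [inj surj] := isometry_diff_bijective Mo Mq (iso _ Mo).
exists (phi origin), ('d phi origin); split=> //.
- exact: iso.
- exact: tw.
- by move=> u; split=> [/inj|->]//; rewrite linear0.
Qed.

Lemma isomorphic_T_product_nilpotent T l : isomorphic M g T M g (T_product l) ->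
  forall u v w, T origin (T origin u v) w = 0.
Proof.
move=> /isomorphic_pointwise[q [L [Mq _ tw L0 _]]] u v w; apply/L0.
by rewrite !tw !T_productE// /rotJ !coordE !mulr0 scale0r.
Qed.

Lemma isomorphic_T_solvable_not_nilpotent T : isomorphic M g T M g T_solvable ->
  exists u v w, T origin (T origin u v) w <> 0.
Proof.
move=> /isomorphic_pointwise[q [L [Mq _ tw L0 surj]]].
have [u Lu] := surj e1; have [v Lv] := surj e2.
exists u, v, u => /L0; rewrite !tw Lu Lv !T_solvableE// => /(congr1 (@cy R)).
have y0 := cy_neq0 Mq; rewrite /rotJ !coordE => E.
have : - 1 = 0 :> R by rewrite -[RHS](mulr0 (cy q ^+ 2)) -E; field.
by move/eqP; rewrite oppr_eq0 oner_eq0.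
Qed.

Lemma T_product_norm_le T l : isomorphic M g T M g (T_product l) ->
  forall u v, g origin (T origin u v) (T origin u v) <=
    l ^+ 2 * (g origin u u * g origin v v).
Proof.
move=> /isomorphic_pointwise[q [L [Mq iso tw _ _]]] u v.
rewrite -!iso tw T_productE//; move: (L u) (L v) => x y.
rewrite /gH2xR /rotJ !coordE.
have i0 : 0 <= (cy q ^+ 2)^-1 by rewrite invr_ge0 sqr_ge0.
move: i0; move: (cy q ^+ 2)^-1 => i i0.
have -> : (l * cz x * - cy y * (l * cz x * - cy y)
    + l * cz x * cx y * (l * cz x * cx y)) * i + l * cz x * 0 * (l * cz x * 0) =
    l ^+ 2 * (cz x * cz x * ((cx y * cx y + cy y * cy y) * i)) by ring.
have h a : 0 <= a * a :> R by rewrite -expr2 sqr_ge0.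
rewrite ler_wpM2l ?sqr_ge0// ler_pM//.
- by rewrite mulr_ge0// addr_ge0.
- by rewrite lerDr mulr_ge0// addr_ge0.
- by rewrite lerDl.
Qed.

Lemma T_product_norm_attained T l : isomorphic M g T M g (T_product l) ->
  exists u v, [/\ g origin u u = 1, g origin v v = 1
    & g origin (T origin u v) (T origin u v) = l ^+ 2].
Proof.
move=> /isomorphic_pointwise[q [L [Mq iso tw _ surj]]].
have [u Lu] := surj e3; have [v Lv] := surj (cy q *: e1).
have y0 := cy_neq0 Mq.
exists u, v; split; rewrite -iso ?tw ?Lu ?Lv ?T_productE// /gH2xR /rotJ !coordE;
  by field.
Qed.

Lemma T_product_index_le T l l' : 0 <= l -> 0 <= l' ->
  isomorphic M g T M g (T_product l) -> isomorphic M g T M g (T_product l') ->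
  l <= l'.
Proof.
move=> l0 l'0 /T_product_norm_attained[u [v [u1 v1 E]]] /T_product_norm_le /(_ u v).
by rewrite E u1 v1 !mulr1 ler_pXn2r.
Qed.

(** Both isomorphisms start from the same [T], so the invariants of [T] at the origin compare the
    two indices directly. *)
Lemma listed_unique T (k k' : option R) : listed k -> listed k' ->
  isomorphic M g T M g (T_listed k) -> isomorphic M g T M g (T_listed k') -> k = k'.
Proof.
case: k k' => [l|] [l'|] //= l0 l'0.
- move=> h h'; congr Some; apply: le_anti; apply/andP; split;
  [exact: T_product_index_le h h'|exact: T_product_index_le h' h].
- move=> /isomorphic_T_product_nilpotent h /isomorphic_T_solvable_not_nilpotent.
  by move=> [u [v [w]]]; rewrite h.
- move=> /isomorphic_T_solvable_not_nilpotent[u [v [w h]]].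
  by move=> /isomorphic_T_product_nilpotent h'; case: h; rewrite h'.
Qed.

End Uniqueness.

(** * The matrix exponential *)

Lemma cvg_sum_ord {R : realType} n (f : 'I_n -> R^nat) (l : 'I_n -> R) :
  (forall i, f i @ \oo --> l i) -> (fun N => \sum_i f i N) @ \oo --> \sum_i l i.
Proof.
elim: n f l => [|n IH] f l h.
  rewrite big_ord0 (_ : (fun N => _) = cst 0); first exact: cvg_cst.
  by apply/funext => N; rewrite big_ord0.
rewrite big_ord_recl (_ : (fun N => _) =
    (fun N => f ord0 N + \sum_i f (lift ord0 i) N)); last first.
  by apply/funext => N; rewrite big_ord_recl.
by apply: cvgD; [exact: h|apply: IH => i; exact: h].
Qed.

Section MatrixExponential.
Context {R : realType} {k : nat}.
Local Notation gl := 'M[R]_k.+1.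
Implicit Types (X A : gl) (i j : 'I_k.+1) (t : R).

(** Unlike the largest entry, the sum of the absolute entries is submultiplicative, which bounds the
    powers by a geometric sequence. *)
Definition abs_sum X : R := \sum_i \sum_j `|X i j|.

Lemma abs_sum_ge0 X : 0 <= abs_sum X.
Proof. by apply: sumr_ge0 => i _; exact: sumr_ge0. Qed.

Lemma row_abs_sum_le X i : \sum_j `|X i j| <= abs_sum X.
Proof.
by rewrite /abs_sum [leRHS](bigD1 i)//= lerDl; apply: sumr_ge0 => i' _; exact: sumr_ge0.
Qed.

Lemma mulmx_entry_le A X i j (c : R) : (forall l, `|X l j| <= c) ->
  `|(A * X) i j| <= abs_sum A * c.
Proof.
move=> h; rewrite mxE; apply: le_trans (ler_norm_sum _ _ _) _.
apply: (@le_trans _ _ ((\sum_l `|A i l|) * c)).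
  by rewrite mulr_suml; apply: ler_sum => l _; rewrite normrM ler_wpM2l.
rewrite ler_wpM2r ?row_abs_sum_le//.
by apply: le_trans (h j).
Qed.

Lemma expr_entry_le X n i j : `|(X ^+ n) i j| <= abs_sum X ^+ n.
Proof.
elim: n i => [|n IH] i; first by rewrite !expr0 mxE; case: (i == j); rewrite ?normr1 ?normr0.
by rewrite !exprS; apply: mulmx_entry_le => l; exact: IH.
Qed.

(** The left factor [A] makes the family stable under termwise differentiation, which replaces [A]
    by [A * X]. *)
Definition exp_coef A X i j : R^nat := fun n => n`!%:R^-1 * (A * X ^+ n) i j.

Lemma is_cvg_exp_coef A X i j t : cvgn (pseries (exp_coef A X i j) t).
Proof.
apply: normed_cvg.
apply: (@series_le_cvg _ _ (fun n => abs_sum A * exp_coeff (abs_sum X * `|t|) n)).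
- by move=> n /=.
- by move=> n /=; rewrite mulr_ge0 ?abs_sum_ge0// exp_coeff_ge0// mulr_ge0 ?abs_sum_ge0.
- move=> n /=; rewrite /exp_coef !normrM normrX ger0_norm ?invr_ge0//.
  rewrite /exp_coeff /= exprMn -mulrA mulrC.
  rewrite [leRHS](_ : _ = abs_sum A * abs_sum X ^+ n * `|t| ^+ n / n`!%:R); last by ring.
  rewrite ler_wpM2r ?invr_ge0// ler_wpM2r ?exprn_ge0//.
  by apply: mulmx_entry_le => l; exact: expr_entry_le.
- rewrite (_ : (fun n => _) = abs_sum A *: exp_coeff (abs_sum X * `|t|))//.
  by apply: is_cvg_seriesZ; exact: is_cvg_series_exp_coeff.
Qed.

Lemma pseries_diffs_exp_coef A X i j :
  pseries_diffs (exp_coef A X i j) = exp_coef (A * X) X i j.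
Proof.
apply/funext => n; rewrite /pseries_diffs /exp_coef factS natrM invfM exprS.
rewrite (mulrA A); move: (_ i j) => x.
by rewrite 2!mulrA divff ?pnatr_eq0// mul1r.
Qed.

Definition exp_entry A X i j t : R := limn (pseries (exp_coef A X i j) t).

Lemma is_derive_exp_entry A X i j t :
  is_derive t 1 (exp_entry A X i j) (exp_entry (A * X) X i j t).
Proof.
have h : `|t| < `| `|t| + 1|.
  by rewrite [ltRHS]ger0_norm ?addr_ge0// ltrDl.
have := @pseries_snd_diffs _ (exp_coef A X i j) (`|t| + 1) t.
rewrite !pseries_diffs_exp_coef; apply => //; exact: is_cvg_exp_coef.
Qed.

Lemma exp_entryM A B X i j t :
  exp_entry (A * B) X i j t = \sum_l A i l * exp_entry B X l j t.
Proof.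
apply: cvg_lim => //.
rewrite (_ : pseries _ t = fun N => \sum_l A i l * pseries (exp_coef B X l j) t N).
  apply: cvg_sum_ord => l; by apply: cvgM; [exact: cvg_cst|exact: is_cvg_exp_coef].
apply/funext => N; rewrite /pseries /series /=.
under [RHS]eq_bigr do rewrite mulr_sumr.
rewrite exchange_big /=; apply: eq_bigr => n _.
rewrite /exp_coef (_ : (A * B * X ^+ n) i j = \sum_l A i l * (B * X ^+ n) l j).
  rewrite mulr_sumr mulr_suml.
  by apply: eq_bigr => l _; ring.
by rewrite -mulrA mxE.
Qed.

Lemma expmx_series_cvg X t :
  series (fun n : nat => n`!%:R^-1 *: (t *: X) ^+ n) @ \oo -->
  (\matrix_(i, j) exp_entry 1 X i j t : gl).
Proof.
apply/cvgrPdist_lt => e e0; near=> N.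
rewrite [ltLHS]/Num.Def.normr/= mx_normrE.
apply: bigmax_lt => //= ij _; rewrite !mxE.
rewrite [X in _ - X](_ : _ = pseries (exp_coef 1 X ij.1 ij.2) t N); last first.
  rewrite /series /= summxE; apply: eq_bigr => n _.
  by rewrite exprZn /= /exp_coef mul1r !mxE; ring.
move: ij; near: N; apply: filter_forall => ij.
by have /cvgrPdist_lt := @is_cvg_exp_coef 1 X ij.1 ij.2 t; apply.
Unshelve. all: by end_near. Qed.

Lemma expmxE X i j t : expmx (t *: X) i j = exp_entry 1 X i j t.
Proof.
by rewrite /expmx (cvg_lim (@norm_hausdorff _ _) (@expmx_series_cvg X t)) mxE.
Qed.

Lemma is_derive_expmx X i j t :
  is_derive t 1 (fun t : R => expmx (t *: X) i j) ((X * expmx (t *: X)) i j).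
Proof.
rewrite (_ : (fun t : R => _) = exp_entry 1 X i j); last first.
  by apply/funext => s; rewrite expmxE.
apply: is_derive_eq (is_derive_exp_entry 1 X i j t) _.
rewrite mul1r -[X in exp_entry X]mulr1 exp_entryM mxE.
by apply: eq_bigr => l _; rewrite expmxE.
Qed.

(** A linear relation between two entries that holds for every power, the identity included, passes
    to the series; this yields zero patterns and symmetries of exponentials. *)
Lemma expmx_entries X i j i' j' (a b : R) t :
  (forall n, a * (X ^+ n) i j + b * (X ^+ n) i' j' = 0) ->
  a * expmx (t *: X) i j + b * expmx (t *: X) i' j' = 0.
Proof.
move=> h; rewrite !expmxE /exp_entry.
have c1 := @is_cvg_exp_coef 1 X i j t; have c2 := @is_cvg_exp_coef 1 X i' j' t.
apply/esym; apply: (cvg_unique _ _ (cvgD (cvgM (cvg_cst a) c1) (cvgM (cvg_cst b) c2))) => //.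
rewrite (_ : _ + _ = cst 0); first exact: cvg_cst.
apply/funext => N; rewrite /= fctE /pseries /series /= !mulr_sumr -big_split /=.
apply: big1 => n _; rewrite /exp_coef mul1r -[RHS](mulr0 (n`!%:R^-1 * t ^+ n)) -(h n).
by ring.
Qed.

Lemma expmx_scale0 X : expmx ((0 : R) *: X) = 1.
Proof.
apply/matrixP => i j; rewrite expmxE; apply: cvg_lim => //.
apply: cvg_near_cst; near=> N; have N0 : (0 < N)%N by near: N; exists 1%N.
rewrite /pseries /series /= -(prednK N0) big_nat_recl// big1 ?addr0.
  by rewrite expr0 mulr1 /exp_coef expr0 mulr1 fact0 invr1 mul1r.
by move=> n _; rewrite expr0n mulr0.
Unshelve. all: by end_near. Qed.

Lemma is_derive_expmx0 X i j :
  is_derive (0 : R) 1 (fun t : R => expmx (t *: X) i j) (X i j).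
Proof. by have := is_derive_expmx X i j 0; rewrite expmx_scale0 mulr1. Qed.

Lemma derive_unique (f : R -> R) t d d' :
  is_derive t 1 f d -> is_derive t 1 f d' -> d = d'.
Proof. by move=> [_ <-] [_ <-]. Qed.

Lemma expmx_entries_tangent X i j i' j' (a b c : R) :
  (forall t : R, a * expmx (t *: X) i j + b * expmx (t *: X) i' j' = c) ->
  a * X i j + b * X i' j' = 0.
Proof.
move=> h; apply: (@derive_unique (fun=> c) 0).
rewrite (_ : (fun=> c) = fun t : R => a * expmx (t *: X) i j + b * expmx (t *: X) i' j').
  have d1 := is_derive_expmx0 X i j; have d2 := is_derive_expmx0 X i' j'.
  by derive_by; rewrite !mulr0 !addr0.
by apply/funext => t; rewrite h.
Qed.

Lemma linear_ode (f : R -> R) (a : R) : (forall t, is_derive t 1 f (a * f t)) ->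
  forall t, f t = f 0 * expR (a * t).
Proof.
move=> h t; pose e (s : R) := expR (- a * s).
have he (s : R) : is_derive s 1 e (- a * e s).
  apply: is_derive_eq (is_derive_fun_comp (is_derive_expR (- a * s))
    (is_derive_funM (is_derive_fun_cst _ _ _) (is_derive_id _ _))) _.
  by rewrite /e; ring.
have : f t * e t = f 0 * e 0.
  apply: (@is_derive_0_is_cst _ (fun s => f s * e s)) => s.
  by apply: is_derive_eq (is_derive_funM (h s) (he s)) _; ring.
rewrite /e mulr0 expR0 mulr1 => <-.
by rewrite -mulrA -expRD mulNr addNr expR0 mulr1.
Qed.

End MatrixExponential.

(** * The groups and their coset representations *)

Section BlockMatrices.
Context {R : realType}.
Local Notation gl := 'M[R]_3.
Implicit Types (P Q X : gl) (a b c d e : R).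

(** Common shape of both groups and of their Lie algebras: matrix computations become identities in
    five scalars. *)
Definition block3 a b c d e : gl :=
  \matrix_(i < 3, j < 3) nth 0 (nth [::] [:: [:: a; b; 0]; [:: c; d; 0]; [:: 0; 0; e]] i) j.

Lemma sum_ord3 (F : 'I_3 -> R) : \sum_i F i = F 0 + F 1 + F ord_max.
Proof.
rewrite !big_ord_recl big_ord0 addr0 addrA.
by congr (_ + F _ + F _); exact: val_inj.
Qed.

Lemma mx3P P Q : P 0 0 = Q 0 0 -> P 0 1 = Q 0 1 -> P 0 ord_max = Q 0 ord_max ->
  P 1 0 = Q 1 0 -> P 1 1 = Q 1 1 -> P 1 ord_max = Q 1 ord_max ->
  P ord_max 0 = Q ord_max 0 -> P ord_max 1 = Q ord_max 1 ->
  P ord_max ord_max = Q ord_max ord_max -> P = Q.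
Proof. by move=> *; apply/matrixP; apply: ord3P; apply: ord3P. Qed.

Lemma block3_00 a b c d e : block3 a b c d e 0 0 = a. Proof. by rewrite mxE. Qed.
Lemma block3_01 a b c d e : block3 a b c d e 0 1 = b. Proof. by rewrite mxE. Qed.
Lemma block3_02 a b c d e : block3 a b c d e 0 ord_max = 0. Proof. by rewrite mxE. Qed.
Lemma block3_10 a b c d e : block3 a b c d e 1 0 = c. Proof. by rewrite mxE. Qed.
Lemma block3_11 a b c d e : block3 a b c d e 1 1 = d. Proof. by rewrite mxE. Qed.
Lemma block3_12 a b c d e : block3 a b c d e 1 ord_max = 0. Proof. by rewrite mxE. Qed.
Lemma block3_20 a b c d e : block3 a b c d e ord_max 0 = 0. Proof. by rewrite mxE. Qed.
Lemma block3_21 a b c d e : block3 a b c d e ord_max 1 = 0. Proof. by rewrite mxE. Qed.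
Lemma block3_22 a b c d e : block3 a b c d e ord_max ord_max = e. Proof. by rewrite mxE. Qed.
Definition block3E := (block3_00, block3_01, block3_02, block3_10, block3_11,
  block3_12, block3_20, block3_21, block3_22).

Lemma block3P P : P 0 ord_max = 0 -> P 1 ord_max = 0 -> P ord_max 0 = 0 ->
  P ord_max 1 = 0 -> P = block3 (P 0 0) (P 0 1) (P 1 0) (P 1 1) (P ord_max ord_max).
Proof. by move=> h1 h2 h3 h4; apply: mx3P; rewrite block3E. Qed.

Lemma block3M a b c d e a' b' c' d' e' :
  block3 a b c d e * block3 a' b' c' d' e' =
  block3 (a * a' + b * c') (a * b' + b * d') (c * a' + d * c') (c * b' + d * d') (e * e').
Proof. by apply: mx3P; rewrite mxE sum_ord3 !block3E; ring. Qed.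

Lemma block3D a b c d e a' b' c' d' e' :
  block3 a b c d e + block3 a' b' c' d' e' =
  block3 (a + a') (b + b') (c + c') (d + d') (e + e').
Proof. by apply: mx3P; rewrite mxE !block3E ?addr0. Qed.

Lemma block3N a b c d e : - block3 a b c d e = block3 (- a) (- b) (- c) (- d) (- e).
Proof. by apply: mx3P; rewrite mxE !block3E ?oppr0. Qed.

Lemma block3Z k a b c d e :
  k *: block3 a b c d e = block3 (k * a) (k * b) (k * c) (k * d) (k * e).
Proof. by apply: mx3P; rewrite mxE !block3E ?mulr0. Qed.

Lemma block3_1 : block3 1 0 0 1 1 = 1.
Proof. by apply: mx3P; rewrite block3E mxE. Qed.

Lemma block3_0 : block3 0 0 0 0 0 = 0.
Proof. by apply: mx3P; rewrite block3E mxE. Qed.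

Lemma brk_block3 a b c d e a' b' c' d' e' :
  brk (block3 a b c d e) (block3 a' b' c' d' e') =
  block3 (b * c' - b' * c) (a * b' + b * d' - a' * b - b' * d)
    (c * a' + d * c' - c' * a - d' * c) (c * b' - c' * b) 0.
Proof. by rewrite /brk !block3M block3N block3D; apply: mx3P; rewrite !block3E; ring. Qed.

Lemma block3X n a b c d e : exists a' b' c' d',
  block3 a b c d e ^+ n = block3 a' b' c' d' (e ^+ n).
Proof.
elim: n => [|n [a' [b' [c' [d' IH]]]]].
  by exists 1, 0, 0, 1; rewrite !expr0 block3_1.
by rewrite exprS IH block3M exprS; do 4!eexists.
Qed.

Lemma inv_of_mul P Q : P * Q = 1 -> P^-1 = Q.
Proof.
move=> PQ; have [uP _] := mulmx1_unit PQ.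
by rewrite -[LHS]mulr1 -PQ mulKr.
Qed.

(** The corner entry solves a scalar linear equation; the upper block stays abstract. *)
Lemma expmx_block3 a b c d e t :
  expmx (t *: block3 a b c d e) = block3
    (expmx (t *: block3 a b c d e) 0 0) (expmx (t *: block3 a b c d e) 0 1)
    (expmx (t *: block3 a b c d e) 1 0) (expmx (t *: block3 a b c d e) 1 1)
    (expR (e * t)).
Proof.
set X := block3 a b c d e.
have h i j : (forall n, (X ^+ n) i j = 0) -> expmx (t *: X) i j = 0.
  move=> E; have := @expmx_entries R 2 X i j i j 1 0 t.
  by rewrite mul1r mul0r addr0; apply => n; rewrite E !mulr0 addr0.
have e22 s : expmx (s *: X) ord_max ord_max = expR (e * s).
  have der (r : R) : is_derive r 1 (fun r : R => expmx (r *: X) ord_max ord_max)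
      (e * expmx (r *: X) ord_max ord_max).
    apply: is_derive_eq (is_derive_expmx X ord_max ord_max r) _.
    by rewrite mxE sum_ord3 /X !block3E; ring.
  by rewrite (linear_ode der) expmx_scale0 mxE mul1r.
by rewrite -e22; apply: block3P; apply: h => n;
  have [a' [b' [c' [d' ->]]]] := block3X n a b c d e; rewrite block3E.
Qed.

Lemma SL2xR_elt_block3 (A : 'M[R]_2) (s : R) :
  SL2xR_elt A s = block3 (A 0 0) (A 0 1) (A 1 0) (A 1 1) (expR s).
Proof.
pose B : 'M[R]_(2 + 1) := block_mx A 0 0 (expR s)%:M.
have i0 : (0 : 'I_3) = lshift 1 0 :> 'I_(2 + 1) by exact: val_inj.
have i1 : (1 : 'I_3) = lshift 1 1 :> 'I_(2 + 1) by exact: val_inj.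
have i2 : (ord_max : 'I_3) = rshift 2 0 :> 'I_(2 + 1) by exact: val_inj.
(* The blocks are indexed by ['I_(2 + 1)], convertible to ['I_3] but written differently; [BE] moves
   an entry across explicit index equalities. *)
have BE (i j : 'I_3) (i' j' : 'I_(2 + 1)) (x : R) : i = i' -> j = j' ->
  B i' j' = x -> SL2xR_elt A s i j = x by move=> -> ->.
apply: mx3P; rewrite block3E; (eapply BE;
  [first [exact: i0|exact: i1|exact: i2]|first [exact: i0|exact: i1|exact: i2]|]);
  by rewrite ?(block_mxEul, block_mxEur, block_mxEdl, block_mxEdr) ?mxE.
Qed.

Lemma det_mx22 (A : 'M[R]_2) : \det A = A 0 0 * A 1 1 - A 0 1 * A 1 0.
Proof.
rewrite (expand_det_row _ 0) !big_ord_recl big_ord0 /cofactor !det_mx11 !mxE /=.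
rewrite addr0 expr0 expr1 mul1r mulN1r mulrN.
by congr (A _ _ * A _ _ - A _ _ * A _ _); exact: val_inj.
Qed.

Definition mx2 a b c d : 'M[R]_2 :=
  \matrix_(i < 2, j < 2) nth 0 (nth [::] [:: [:: a; b]; [:: c; d]] i) j.

Lemma SL2xRP P : SL2xR P <->
  exists a b c d e, [/\ a * d - b * c = 1, 0 < e & P = block3 a b c d e].
Proof.
split=> [[A [s [dA ->]]]|[a [b [c [d [e [D e0 ->]]]]]]].
  exists (A 0 0), (A 0 1), (A 1 0), (A 1 1), (expR s); rewrite expR_gt0 SL2xR_elt_block3.
  by split=> //; rewrite -dA det_mx22.
exists (mx2 a b c d), (ln e); rewrite SL2xR_elt_block3 det_mx22 !mxE /=.
by rewrite lnK ?posrE.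
Qed.

Lemma SO2P P : SO2 P <->
  exists a b, a ^+ 2 + b ^+ 2 = 1 /\ P = block3 a b (- b) a 1.
Proof.
split=> [[A [AA dA ->]]|[a [b [E ->]]]].
  move: dA; rewrite det_mx22 => dA.
  have ent i j : \sum_l A i l * A j l = (i == j)%:R.
    by have := congr1 (fun B : 'M[R]_2 => B i j) AA; rewrite !mxE => <-;
      apply: eq_bigr => l _; rewrite mxE.
  have := ent 0 0; have := ent 0 1; rewrite !big_ord_recl !big_ord0 /= !addr0.
  have -> : lift ord0 ord0 = 1 :> 'I_2 by exact: val_inj.
  move=> h01 h00; have E01 : A 0 0 * A 1 0 + A 0 1 * A 1 1 = 0 by [].
  have E00 : A 0 0 * A 0 0 + A 0 1 * A 0 1 = 1 by [].
  exists (A 0 0), (A 0 1); split; first by rewrite !expr2.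
  rewrite SL2xR_elt_block3 expR0; congr block3.
  (* Multiplying by the squared norm of the first row, then using orthogonality of the rows and the
     determinant, expresses the second row by the first. *)
  - rewrite -[LHS]mulr1 -E00.
    have -> : A 1 0 * (A 0 0 * A 0 0 + A 0 1 * A 0 1) =
      A 0 0 * (A 0 0 * A 1 0 + A 0 1 * A 1 1) - A 0 1 * (A 0 0 * A 1 1 - A 0 1 * A 1 0) by ring.
    by rewrite E01 dA mulr0 mulr1 sub0r.
  - rewrite -[LHS]mulr1 -E00.
    have -> : A 1 1 * (A 0 0 * A 0 0 + A 0 1 * A 0 1) =
      A 0 1 * (A 0 0 * A 1 0 + A 0 1 * A 1 1) + A 0 0 * (A 0 0 * A 1 1 - A 0 1 * A 1 0) by ring.
    by rewrite E01 dA mulr0 mulr1 add0r.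
exists (mx2 a b (- b) a); split.
- apply/matrixP => i j; rewrite !mxE !big_ord_recl big_ord0 !mxE /=.
  case: i => -[|[|//]] hi; case: j => -[|[|//]] hj; rewrite /= ?mulr1n ?mulr0n ?addr0 -?E; ring.
- by rewrite det_mx22 !mxE /= -E; ring.
- by rewrite SL2xR_elt_block3 expR0 !mxE.
Qed.

Lemma solv_elt_block3 p : solv_elt p = block3 (cy p) (cx p) 0 1 (expR (cz p)).
Proof. by []. Qed.

Lemma SolvP P : Solv P <-> exists a b e, [/\ 0 < a, 0 < e & P = block3 a b 0 1 e].
Proof.
split=> [[p p0 <-]|[a [b [e [a0 e0 ->]]]]].
  by exists (cy p), (cx p), (expR (cz p)); rewrite expR_gt0.
exists (pt b a (ln e)); first by rewrite /H2xR /= coordE.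
by rewrite solv_elt_block3 !coordE lnK ?posrE.
Qed.

End BlockMatrices.

(** * The two groups as connected closed matrix groups *)

Section LieGroupsOfIsometries.
Context {R : realType}.
Local Notation gl := 'M[R]_3.
Local Notation V := 'rV[R]_3.
Local Notation M := (@H2xR R).
Local Notation g := (@gH2xR R).
Implicit Types (P Q X : gl) (a b c d e : R).

(** The group is the union of the paths, all of which contain the identity. *)
Lemma connected_of_paths (G : set gl) :
  (forall P, G P -> exists f : R -> gl, [/\ continuous f, f 0 = 1, f 1 = P
    & forall t : R, 0 <= t <= 1 -> G (f t)]) -> connected G.
Proof.
move=> h.
have /choice[path pathP] P : exists f : R -> gl, G P -> [/\ continuous f, f 0 = 1,
    f 1 = P & forall t : R, 0 <= t <= 1 -> G (f t)].
  have [/h[f hf]|nGP] := pselect (G P); first by exists f.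
  by exists (fun=> 1) => /nGP.
rewrite (_ : G = \bigcup_(P in G) (path P @` `[0, 1])); last first.
  apply/seteqP; split=> [P GP|P [Q GQ [t]]].
    exists P => //; exists 1; first by rewrite /= in_itv /= lexx ler01.
    by case: (pathP P GP).
  by rewrite /= in_itv /= => ht <-; case: (pathP Q GQ) => _ _ _; exact.
apply: bigcup_connected => [|P GP].
  exists 1 => P GP; exists 0; first by rewrite /= in_itv /= lexx ler01.
  by case: (pathP P GP).
apply: connected_continuous_connected; first exact: segment_connected.
by apply: continuous_subspaceT; case: (pathP P GP).
Qed.

Lemma smooth_block3 {U : normedModType R} (A : set U) (a b c d e : U -> R) : open A ->
  smooth A a -> smooth A b -> smooth A c -> smooth A d -> smooth A e ->
  smooth A (fun q => block3 (a q) (b q) (c q) (d q) (e q)).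
Proof.
move=> oA sa sb sc sd se; apply/(smooth_mxP oA).
have h (f : U -> R) i j : smooth A f ->
    (forall q, block3 (a q) (b q) (c q) (d q) (e q) i j = f q) ->
    smooth A (fun q => block3 (a q) (b q) (c q) (d q) (e q) i j).
  by move=> sf E; apply: (smooth_eq oA) sf => q _; rewrite E.
have s0 := smooth_cst oA (0 : R).
apply: ord3P; apply: ord3P.
- exact: h sa (fun q => block3_00 _ _ _ _ _).
- exact: h sb (fun q => block3_01 _ _ _ _ _).
- exact: h s0 (fun q => block3_02 _ _ _ _ _).
- exact: h sc (fun q => block3_10 _ _ _ _ _).
- exact: h sd (fun q => block3_11 _ _ _ _ _).
- exact: h s0 (fun q => block3_12 _ _ _ _ _).
- exact: h s0 (fun q => block3_20 _ _ _ _ _).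
- exact: h s0 (fun q => block3_21 _ _ _ _ _).
- exact: h se (fun q => block3_22 _ _ _ _ _).
Qed.

Lemma act_SL2xRE P p : act_SL2xR P p =
  mobius_map (P 0 0) (P 0 1) (P 1 0) (P 1 1) (ln (P ord_max ord_max)) p.
Proof.
rewrite /act_SL2xR /moebius; move: (P 0 0) (P 0 1) (P 1 0) (P 1 1) => a b c d.
rewrite /mobius_map /mobius_denom; by simpc; congr pt => /=; ring.
Qed.

Lemma act_SolvE P p : Solv P -> act_Solv P p =
  mobius_map (P 0 0) (P 0 1) 0 1 (ln (P ord_max ord_max)) p.
Proof.
move=> /SolvP[a [b [e [a0 e0 ->]]]]; rewrite /act_Solv solv_elt_block3.
have -> : block3 a b 0 1 e *m block3 (cy p) (cx p) 0 1 (expR (cz p)) =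
  block3 a b 0 1 e * block3 (cy p) (cx p) 0 1 (expR (cz p)) by [].
rewrite block3M !block3E lnM ?posrE ?expR_gt0// expRK /mobius_map /mobius_denom.
by apply: coordP; rewrite !coordE; field.
Qed.

Lemma SL2xR_1 : SL2xR (1 : gl).
Proof. by apply/SL2xRP; exists 1, 0, 0, 1, 1; rewrite block3_1 ltr01; split=> //; ring. Qed.

Lemma SL2xR_mul P Q : SL2xR P -> SL2xR Q -> SL2xR (P * Q).
Proof.
move=> /SL2xRP[a [b [c [d [e [D e0 ->]]]]]] /SL2xRP[a' [b' [c' [d' [e' [D' e0' ->]]]]]].
apply/SL2xRP; rewrite block3M; do 5!eexists; split; last by [].
  by rewrite -[RHS]mulr1 -{1}D -D'; ring.
exact: mulr_gt0.
Qed.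

Lemma block3_inv a b c d e : a * d - b * c = 1 -> e != 0 ->
  block3 a b c d e * block3 d (- b) (- c) a e^-1 = 1.
Proof.
move=> D e0; rewrite block3M divff// -block3_1; congr block3; rewrite -?D; ring.
Qed.

Lemma SL2xR_inv P : SL2xR P -> SL2xR P^-1.
Proof.
move=> /SL2xRP[a [b [c [d [e [D e0 ->]]]]]].
rewrite (inv_of_mul (block3_inv D (lt0r_neq0 e0))); apply/SL2xRP.
by exists d, (- b), (- c), a, e^-1; split=> //; [rewrite -D; ring|rewrite invr_gt0].
Qed.

Lemma unitmx_row2 P : P \in unitmx -> P ord_max 0 = 0 -> P ord_max 1 = 0 ->
  P ord_max ord_max != 0.
Proof.
move=> uP h0 h1; apply/eqP => h2.
have := congr1 (fun Q : 'M[R]_3 => Q ord_max ord_max) (mulmxV uP).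
rewrite !mxE sum_ord3 h0 h1 h2 !mul0r !addr0 => /eqP.
by rewrite eqxx eq_sym oner_eq0.
Qed.

Lemma closed_entry_eq i j (x : R) : closed [set P : gl | P i j = x].
Proof.
apply: (preimage_closed (f := fun P : gl => P i j) (D := [set t | t = x])).
  by move=> P _; exact: coord_continuous.
exact: closed_eq.
Qed.

Lemma closed_entry_ge i j (x : R) : closed [set P : gl | x <= P i j].
Proof.
apply: (preimage_closed (f := fun P : gl => P i j) (D := [set t | x <= t])).
  by move=> P _; exact: coord_continuous.
exact: closed_ge.
Qed.

Lemma matrix_lie_group_SL2xR : matrix_lie_group (@SL2xR R).
Proof.
split; [|exact: SL2xR_1|exact: SL2xR_mul|exact: SL2xR_inv].
(* A closed condition can only ask for a nonnegative corner entry; invertibility makes it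
   positive. *)
exists ([set P : gl | P 0 ord_max = 0] `&` [set P : gl | P 1 ord_max = 0] `&`
  [set P : gl | P ord_max 0 = 0] `&` [set P : gl | P ord_max 1 = 0] `&`
  [set P : gl | 0 <= P ord_max ord_max] `&`
  [set P : gl | P 0 0 * P 1 1 - P 0 1 * P 1 0 = 1]).
  do !(apply: closedI); do ?exact: closed_entry_eq; do ?exact: closed_entry_ge.
  apply: (preimage_closed (f := fun P : gl => P 0 0 * P 1 1 - P 0 1 * P 1 0)
    (D := [set t | t = 1])); last exact: closed_eq.
  have oT : open [set: gl] by exact: openT.
  have se i j : smooth [set: gl] (fun P : gl => P i j).
    exact: (proj1 (smooth_mxP oT (fun q => q)) (smooth_id oT) i j).
  have [s00 s01] := (se 0 0, se 0 1); have [s10 s11] := (se 1 0, se 1 1).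
  have sdet : smooth [set: gl] (fun P : gl => P 0 0 * P 1 1 - P 0 1 * P 1 0).
    by smooth_solve.
  by move=> P _; exact: (smooth_continuous sdet).
apply/seteqP; split=> [P /SL2xRP[a [b [c [d [e [D e0 ->]]]]]]|P] /=.
  rewrite !block3E; split; last by case: (mulmx1_unit (block3_inv D (lt0r_neq0 e0))).
  by do !split=> //; exact: ltW.
move=> [[[[[[h1 h2] h3] h4] h5] h6] uP]; apply/SL2xRP.
exists (P 0 0), (P 0 1), (P 1 0), (P 1 1), (P ord_max ord_max); split=> //.
  by rewrite lt0r h5 unitmx_row2.
exact: block3P.
Qed.

Lemma matrix_lie_group_Solv : matrix_lie_group (@Solv R).
Proof.
split.
- exists ([set P : gl | P 0 ord_max = 0] `&` [set P : gl | P 1 ord_max = 0] `&`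
    [set P : gl | P ord_max 0 = 0] `&` [set P : gl | P ord_max 1 = 0] `&`
    [set P : gl | 0 <= P ord_max ord_max] `&` [set P : gl | 0 <= P 0 0] `&`
    [set P : gl | P 1 0 = 0] `&` [set P : gl | P 1 1 = 1]).
    by do !(apply: closedI); do ?exact: closed_entry_eq; do ?exact: closed_entry_ge.
  apply/seteqP; split=> [P /SolvP[a [b [e [a0 e0 ->]]]]|P] /=.
    rewrite !block3E; split; first by do !split=> //; exact: ltW.
    have : block3 a b 0 1 e * block3 a^-1 (- b / a) 0 1 e^-1 = 1.
      rewrite block3M -block3_1; have := lt0r_neq0 a0; have := lt0r_neq0 e0.
      by move=> e1 a1; congr block3; field.
    by move=> /mulmx1_unit[].
  move=> [[[[[[[[h1 h2] h3] h4] h5] h6] h7] h8] uP]; apply/SolvP.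
  exists (P 0 0), (P 0 1), (P ord_max ord_max).
  split; last by rewrite {1}(block3P h1 h2 h3 h4) h7 h8.
  + rewrite lt0r h6 andbT; apply/eqP => h0.
    have := congr1 (fun Q : 'M[R]_3 => Q 0 0) (mulVmx uP).
    rewrite !mxE sum_ord3 h0 h7 h3 !mulr0 !addr0 => /eqP.
    by rewrite eqxx eq_sym oner_eq0.
  + by rewrite lt0r h5 unitmx_row2.
- by apply/SolvP; exists 1, 0, 1; rewrite block3_1 ltr01.
- move=> P Q /SolvP[a [b [e [a0 e0 ->]]]] /SolvP[a' [b' [e' [a0' e0' ->]]]].
  apply/SolvP; exists (a * a'), (a * b' + b), (e * e'); rewrite !mulr_gt0//.
  by split=> //; rewrite block3M; congr block3; ring.
- move=> P /SolvP[a [b [e [a0 e0 ->]]]].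
  have E : block3 a b 0 1 e * block3 a^-1 (- b / a) 0 1 e^-1 = 1.
    rewrite block3M -block3_1; have := lt0r_neq0 a0; have := lt0r_neq0 e0.
    by move=> e1 a1; congr block3; field.
  by rewrite (inv_of_mul E); apply/SolvP; exists a^-1, (- b / a), e^-1;
    rewrite !invr_gt0.
Qed.

(** Factorisation into unipotent matrices: upper with [x], lower with [y], upper with [z], lower
    with [t]. Scaling the four parameters joins the matrix to the identity while the determinant
    stays 1. *)
Lemma SL2xR_elementary a b c d : a * d - b * c = 1 -> exists x y z t,
  [/\ a = 1 + x * y + t * ((1 + x * y) * z + x), b = (1 + x * y) * z + x,
      c = y + t * (y * z + 1) & d = y * z + 1].
Proof.
move=> D.
have main a' c' : c' != 0 -> a' * d - b * c' = 1 ->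
    [/\ a' = 1 + (a' - 1) / c' * c', b = (1 + (a' - 1) / c' * c') * ((d - 1) / c') + (a' - 1) / c'
      & d = c' * ((d - 1) / c') + 1].
  move=> c0 D'; split; [by field| |by field].
  by apply: (eq_of_multiple (k := - c'^-1) D'); field.
(* For [c = 0] the second column is subtracted from the first, which makes the lower left entry
   [- d != 0]; undoing this is the factor with [t = 1]. *)
have [c0|c0] := eqVneq c 0.
  have d0 : d != 0.
    by apply/eqP => d0; move/eqP: D; rewrite d0 c0 !mulr0 subrr eq_sym oner_eq0.
  have [] := main (a - b) (c - d).
  - by rewrite c0 sub0r oppr_eq0.
  - by rewrite -D; ring.
  move=> h1 h2 h3; exists ((a - b - 1) / (c - d)), (c - d), ((d - 1) / (c - d)), 1.
  by split; [rewrite mul1r -h2 -h1; ring|exact: h2|rewrite mul1r -h3; ring|exact: h3].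
have [h1 h2 h3] := main a c c0 D.
exists ((a - 1) / c), c, ((d - 1) / c), 0.
by split; rewrite ?mul0r ?addr0.
Qed.

Lemma connected_SL2xR : connected (@SL2xR R).
Proof.
apply: connected_of_paths => P /SL2xRP[a [b [c [d [e [D e0 PE]]]]]].
have [x [y [z [t [ha hb hc hd]]]]] := SL2xR_elementary D.
pose f s : gl := block3
  (1 + (s * x) * (s * y) + (s * t) * ((1 + (s * x) * (s * y)) * (s * z) + s * x))
  ((1 + (s * x) * (s * y)) * (s * z) + s * x)
  (s * y + (s * t) * ((s * y) * (s * z) + 1)) ((s * y) * (s * z) + 1)
  (1 + s * (e - 1)).
exists f; split.
- have sf : smooth [set: R] f.
    have oT : open [set: R] by exact: openT.
    by apply: smooth_block3 => //; smooth_solve.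
  by move=> s; exact: (smooth_continuous sf).
- by rewrite /f -block3_1; congr block3; ring.
- by rewrite PE /f !mul1r ha hb hc hd; congr block3; ring.
- move=> s /andP[s0 s1]; apply/SL2xRP; rewrite /f; do 5!eexists; split; last by [].
    by ring.
  have : 0 <= s * e by rewrite mulr_ge0// ltW.
  have [->|/eqP s1'] := eqVneq s 1; first by move=> _; rewrite mul1r addrC subrK.
  have : s < 1 by rewrite lt_neqAle s1 andbT; apply/eqP.
  by lra.
Qed.

Lemma connected_Solv : connected (@Solv R).
Proof.
apply: connected_of_paths => P /SolvP[a [b [e [a0 e0 PE]]]].
pose f s : gl := block3 (1 + s * (a - 1)) (s * b) 0 1 (1 + s * (e - 1)).
have pos (x s : R) : 0 < x -> 0 <= s <= 1 -> 0 < 1 + s * (x - 1).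
  move=> x0 /andP[s0 s1]; have : 0 <= s * x by rewrite mulr_ge0// ltW.
  have [->|/eqP s1'] := eqVneq s 1; first by move=> _; rewrite mul1r addrC subrK.
  have : s < 1 by rewrite lt_neqAle s1 andbT; apply/eqP.
  by lra.
exists f; split.
- have sf : smooth [set: R] f.
    have oT : open [set: R] by exact: openT.
    by apply: smooth_block3 => //; smooth_solve.
  by move=> s; exact: (smooth_continuous sf).
- by rewrite /f -block3_1; congr block3; ring.
- by rewrite PE /f !mul1r; congr block3; ring.
- move=> s hs; apply/SolvP.
  by exists (1 + s * (a - 1)), (s * b), (1 + s * (e - 1)); split=> //; exact: pos.
Qed.

End LieGroupsOfIsometries.

(** * Transitivity and isotropy groups *)

Section TransitiveActions.
Context {R : realType}.
Local Notation gl := 'M[R]_3.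
Local Notation V := 'rV[R]_3.
Local Notation M := (@H2xR R).
Local Notation g := (@gH2xR R).
Implicit Types (P Q X Y Z : gl) (a b c d e l s t : R) (p q : V).

Lemma H2xR_origin : M (origin : V).
Proof. by rewrite /H2xR /= coordE. Qed.

Lemma smooth_fst_entry i j : smooth [set: gl * V] (fun z : gl * V => z.1 i j).
Proof.
have oT : open [set: gl * V] by exact: openT.
have h : smooth [set: gl * V] (@fst gl V).
  by apply: (smooth_linear oT (L := @fst gl V)) => x; exact: cvg_fst.
exact: (proj1 (smooth_mxP oT _) h).
Qed.

Lemma smooth_snd : smooth [set: gl * V] (fun z : gl * V => z.2).
Proof.
have oT : open [set: gl * V] by exact: openT.
by apply: (smooth_linear oT (L := @snd gl V)) => x; exact: cvg_snd.
Qed.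

Lemma smooth_subset {U W : normedModType R} (A B : set U) (f : U -> W) :
  A `<=` B -> smooth B f -> smooth A f.
Proof.
move=> AB sf n; elim: n f sf => [|n IH] f sf /=.
  by move=> p /AB; exact: (sf 0%N).
move=> v; split; first by move=> p /AB; exact: (sf 1%N v).1.
by apply: IH; exact: smooth_derive.
Qed.

Lemma open_smooth_gt0 {U : normedModType R} (f : U -> R) : smooth setT f ->
  open [set q | 0 < f q].
Proof.
move=> sf; apply: (@open_comp _ _ f [set t | 0 < t]); last exact: open_gt.
by move=> q _; exact: (smooth_continuous sf).
Qed.

Lemma smooth_mobius_family {U : normedModType R} (A : set U) (a b c d s : U -> R)
    (F : U -> V) : open A ->
  smooth A a -> smooth A b -> smooth A c -> smooth A d -> smooth A s -> smooth A F ->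
  (forall x : U, A x -> mobius_denom (c x) (d x) (F x) != 0) ->
  smooth A (fun x : U => mobius_map (a x) (b x) (c x) (d x) (s x) (F x)).
Proof.
by move=> oA sa sb sc sd ss sF n0; rewrite /mobius_map /mobius_denom; smooth_solve.
Qed.

Lemma mobius_map_comp a b c d s a' b' c' d' s' p :
  a * d - b * c != 0 -> 0 < a' * d' - b' * c' -> M p ->
  mobius_map (a * a' + b * c') (a * b' + b * d') (c * a' + d * c') (c * b' + d * d')
    (s + s') p = mobius_map a b c d s (mobius_map a' b' c' d' s' p).
Proof.
move=> D0 D0' Mp; have n0' := lt0r_neq0 (mobius_denom_gt0 (lt0r_neq0 D0') Mp).
have Mq := H2xR_mobius s' D0' Mp; have n0 := lt0r_neq0 (mobius_denom_gt0 D0 Mq).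
(* Cocycle identity for [|c w + d| ^ 2]; it clears the nested denominator. *)
have nE : mobius_denom (c * a' + d * c') (c * b' + d * d') p =
    mobius_denom c d (mobius_map a' b' c' d' s' p) * mobius_denom c' d' p.
  rewrite {2}/mobius_denom /mobius_map !coordE.
  by rewrite /mobius_denom in n0' *; field.
rewrite {1 2}/mobius_map nE; apply: coordP; rewrite !coordE; last by ring.
- move: n0; move: (mobius_denom c d _) => n n0.
  rewrite /mobius_map ?coordE; rewrite /mobius_denom in n0' *.
  by field; rewrite n0 n0'.
- move: n0; move: (mobius_denom c d _) => n n0.
  rewrite /mobius_map ?coordE; rewrite /mobius_denom in n0' *.
  by field; rewrite n0 n0'.
Qed.

Lemma mobius_map_id p : mobius_map 1 0 0 1 0 p = p.
Proof. by rewrite /mobius_map /mobius_denom; apply: coordP; rewrite !coordE; field. Qed.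

Lemma transitive_isometric_SL2xR : transitive_isometric_action M g (@SL2xR R) act_SL2xR.
Proof.
split.
- have sE := smooth_fst_entry; have s2 := smooth_snd.
  have oT : open [set: gl * V] by exact: openT.
  have [s00 s01] := (sE 0 0, sE 0 1); have [s10 s11] := (sE 1 0, sE 1 1).
  have s22 := sE ord_max ord_max.
  have sn : smooth [set: gl * V] (fun z : gl * V => mobius_denom (z.1 1 0) (z.1 1 1) z.2).
    by rewrite /mobius_denom; smooth_solve.
  (* An open set of pairs containing those of the group and the space, on which the logarithm and
     the quotient stay smooth. *)
  pose U := [set z : gl * V | 0 < z.1 ord_max ord_max] `&`
    [set z : gl * V | 0 < mobius_denom (z.1 1 0) (z.1 1 1) z.2].
  have oU : open U by apply: openI; exact: open_smooth_gt0.
  have UT : U `<=` setT by [].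
  exists U, (fun z : gl * V => act_SL2xR z.1 z.2); split=> //.
    move=> [P p] [/= /SL2xRP[a [b [c [d [e [D e0 ->]]]]]] Mp].
    rewrite /U /= !block3E; split=> //; apply: (mobius_denom_gt0 (a := a) (b := b)) => //.
    by rewrite D oner_eq0.
  rewrite (_ : (fun z : gl * V => _) = fun z : gl * V => mobius_map (z.1 0 0) (z.1 0 1)
      (z.1 1 0) (z.1 1 1) (ln (z.1 ord_max ord_max)) z.2); last first.
    by apply/funext => z; rewrite act_SL2xRE.
  apply: smooth_mobius_family => //; try exact: smooth_subset UT _.
    apply: smooth_ln => //; first exact: smooth_subset UT s22.
    by move=> z [].
  by move=> z [_ /lt0r_neq0].
- by move=> p Mp; rewrite act_SL2xRE -block3_1 !block3E ln1 mobius_map_id.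
- move=> P Q p /SL2xRP[a [b [c [d [e [D e0 ->]]]]]].
  move=> /SL2xRP[a' [b' [c' [d' [e' [D' e0' ->]]]]]] Mp.
  rewrite !act_SL2xRE block3M !block3E lnM ?posrE// mobius_map_comp//.
    by rewrite D oner_eq0.
  by rewrite D' ltr01.
- move=> P /SL2xRP[a [b [c [d [e [D e0 ->]]]]]].
  rewrite (_ : act_SL2xR _ = mobius_map a b c d (ln e)).
    by apply: isometry_mobius; rewrite D.
  by apply/funext => p; rewrite act_SL2xRE !block3E.
- move=> p q Mp Mq; have py : 0 < cy p by []. have qy : 0 < cy q by [].
  (* An upper triangular matrix of determinant 1 with diagonal entry [r] scales the half plane by
     [r ^ 2], hence the square root. *)
  pose r := Num.sqrt (cy q / cy p).
  have r0 : 0 < r by rewrite sqrtr_gt0 divr_gt0.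
  have rr : r ^+ 2 = cy q / cy p by rewrite sqr_sqrtr// ltW// divr_gt0.
  exists (block3 r ((cx q - r ^+ 2 * cx p) / r) 0 r^-1 (expR (cz q - cz p))).
    apply/SL2xRP; do 5!eexists; split; last by []; last exact: expR_gt0.
    by rewrite mulr0 subr0 divff ?lt0r_neq0.
  rewrite act_SL2xRE !block3E expRK /mobius_map /mobius_denom.
  have r1 := lt0r_neq0 r0; have p1 := lt0r_neq0 py.
  apply: coordP; rewrite !coordE; last by ring.
    by field.
  have -> : cy q = r ^+ 2 * cy p by rewrite rr divfK.
  by field.
Qed.

Lemma transitive_isometric_Solv : transitive_isometric_action M g (@Solv R) act_Solv.
Proof.
split.
- have sE := smooth_fst_entry; have s2 := smooth_snd.
  have oT : open [set: gl * V] by exact: openT.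
  pose U := [set z : gl * V | 0 < z.1 ord_max ord_max].
  have oU : open U by exact: open_smooth_gt0 (sE ord_max ord_max).
  have UT : U `<=` setT by [].
  (* The Mobius form, which agrees with [act_Solv] on the group, serves as smooth extension. *)
  exists U, (fun z : gl * V => mobius_map (z.1 0 0) (z.1 0 1) 0 1 (ln (z.1 ord_max ord_max)) z.2).
  split=> //.
  + by move=> [P p] [/= /SolvP[a [b [e [a0 e0 ->]]]] Mp]; rewrite /U /= block3E.
  + apply: smooth_mobius_family => //; try exact: smooth_subset UT _.
    * exact: smooth_cst.
    * exact: smooth_cst.
    * by apply: smooth_ln => //; exact: smooth_subset UT (sE ord_max ord_max).
    * move=> z _; rewrite /mobius_denom !mul0r add0r expr1n expr0n addr0.
      exact: oner_neq0.
  + by move=> [P p] [/= GP Mp]; rewrite act_SolvE.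
- move=> p Mp; rewrite act_SolvE; last by apply/SolvP; exists 1, 0, 1; rewrite block3_1 ltr01.
  by rewrite -block3_1 !block3E ln1 mobius_map_id.
- move=> P Q p GP GQ Mp; have [_ _ GM _] := @matrix_lie_group_Solv R.
  rewrite !act_SolvE//; last exact: GM.
  move: GP GQ => /SolvP[a [b [e [a0 e0 ->]]]] /SolvP[a' [b' [e' [a0' e0' ->]]]].
  rewrite block3M !block3E lnM ?posrE// -mobius_map_comp//.
  + by congr mobius_map; ring.
  + by rewrite mulr1 mulr0 subr0 lt0r_neq0.
  + by rewrite mulr1 mulr0 subr0.
- move=> P GP; rewrite (_ : act_Solv P =
      mobius_map (P 0 0) (P 0 1) 0 1 (ln (P ord_max ord_max))).
    move: GP => /SolvP[a [b [e [a0 e0 ->]]]].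
    by apply: isometry_mobius; rewrite !block3E mulr1 mulr0 subr0.
  by apply/funext => p; rewrite act_SolvE.
- move=> p q Mp Mq; have py : 0 < cy p by []. have qy : 0 < cy q by [].
  have G : Solv (block3 (cy q / cy p) (cx q - cy q / cy p * cx p) 0 1
      (expR (cz q - cz p))).
    apply/SolvP; do 3!eexists; split; last by []; last exact: expR_gt0.
    exact: divr_gt0.
  exists (block3 (cy q / cy p) (cx q - cy q / cy p * cx p) 0 1 (expR (cz q - cz p))) => //.
  rewrite act_SolvE// !block3E expRK /mobius_map /mobius_denom.
  have p1 := lt0r_neq0 py.
  by apply: coordP; rewrite !coordE; field.
Qed.

Lemma isotropy_SL2xR : SO2 = [set P : gl | SL2xR P /\ act_SL2xR P origin = origin].
Proof.
apply/seteqP; split=> [P /SO2P[a [b [E ->]]]|P [/SL2xRP[a [b [c [d [e [D e0 ->]]]]]]]] /=.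
  have D : a * a - b * - b = 1 by apply: etrans E; ring.
  split; first by apply/SL2xRP; exists a, b, (- b), a, 1; rewrite ltr01.
  rewrite act_SL2xRE !block3E ln1 /mobius_map /mobius_denom !coordE.
  have n0 : (- b * 0 + a) ^+ 2 + (- b * 1) ^+ 2 = 1.
    by apply: etrans E; ring.
  rewrite n0 D; apply: coordP; rewrite !coordE ?addr0//.
    by field.
  by rewrite mul1r divr1.
rewrite act_SL2xRE !block3E /mobius_map /mobius_denom !coordE => E.
have := congr1 (@cx R) E; have := congr1 (@cy R) E; have := congr1 (@cz R) E.
rewrite !coordE => E3 E2 E1.
have e1 : e = 1.
  by apply: ln_inj; rewrite ?posrE// ln1 -[LHS]add0r.
(* The second coordinate of the image of [i] is [1 / |c i + d| ^ 2]. *)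
have n0 : (c * 0 + d) ^+ 2 + (c * 1) ^+ 2 = 1.
  by move: E2; rewrite D mulr1 mul1r => E2; rewrite -[LHS]invrK E2 invr1.
rewrite n0 divr1 in E1.
have cd : c ^+ 2 + d ^+ 2 = 1 by rewrite -n0; ring.
have ac : a * c + b * d = 0 by rewrite -[RHS]E1; ring.
apply/SO2P; exists d, (- c); split; first by rewrite -cd; ring.
rewrite e1 opprK; congr block3.
- by rewrite -[LHS]mulr1 -cd -[RHS]mulr1 -D; apply: (eq_of_multiple (k := c) ac); ring.
- by rewrite -[LHS]mulr1 -cd -[RHS]mulr1 -D; apply: (eq_of_multiple (k := d) ac); ring.
Qed.

Lemma isotropy_Solv :
  [set 1] = [set P : gl | Solv P /\ act_Solv P origin = origin].
Proof.
apply/seteqP; split=> [P ->|P [GP]] /=.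
  have G1 : Solv (1 : gl) by apply/SolvP; exists 1, 0, 1; rewrite block3_1 ltr01.
  by split=> //; rewrite act_SolvE// -block3_1 !block3E ln1 mobius_map_id.
rewrite act_SolvE//; move: GP => /SolvP[a [b [e [a0 e0 ->]]]].
rewrite !block3E /mobius_map /mobius_denom !coordE => E.
have := congr1 (@cx R) E; have := congr1 (@cy R) E; have := congr1 (@cz R) E.
rewrite !coordE => E3 E2 E1.
have e1 : e = 1 by apply: ln_inj; rewrite ?posrE// ln1 -[LHS]add0r.
have a1 : a = 1 by rewrite -[RHS]E2; field.
have b0 : b = 0 by rewrite -[RHS]E1; field.
by rewrite e1 a1 b0 block3_1.
Qed.

End TransitiveActions.

(** * Lie algebras, reductive complements and the tensors they determine *)

Section CosetRepresentations.
Context {R : realType}.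
Local Notation gl := 'M[R]_3.
Local Notation V := 'rV[R]_3.
Local Notation M := (@H2xR R).
Local Notation g := (@gH2xR R).
Implicit Types (P Q X Y Z A B C : gl) (a b c d e l s t : R) (p q : V).

Lemma memv_span3 A B C X : X \in (<[A]> + <[B]> + <[C]>)%VS <->
  exists u v w, X = u *: A + v *: B + w *: C.
Proof.
split=> [/memv_addP[X1 /memv_addP[X2 /vlineP[u ->]] [X3 /vlineP[v ->] ->]]
    [X4 /vlineP[w ->] ->]|[u [v [w ->]]]]; first by exists u, v, w.
by rewrite !memv_add// memvZ// memv_line.
Qed.

Lemma tangent_entry0 (G : set gl) X i j x : (forall P, G P -> P i j = x) ->
  lie_algebra G X -> X i j = 0.
Proof.
move=> h LX; have := @expmx_entries_tangent R 2 X i j i j 1 0 x.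
rewrite mul1r mul0r addr0; apply => t.
by rewrite mul1r mul0r addr0; apply: h; exact: LX.
Qed.

(** Liouville's formula in the traceless case: the derivative of the determinant is the trace times
    the determinant. *)
Lemma det_expmx_block3 a b c e t : let E := expmx (t *: block3 a b c (- a) e) in
  E 0 0 * E 1 1 - E 0 1 * E 1 0 = 1.
Proof.
set X := block3 a b c (- a) e.
pose f (s : R) := expmx (s *: X) 0 0 * expmx (s *: X) 1 1
  - expmx (s *: X) 0 1 * expmx (s *: X) 1 0.
have df (s : R) : is_derive s 1 f 0.
  have d00 := is_derive_expmx X 0 0 s; have d01 := is_derive_expmx X 0 1 s.
  have d10 := is_derive_expmx X 1 0 s; have d11 := is_derive_expmx X 1 1 s.
  rewrite mxE sum_ord3 /X !block3E -/X in d00.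
  rewrite mxE sum_ord3 /X !block3E -/X in d01.
  rewrite mxE sum_ord3 /X !block3E -/X in d10.
  rewrite mxE sum_ord3 /X !block3E -/X in d11.
  by rewrite /f; derive_by; ring.
have : f t = f 0 by exact: is_derive_0_is_cst.
by rewrite /= /f expmx_scale0 -block3_1 !block3E mulr1 mulr0 subr0.
Qed.

Lemma lie_algebra_SL2xRP X : lie_algebra SL2xR X <->
  exists a b c e, X = block3 a b c (- a) e.
Proof.
split=> [LX|[a [b [c [e ->]]]] t].
  have entry i j : (forall a b c d e, block3 a b c d e i j = 0) -> X i j = 0.
    by move=> h; apply: tangent_entry0 LX => P /SL2xRP[a [b [c [d [e [_ _ ->]]]]]].
  have XE := block3P (entry _ _ block3_02) (entry _ _ block3_12)
    (entry _ _ block3_20) (entry _ _ block3_21).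
  (* The trace is the derivative at 0 of the determinant, which is constantly 1 along the
     exponential. *)
  have tr : X 0 0 + X 1 1 = 0.
    have d00 := is_derive_expmx0 X 0 0; have d01 := is_derive_expmx0 X 0 1.
    have d10 := is_derive_expmx0 X 1 0; have d11 := is_derive_expmx0 X 1 1.
    have d1 : is_derive (0 : R) 1 (fun t : R => expmx (t *: X) 0 0 * expmx (t *: X) 1 1
        - expmx (t *: X) 0 1 * expmx (t *: X) 1 0) (X 0 0 + X 1 1).
      by derive_by; rewrite !expmx_scale0 -block3_1 !block3E; ring.
    apply: (derive_unique d1).
    rewrite (_ : (fun t : R => _) = fun=> 1); first exact: is_derive_fun_cst.
    apply/funext => t; have /SL2xRP[a [b [c [d [e [D _ ->]]]]]] := LX t.
    by rewrite !block3E.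
  exists (X 0 0), (X 0 1), (X 1 0), (X ord_max ord_max); rewrite {1}XE.
  by congr block3; rewrite -[RHS]addr0 -tr addKr.
apply/SL2xRP; rewrite expmx_block3; do 5!eexists; split; last by [].
  exact: det_expmx_block3.
exact: expR_gt0.
Qed.

Lemma block3_rotationX r n : exists a b,
  block3 0 r (- r) 0 0 ^+ n = block3 a b (- b) a (0 ^+ n).
Proof.
elim: n => [|n [a [b IH]]].
  by exists 1, 0; rewrite !expr0 oppr0 block3_1.
rewrite exprS IH block3M exprS; exists (- (r * b)), (r * a).
by congr block3; ring.
Qed.

(** The exponential of a rotation generator has the shape of a rotation because all its powers are
    scaled rotations, and unit norm because its determinant is 1. *)
Lemma lie_algebra_SO2P X : lie_algebra SO2 X <->
  exists r, X = block3 0 r (- r) 0 0.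
Proof.
split=> [LX|[r ->] t].
  have LX' : lie_algebra SL2xR X.
    by move=> t; have := LX t; rewrite isotropy_SL2xR => -[].
  have /lie_algebra_SL2xRP[a [b [c [e XE]]]] := LX'.
  have e0 : X ord_max ord_max = 0.
    by apply: (tangent_entry0 (x := 1)) LX => P /SO2P[? [? [_ ->]]]; rewrite block3E.
  have h1 := @expmx_entries_tangent R 2 X 0 0 1 1 1 (- 1) 0.
  have h2 := @expmx_entries_tangent R 2 X 0 1 1 0 1 1 0.
  have E1 : 1 * X 0 0 + - 1 * X 1 1 = 0.
    apply: h1 => t; have /SO2P[? [? [_ ->]]] := LX t; rewrite !block3E; ring.
  have E2 : 1 * X 0 1 + 1 * X 1 0 = 0.
    apply: h2 => t; have /SO2P[? [? [_ ->]]] := LX t; rewrite !block3E; ring.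
  rewrite XE !block3E in E1 E2 e0; exists b; rewrite XE e0.
  have a0 : a = 0 by lra.
  have cb : c = - b by lra.
  by rewrite a0 cb oppr0.
have h1 := @expmx_entries R 2 (block3 0 r (- r) 0 0) 0 0 1 1 1 (- 1) t.
have h2 := @expmx_entries R 2 (block3 0 r (- r) 0 0) 0 1 1 0 1 1 t.
have D := det_expmx_block3 0 r (- r) 0 t; rewrite oppr0 in D.
apply/SO2P; rewrite expmx_block3 mul0r expR0.
move: h1 h2 D => /=; set E := expmx _ => h1 h2 D.
have E1 : 1 * E 0 0 + - 1 * E 1 1 = 0.
  by apply: h1 => n; have [a [b ->]] := block3_rotationX r n; rewrite !block3E; ring.
have E2 : 1 * E 0 1 + 1 * E 1 0 = 0.
  by apply: h2 => n; have [a [b ->]] := block3_rotationX r n; rewrite !block3E; ring.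
have lin (x y : R) : 1 * x + - 1 * y = 0 -> y = x by lra.
have lin' (x y : R) : 1 * x + 1 * y = 0 -> y = - x by lra.
have E11 := lin _ _ E1; have E10 := lin' _ _ E2.
exists (E 0 0), (E 0 1); rewrite E11 E10; split=> //.
by rewrite E11 E10 in D; apply: etrans D; ring.
Qed.

Lemma lie_algebra_SolvP X : lie_algebra Solv X <->
  exists a b e, X = block3 a b 0 0 e.
Proof.
split=> [LX|[a [b [e ->]]] t].
  have entry i j x : (forall a b e, block3 a b 0 1 e i j = x) -> X i j = 0.
    by move=> h; apply: (tangent_entry0 (x := x)) LX => P /SolvP[a [b [e [_ _ ->]]]].
  have XE := block3P (entry _ _ _ (fun a b e => block3_02 a b 0 1 e))
    (entry _ _ _ (fun a b e => block3_12 a b 0 1 e))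
    (entry _ _ _ (fun a b e => block3_20 a b 0 1 e))
    (entry _ _ _ (fun a b e => block3_21 a b 0 1 e)).
  exists (X 0 0), (X 0 1), (X ord_max ord_max); rewrite {1}XE.
  by rewrite (entry _ _ _ (fun a b e => block3_10 a b 0 1 e))
    (entry _ _ _ (fun a b e => block3_11 a b 0 1 e)).
pose X0 := block3 a b 0 0 e.
have d i j (s : R) := is_derive_expmx X0 i j s.
(* The second row of [X0] is zero, so the second row of the exponential is constant. *)
have d10 (s : R) : is_derive s 1 (fun s : R => expmx (s *: X0) 1 0) (0 * expmx (s *: X0) 1 0).
  by apply: is_derive_eq (d 1 0 s) _; rewrite mxE sum_ord3 /X0 !block3E; ring.
have d11 (s : R) : is_derive s 1 (fun s : R => expmx (s *: X0) 1 1) (0 * expmx (s *: X0) 1 1).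
  by apply: is_derive_eq (d 1 1 s) _; rewrite mxE sum_ord3 /X0 !block3E; ring.
have E10 s : expmx (s *: X0) 1 0 = 0.
  by rewrite (linear_ode d10) expmx_scale0 -block3_1 block3E mul0r.
have E11 s : expmx (s *: X0) 1 1 = 1.
  by rewrite (linear_ode d11) expmx_scale0 -block3_1 block3E mul0r expR0 mulr1.
have d00 (s : R) : is_derive s 1 (fun s : R => expmx (s *: X0) 0 0) (a * expmx (s *: X0) 0 0).
  by apply: is_derive_eq (d 0 0 s) _; rewrite mxE sum_ord3 E10 /X0 !block3E; ring.
apply/SolvP; rewrite expmx_block3 -/X0 E10 E11; do 3!eexists; split; last by [].
  rewrite (linear_ode d00) expmx_scale0 -block3_1 block3E mul1r.
  exact: expR_gt0.
exact: expR_gt0.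
Qed.

(** The bracket with [J] acts on the symmetric traceless matrices as twice the rotation [rotJ] of
    the tangent plane, hence [l / 2]. The multiple of [J] leaves the fundamental field at the origin
    unchanged. *)
Definition m_product l : {vspace gl} :=
  (<[block3 1 0 0 (- 1) 0]> + <[block3 0 1 1 0 0]> +
   <[block3 0 (l / 2) (- (l / 2)) 0 1]>)%VS.

Lemma m_productP l X : X \in m_product l <-> exists u v w,
  X = block3 u (v + l / 2 * w) (v - l / 2 * w) (- u) w.
Proof.
have E u v w : u *: block3 1 0 0 (- 1) 0 + v *: block3 0 1 1 0 0 +
    w *: block3 0 (l / 2) (- (l / 2)) 0 1 =
    block3 u (v + l / 2 * w) (v - l / 2 * w) (- u) w.
  by rewrite !block3Z !block3D; congr block3; ring.
split=> [/memv_span3[u [v [w ->]]]|[u [v [w ->]]]]; first by exists u, v, w; rewrite E.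
by apply/memv_span3; exists u, v, w; rewrite E.
Qed.

Lemma reductive_SL2xR l : reductive_decomposition SL2xR SO2 (m_product l).
Proof.
split.
- move=> X /m_productP[u [v [w ->]]]; apply/lie_algebra_SL2xRP; by do 4!eexists.
- move=> X /m_productP[u [v [w ->]]] /lie_algebra_SO2P[r E].
  have h i j := congr1 (fun P : gl => P i j) E.
  have := h 0 0; have := h 0 1; have := h 1 0; have := h ord_max ord_max.
  rewrite !block3E => w0; rewrite w0 mulr0 subr0 addr0 => v1 v2 u0.
  have v0 : v = 0 by lra.
  by rewrite u0 v0 oppr0 block3_0.
- move=> X /lie_algebra_SL2xRP[a [b [c [e ->]]]].
  exists (block3 a ((b + c) / 2 + l / 2 * e) ((b + c) / 2 - l / 2 * e) (- a) e).
  (* The skew part of the matrix, less the share contributed by the third generator of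
     [m_product]. *)
  pose r := (b - c) / 2 - l / 2 * e; exists (block3 0 r (- r) 0 0); split.
  + by apply/m_productP; exists a, ((b + c) / 2), e.
  + by apply/lie_algebra_SO2P; exists r.
  + by rewrite block3D /r; congr block3; field.
- move=> h X /SO2P[a [b [E ->]]] /m_productP[u [v [w ->]]].
  have D : a * a - b * - b = 1 by apply: etrans E; ring.
  rewrite (inv_of_mul (block3_inv D (oner_neq0 _))) !block3M; apply/m_productP.
  (* Conjugation by a rotation turns the symmetric traceless matrices by twice the angle. *)
  exists ((a ^+ 2 - b ^+ 2) * u + 2 * a * b * v), ((a ^+ 2 - b ^+ 2) * v - 2 * a * b * u), w.
  rewrite opprK invr1; congr block3; try ring.
  + by apply: (eq_of_multiple (k := l / 2 * w) E); ring.
  + by apply: (eq_of_multiple (k := - (l / 2 * w)) E); ring.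
Qed.

Definition m_solvable : {vspace gl} :=
  (<[block3 1 0 0 0 0]> + <[block3 0 1 0 0 0]> + <[block3 0 0 0 0 1]>)%VS.

Lemma m_solvableP X : X \in m_solvable <-> exists a b e, X = block3 a b 0 0 e.
Proof.
have E u v w : u *: block3 1 0 0 0 0 + v *: block3 0 1 0 0 0 +
    w *: block3 0 0 0 0 1 = block3 u v 0 0 w.
  by rewrite !block3Z !block3D; congr block3; ring.
split=> [/memv_span3[u [v [w ->]]]|[u [v [w ->]]]]; first by exists u, v, w; rewrite E.
by apply/memv_span3; exists u, v, w; rewrite E.
Qed.

Lemma reductive_Solv : reductive_decomposition Solv [set 1] m_solvable.
Proof.
split.
- by move=> X /m_solvableP h; apply/lie_algebra_SolvP.
- move=> X _ LX; apply/matrixP => i j; rewrite mxE.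
  by apply: (tangent_entry0 (x := (1 : gl) i j)) LX => P ->.
- move=> X /lie_algebra_SolvP h; exists X, 0; rewrite addr0; split=> //.
    exact/m_solvableP.
  by move=> t; rewrite scaler0 /= -(scale0r (1 : gl)) expmx_scale0.
- by move=> h X -> Xm; rewrite mul1r invr1 mulr1.
Qed.

(** On the Lie algebra of [SL2xR] the kernel is that of [SO2], so evaluation at the origin projects
    brackets to the complement. *)
Lemma fundamental_SL2xR X : fundamental act_SL2xR X origin =
  pt (X 0 1 + X 1 0) (X 0 0 - X 1 1) (X ord_max ord_max).
Proof.
rewrite /fundamental derive1E; apply: derive_val.
rewrite (_ : (fun t : R => _) = fun t : R => mobius_map (expmx (t *: X) 0 0)
  (expmx (t *: X) 0 1) (expmx (t *: X) 1 0) (expmx (t *: X) 1 1)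
  (ln (expmx (t *: X) ord_max ord_max)) origin); last first.
  by apply/funext => t; rewrite act_SL2xRE.
have d00 := is_derive_expmx0 X 0 0; have d01 := is_derive_expmx0 X 0 1.
have d10 := is_derive_expmx0 X 1 0; have d11 := is_derive_expmx0 X 1 1.
have d22 := is_derive_expmx0 X ord_max ord_max.
have E : expmx ((0 : R) *: X) = block3 1 0 0 1 1 by rewrite expmx_scale0 block3_1.
rewrite /mobius_map /mobius_denom.
have n0 : (expmx ((0 : R) *: X) 1 0 * cx origin + expmx ((0 : R) *: X) 1 1) ^+ 2
    + (expmx ((0 : R) *: X) 1 0 * cy origin) ^+ 2 != 0.
  by rewrite E !block3E !coordE mul0r add0r mul0r expr1n expr0n addr0 oner_neq0.
have e0 : 0 < expmx ((0 : R) *: X) ord_max ord_max by rewrite E block3E ltr01.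
have dln := is_derive_fun_comp (is_derive1_ln e0) d22.
eapply is_derive_eq; first by eapply is_derive_pt; derive_solve.
rewrite E !block3E !coordE; apply: coordP; rewrite !coordE /=; by field.
Qed.

Lemma fundamental_Solv a b e : fundamental act_Solv (block3 a b 0 0 e) origin = pt b a e.
Proof.
set X := block3 a b 0 0 e.
have LX : lie_algebra Solv X by apply/lie_algebra_SolvP; exists a, b, e.
rewrite /fundamental derive1E; apply: derive_val.
rewrite (_ : (fun t : R => _) = fun t : R => mobius_map (expmx (t *: X) 0 0)
  (expmx (t *: X) 0 1) 0 1 (ln (expmx (t *: X) ord_max ord_max)) origin); last first.
  by apply/funext => t; rewrite act_SolvE//; exact: LX.
have d00 := is_derive_expmx0 X 0 0; have d01 := is_derive_expmx0 X 0 1.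
have d22 := is_derive_expmx0 X ord_max ord_max.
have E : expmx ((0 : R) *: X) = block3 1 0 0 1 1 by rewrite expmx_scale0 block3_1.
rewrite /mobius_map /mobius_denom.
have n0 : (0 * cx origin + 1) ^+ 2 + (0 * cy origin) ^+ 2 != 0 :> R.
  by rewrite !mul0r add0r expr1n expr0n addr0 oner_neq0.
have e0 : 0 < expmx ((0 : R) *: X) ord_max ord_max by rewrite E block3E ltr01.
have dln := is_derive_fun_comp (is_derive1_ln e0) d22.
eapply is_derive_eq; first by eapply is_derive_pt; derive_solve.
rewrite E /X !block3E !coordE; apply: coordP; rewrite !coordE /=; by field.
Qed.

(** [theta3] is invariant under translations of the line, and the differential commutes with [J]. *)
Lemma mobius_intertwines_T_product l a b c d s : 0 < a * d - b * c ->
  intertwines M (T_product l) (T_product l) (mobius_map a b c d s).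
Proof.
move=> D p Mp u v; have D0 := lt0r_neq0 D; have Mq := H2xR_mobius s D Mp.
by rewrite !diff_mobius// !T_productE// mobius_diff_rotJ /mobius_diff coordE.
Qed.

(** [dx / y] is invariant under [w -> a w + b]; unlike [theta3] it is not preserved by all of
    [SL2xR]. *)
Lemma affine_intertwines_T_solvable a b s : 0 < a ->
  intertwines M (@T_solvable R) (@T_solvable R) (mobius_map a b 0 1 s).
Proof.
move=> a0 p Mp u v; have D : 0 < a * 1 - b * 0 by rewrite mulr1 mulr0 subr0.
have D0 := lt0r_neq0 D; have Mq := H2xR_mobius s D Mp.
rewrite !diff_mobius// !T_solvableE// mobius_diff_rotJ; congr (_ *: _).
rewrite /mobius_diff /mobius_map /mobius_denom !coordE.
by have y0 := cy_neq0 Mp; have a1 := lt0r_neq0 a0; field; rewrite y0 a1.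
Qed.

Lemma coset_representation_T_product l :
  coset_representation M g (T_product l) SL2xR act_SL2xR origin SO2.
Proof.
split.
- by split; [exact: matrix_lie_group_SL2xR|exact: connected_SL2xR].
- exact: transitive_isometric_SL2xR.
- by split; [exact: H2xR_origin|exact: isotropy_SL2xR].
exists (m_product l); first exact: reductive_SL2xR.
split.
- by have [] := homogeneous_T_product l.
- move=> P /SL2xRP[a [b [c [d [e [D e0 ->]]]]]].
  rewrite (_ : act_SL2xR _ = mobius_map a b c d (ln e)).
    by apply: mobius_intertwines_T_product; rewrite D.
  by apply/funext => p; rewrite act_SL2xRE !block3E.
- move=> X Y Z /m_productP[u [v [w ->]]] /m_productP[u' [v' [w' ->]]].
  move=> /m_productP[u2 [v2 [w2 ->]]] st; rewrite /st !brk_block3 !fundamental_SL2xR.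
  rewrite !block3E T_productE; last exact: H2xR_origin.
  by rewrite /gH2xR /rotJ !coordE; field.
Qed.

Lemma coset_representation_T_solvable :
  coset_representation M g (@T_solvable R) Solv act_Solv origin [set 1].
Proof.
split.
- by split; [exact: matrix_lie_group_Solv|exact: connected_Solv].
- exact: transitive_isometric_Solv.
- by split; [exact: H2xR_origin|exact: isotropy_Solv].
exists m_solvable; first exact: reductive_Solv.
split.
- by have [] := @homogeneous_T_solvable R.
- move=> P GP; rewrite (_ : act_Solv P =
      mobius_map (P 0 0) (P 0 1) 0 1 (ln (P ord_max ord_max))).
    move: GP => /SolvP[a [b [e [a0 e0 ->]]]].
    by apply: affine_intertwines_T_solvable; rewrite block3E.
  by apply/funext => p; rewrite act_SolvE.
- move=> X Y Z /m_solvableP[a [b [e ->]]] /m_solvableP[a' [b' [e' ->]]].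
  move=> /m_solvableP[a2 [b2 [e2 ->]]] st; rewrite /st !brk_block3.
  rewrite !(mul0r, mulr0, subr0, addr0) !fundamental_Solv.
  rewrite T_solvableE; last exact: H2xR_origin.
  by rewrite /gH2xR /rotJ !coordE; field.
Qed.

End CosetRepresentations.

Theorem theorem2 (R : realType) :
  (forall l : R, 0 <= l -> homogeneous_structure H2xR gH2xR (T_product l)) /\
  homogeneous_structure H2xR gH2xR (@T_solvable R) /\
  (forall T : @tensor12 R 3, homogeneous_structure H2xR gH2xR T ->
     exists! c : option R,
       listed c /\ isomorphic H2xR gH2xR T H2xR gH2xR (T_listed c)) /\
  (forall l : R, 0 <= l ->
     coset_representation H2xR gH2xR (T_product l)
       SL2xR act_SL2xR origin SO2) /\
  coset_representation H2xR gH2xR (@T_solvable R)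
    Solv act_Solv origin [set 1].
Proof.
split; first by move=> l _; exact: homogeneous_T_product.
split; first exact: homogeneous_T_solvable.
split; last first.
  split; last exact: coset_representation_T_solvable.
  by move=> l _; exact: coset_representation_T_product.
move=> T /homogeneous_structure_listed[k [lk ik]]; exists k; split=> // k' [lk' ik'].
exact: listed_unique lk lk' ik ik'.
Qed.
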